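(* Let $n\ge 2$, $1\le k<n$, $\lambda>0$, and let $P_n(\boldsymbol\theta)=\sum_{T\subset[n]}p_T\boldsymbol\theta^T$ be an affine polynomial with $p_\varnothing=1$, $p_T\ne0$ for all $T\subset[n]$, $p_{[j]}>0$ for $j=1,\dots,n$, such that the multivariate gamma distribution $\boldsymbol\gamma_{(P_n,\lambda)}$ exists and is infinitely divisible. Let $\mathbf X=(X_1,\dots,X_n)\sim\boldsymbol\gamma_{(P_n,\lambda)}$. Let $$Q_{[n]\setminus[k]}(\theta_{k+1},\dots,\theta_n)=\prod_{i=k+1}^n\big[1+\theta_i(-\widetilde p_i)^{-1}\big]$$ and, with $c_{\boldsymbol\alpha,\lambda}(R_n)$ the coefficients defined by $[1-R_n(\mathbf z)]^{-\lambda}=\sum_{\boldsymbol\alpha\in\mathbb N^n}c_{\boldsymbol\alpha,\lambda}(R_n)\mathbf z^{\boldsymbol\alpha}$ near $\mathbf z=\mathbf 0$, $$\mathbf F_k(\lambda,R_n,\mathbf x_{[k]},\boldsymbol\theta_{[n]\setminus[k]})=\sum_{\boldsymbol\alpha\in\mathbb N^n,\ c_{\boldsymbol\alpha,\lambda}(R_n)\neq0}\frac{\prod_{i=1}^kx_i^{\alpha_i}}{\prod_{i=1}^k(\lambda)_{\alpha_i}}\,c_{\boldsymbol\alpha,\lambda}(R_n)\prod_{i=k+1}^n(\theta_i-\widetilde p_i)^{-\alpha_i}.$$ Then the Laplace transform of $\mathbf X_{[n]\setminus[k]}=(X_{k+1},\dots,X_n)$ given $\mathbf X_{[k]}=(X_1,\dots,X_k)=\mathbf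 x_{[k]}=(x_1,\dots,x_k)$ is $$L_{\mathbf X_{[n]\setminus[k]}}^{\mathbf X_{[k]}=\mathbf x_{[k]}}(\boldsymbol\theta_{[n]\setminus[k]})=\big[Q_{[n]\setminus[k]}(\boldsymbol\theta_{[n]\setminus[k]})\big]^{-\lambda}\,\frac{\mathbf F_k(\lambda,R_n,\mathbf x_{[k]},\boldsymbol\theta_{[n]\setminus[k]})}{\mathbf F_k(\lambda,R_n,\mathbf x_{[k]},\mathbf 0_{[n]\setminus[k]})}.$$
   Context: Notation: $\mathbb N=\{0,1,2,\dots\}$, $[n]=\{1,\dots,n\}$, $\overline T=[n]\setminus T$, $\mathbf z^T=\prod_{t\in T}z_t$, $\mathbf z^{\boldsymbol\alpha}=\prod_iz_i^{\alpha_i}$, $\boldsymbol\theta_{[n]\setminus[k]}=(\theta_{k+1},\dots,\theta_n)$, $(\lambda)_m=\Gamma(\lambda+m)/\Gamma(\lambda)$. An affine polynomial is a polynomial of degree at most one in each variable. The multivariate gamma distribution $\boldsymbol\gamma_{(P,\lambda)}$ is the probability distribution on $\mathbb R^n$ of a random vector $\mathbf X$ with $\mathbb E[\exp(-\sum_i\theta_iX_i)]=[P(\boldsymbol\theta)]^{-\lambda}$ for $\boldsymbol\theta$ in a set with non-empty interior; it is infinitely divisible if for every $t>0$, $[P(\boldsymbol\theta)]^{-\lambda t}$ is the Laplace transform of a positive measure. $\widetilde p_T=-p_{\overline T}/p_{[n]}$, $\widetilde p_i=\widetilde p_{\{i\}}$, $\boldsymbol\theta_{P_n}=(\widetilde p_1,\dots,\widetilde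 p_n)$. $R_n(\mathbf z)=\sum_{T\subset[n],|T|\ge2}r_T\mathbf z^T$ with $r_T=-\frac1{p_{[n]}}\big(\prod_{i\in\overline T}\frac{\partial}{\partial\theta_i}\big)P_n(\boldsymbol\theta_{P_n})$; equivalently $P_n(\boldsymbol\theta)=p_{[n]}\prod_i(\theta_i-\widetilde p_i)\{1-R_n((\theta_1-\widetilde p_1)^{-1},\dots,(\theta_n-\widetilde p_n)^{-1})\}$. The conditional Laplace transform is $L_{\mathbf X_{[n]\setminus[k]}}^{\mathbf X_{[k]}=\mathbf x_{[k]}}(\boldsymbol\theta_{[n]\setminus[k]})=\mathbb E[\exp(-\sum_{i=k+1}^n\theta_iX_i)\mid \mathbf X_{[k]}=\mathbf x_{[k]}]$; the formula gives a version of it for $\mathbf x_{[k]}\in(0,\infty)^k$ and $\theta_i\ge0$. *)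

(* Defs.v *)
(* MathComp-Analysis, over an arbitrary [R : realType].  Indices in {1, ..., n}
   become ordinals in {0, ..., n-1}, so that [k] is the set of i with i < k. *)
From HB Require Import structures.
From mathcomp Require Import all_boot all_order all_algebra.
From mathcomp Require Import all_classical all_reals all_analysis.

Set Implicit Arguments.
Unset Strict Implicit.
Unset Printing Implicit Defensive.
Import Order.TTheory GRing.Theory Num.Theory.
Import numFieldNormedType.Exports.
Local Open Scope classical_set_scope.
Local Open Scope ring_scope.

Section Indices.
Variables (k n : nat) (le_kn : (k <= n)%N).

Definition fst_idx (i : 'I_k) : 'I_n := widen_ord le_kn i.

(* i |-> k + i *)
Definition snd_idx (i : 'I_(n - k)) : 'I_n :=
  cast_ord (subnKC le_kn) (rshift k i).

Definition fst_block (T : Type) (x : n.-tuple T) : k.-tuple T :=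
  [tuple tnth x (fst_idx i) | i < k].

Definition snd_block (T : Type) (x : n.-tuple T) : (n - k).-tuple T :=
  [tuple tnth x (snd_idx i) | i < n - k].

End Indices.

Section AffinePolynomial.
Variables (R : realType) (n : nat).
Implicit Types (p : {set 'I_n} -> R) (T : {set 'I_n}) (theta z : 'rV[R]_n).

Definition affine_poly p theta : R :=
  \sum_(T : {set 'I_n}) p T * \prod_(t in T) theta 0 t.

Definition ptilde p T : R := - (p (~: T) / p [set: 'I_n]%SET).

Definition ptilde1 p (i : 'I_n) : R := ptilde p [set i]%SET.

Definition theta_P p : 'rV[R]_n := \row_i ptilde1 p i.

Definition pderiv (i : 'I_n) (f : 'rV[R]_n -> R) : 'rV[R]_n -> R :=
  fun theta => 'D_(delta_mx 0 i) f theta.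

(* The order of differentiation is that of [enum S]. *)
Definition pderivs (S : {set 'I_n}) (f : 'rV[R]_n -> R) : 'rV[R]_n -> R :=
  foldr pderiv f (enum S).

Definition rcoef p T : R :=
  - ((p [set: 'I_n]%SET)^-1 * pderivs (~: T) (affine_poly p) (theta_P p)).

Definition Rpoly p z : R :=
  \sum_(T : {set 'I_n} | (2 <= #|T|)%N) rcoef p T * \prod_(t in T) z 0 t.

End AffinePolynomial.

Section Sums.
Variables (R : realType) (I : choiceType).
Implicit Types (D : set I) (f : I -> R).

(* Only meaningful for absolutely summable families. *)
Definition real_sum D f : R :=
  fine (\esum_(i in D) (EFin \o f)^\+%E i - \esum_(i in D) (EFin \o f)^\-%E i)%E.

Definition abs_summable D f : Prop := summable D (EFin \o f).

End Sums.

Definition power_series_at0 (R : realType) (n : nat)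
    (c : {ffun 'I_n -> nat} -> R) (f : 'rV[R]_n -> R) : Prop :=
  let term (z : 'rV[R]_n) (alpha : {ffun 'I_n -> nat}) :=
    c alpha * \prod_(i < n) z 0 i ^+ alpha i in
  \forall z \near (0 : 'rV[R]_n),
    abs_summable setT (term z) /\ f z = real_sum setT (term z).

Section Gamma.
Variable R : realType.

Definition Gamma (s : R) : R :=
  (\int[lebesgue_measure]_(x in `]0%R, +oo[) (x `^ (s - 1) * expR (- x)))%R.

Definition rising (lambda : R) (m : nat) : R :=
  Gamma (lambda + m%:R) / Gamma lambda.

End Gamma.

Section MultivariateGamma.
Variables (R : realType) (n : nat).
Implicit Types (p : {set 'I_n} -> R) (lambda : R) (Theta : set 'rV[R]_n).

Definition expdot (theta : 'rV[R]_n) (x : n.-tuple R) : R :=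
  expR (- \sum_(i < n) theta 0 i * tnth x i).

Definition laplace (mu : {measure set (n.-tuple R) -> \bar R})
  (theta : 'rV[R]_n) : \bar R := (\int[mu]_x (expdot theta x)%:E)%E.

(* Positivity of the polynomial on [Theta] gives its real powers a meaning:
   [powR] is total. *)
Definition laplace_domain p Theta : Prop :=
  Theta° !=set0 /\ forall theta, Theta theta -> 0 < affine_poly p theta.

Definition mgamma p lambda Theta
    (mu : {measure set (n.-tuple R) -> \bar R}) : Prop :=
  forall theta, Theta theta ->
    laplace mu theta = (affine_poly p theta `^ (- lambda))%:E.

(* The roots have their Laplace transforms on the same set [Theta] as the
   distribution itself. *)
Definition mgamma_infdiv p lambda Theta : Prop :=
  forall t : R, 0 < t ->
    exists mu : {measure set (n.-tuple R) -> \bar R},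
      mgamma p (lambda * t) Theta mu.

End MultivariateGamma.

Section ConditionalFormula.
Variables (R : realType) (k n : nat) (le_kn : (k <= n)%N).
Implicit Types (p : {set 'I_n} -> R) (c : {ffun 'I_n -> nat} -> R)
  (x : k.-tuple R) (theta : 'rV[R]_(n - k)).

Definition Qpoly p theta : R :=
  \prod_(i < n - k) (1 + theta 0 i * (- ptilde1 p (snd_idx le_kn i))^-1).

Definition Fterm p lambda c x theta (alpha : {ffun 'I_n -> nat}) : R :=
  (\prod_(i < k) tnth x i ^+ alpha (fst_idx le_kn i))
    / (\prod_(i < k) rising lambda (alpha (fst_idx le_kn i)))
  * c alpha
  * \prod_(i < n - k) (theta 0 i - ptilde1 p (snd_idx le_kn i))
                        ^- alpha (snd_idx le_kn i).

Definition csupp c : set {ffun 'I_n -> nat} := [set alpha | c alpha != 0].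

Definition Fseries p lambda c x theta : R :=
  real_sum (csupp c) (Fterm p lambda c x theta).

Definition pos_orthant : set (k.-tuple R) := [set x | forall i, 0 < tnth x i].

End ConditionalFormula.

(* [phi], defined on [D], is a version of z |-> E[Y | Z = z]. *)
Definition cond_exp_version d (T : measurableType d) (R : realType)
    (P : probability T R) d' (U : measurableType d')
    (Z : T -> U) (Y : T -> R) (D : set U) (phi : U -> R) : Prop :=
  [/\ measurable D /\ P (Z @^-1` (~` D)) = 0%E,
      P.-integrable setT (EFin \o Y),
      measurable_fun D phi,
      P.-integrable (Z @^-1` D) (EFin \o (phi \o Z)) &
      forall B : set U, measurable B ->
        (\int[P]_(w in Z @^-1` B) (Y w)%:E =
         \int[P]_(w in Z @^-1` (B `&` D)) (phi (Z w))%:E)%E].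

(* Main.v *)
(* Put beta_i = - ptilde_i and q = 1 - R_n, so that
   P_n(theta) = p_[n] prod_i (theta_i + beta_i) q(z) with z_i = 1 / (theta_i + beta_i).
   The proof goes through the identity: the law of X has density
   K sum_alpha c_alpha prod_i x_i^alpha_i / (lambda)_alpha_i
   with respect to the product of the gamma laws of shape lambda and rates beta_i.
   Integrating out the last coordinates then gives the formula, provided that the
   series converge, which is clear once all terms are nonnegative.

   Nonnegativity comes from infinite divisibility.  Comparing one-dimensional
   slices of the Laplace transform with those of gamma laws shows that X and all
   its convolution roots live on the nonnegative orthant and that all the p_T are
   positive.  Letting t -> 0 in the mixed differences of P_n^(- lambda t), those of
   - ln P_n, hence those of - ln q, are nonnegative; since q is affine, the square
   of d_i (- ln q) is d_i^2 (- ln q), so all derivatives of - ln q at 0 are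
   nonnegative, and therefore so are those of q^(- lambda), i.e. the c_alpha. *)
Require Import Defs.
From HB Require Import structures.
From mathcomp Require Import all_boot all_order all_algebra.
From mathcomp Require Import all_classical all_reals all_analysis.
From mathcomp Require Import measurable_realfun measurable_fun_approximation.
From mathcomp Require Import ring lra.

Set Implicit Arguments.
Unset Strict Implicit.
Unset Printing Implicit Defensive.
Import Order.TTheory GRing.Theory Num.Theory.
Import numFieldNormedType.Exports.
Local Open Scope classical_set_scope.
Local Open Scope ring_scope.

(** * Densities and Laplace transforms *)

(** The Laplace transform is given only on a set with interior, whereas q^(- lambda) is expanded
    near z = 0, that is for large theta. The identity is carried there along real lines: e^(hx) +
    e^(-hx) is a power series in h with nonnegative coefficients, so Tonelli determines the
    symmetrised transform for all h from small h, even where it might be infinite, and reflections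
    about moving centres then reach the points that are needed. Passing from - ln P_n to - ln q
    costs nothing: they differ by a constant and functions of single coordinates, which vanish under
    differences in two distinct coordinates, and order one is covered by R_n having no linear term.
    Differences are used so that no Laplace transform has to be differentiated; only the explicit
    affine polynomial is. The final series converge for every x > 0, and not just for almost every
    x, by monotonicity: a nonnegative series that is infinite at x is infinite at all larger points,
    a set charged by the gamma laws, against integrability. *)

Section Density.
Local Open Scope ereal_scope.
Context d (T : measurableType d) (R : realType).
Variables (mu : {measure set T -> \bar R}) (f : T -> \bar R).
Hypotheses (mf : measurable_fun setT f) (f0 : forall x, 0 <= f x).

Lemma density_measure : exists nu : {measure set T -> \bar R},
  forall A, measurable A -> nu A = \int[mu]_(x in A) f x.
Proof.
pose m A := \int[mu]_(x in A) f x.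
have m0 : m set0 = 0 by rewrite /m integral_set0.
have m_ge0 A : 0 <= m A by exact: integral_ge0.
have m_sadd : semi_sigma_additive m.
  move=> F mF tF mUF; rewrite /m ge0_integral_bigcup//.
    by apply: is_cvg_ereal_nneg_natsum_cond => n _ _; exact: integral_ge0.
  exact: measurable_funTS.
pose mm := isMeasure.Build _ _ _ m m0 m_ge0 m_sadd.
pose nu : {measure set T -> \bar R} := HB.pack m mm.
by exists nu.
Qed.

Variable nu : {measure set T -> \bar R}.
Hypothesis nuE : forall A, measurable A -> nu A = \int[mu]_(x in A) f x.

Import HBNNSimple.

(** Simple functions and monotone convergence. Infinite values of [f] are allowed because the
    density of the gamma mixture is a series whose finiteness is only established at the end. *)
Lemma ge0_integral_density (g : T -> \bar R) :
  measurable_fun setT g -> (forall x, 0 <= g x) ->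
  \int[nu]_x g x = \int[mu]_x (g x * f x).
Proof.
move=> mg g0; pose h := nnsfun_approx measurableT mg.
have hcvg x : EFin \o h ^~ x @ \oo --> g x.
  by apply: cvg_nnsfun_approx => // y _; exact: g0.
have hnd x : {homo (fun n => (h n x)%:E) : a b / (a <= b)%N >-> a <= b}.
  by move=> a b ab; rewrite lee_fin; exact/lefP/nd_nnsfun_approx.
have -> : \int[nu]_x g x = limn (fun n => \int[nu]_x (h n x)%:E).
  rewrite -monotone_convergence//.
  - by apply: eq_integral => x _; apply/esym/cvg_lim => //; exact: hcvg.
  - by move=> n; exact/measurable_EFinP.
  - by move=> n x _; rewrite lee_fin.
have hfnd x : {homo (fun n => (h n x)%:E * f x) : a b / (a <= b)%N >-> a <= b}.
  by move=> a b ab; rewrite lee_wpmul2r//; exact: hnd.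
have hfcvg x : (fun n => (h n x)%:E * f x) @ \oo --> g x * f x.
  have := f0 x; case fx : (f x) => [r| |] //= r0.
    by apply: cvgeZr => //; exact: hcvg.
  (* Here [f x] is infinite: either [g x] and all its approximations vanish, or the approximations
     are eventually positive and the products are already infinite. *)
  have [gx0|gx0] := eqVneq (g x) 0.
    have hx n : (h n x)%:E = 0.
      apply/eqP; rewrite eq_le; apply/andP; split; last by rewrite lee_fin.
      rewrite -gx0 -(cvg_lim _ (hcvg x))//.
      rewrite (cvg_lim _ (ereal_nondecreasing_cvgn (hnd x)))//.
      by apply: ereal_sup_ubound; exists n.
    by under eq_fun do rewrite hx mul0e; rewrite gx0 mul0e; exact: cvg_cst.
  have gx : 0 < g x by rewrite lt0e gx0/=.
  rewrite gt0_muley//; apply: cvg_near_cst.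
  have : \forall n \near \oo, 0 < (h n x)%:E.
    by have := hcvg x _ (open_ereal_gt' gx).
  apply: filterS => n hn; by rewrite gt0_muley.
have -> : \int[mu]_x (g x * f x) = limn (fun n => \int[mu]_x ((h n x)%:E * f x)).
  rewrite -monotone_convergence//.
  - by apply: eq_integral => x _; apply/esym/cvg_lim => //; exact: hfcvg.
  - move=> n; apply: emeasurable_funM => //; exact/measurable_EFinP.
  - by move=> n x _; rewrite mule_ge0// lee_fin.
suff hE n : \int[nu]_x (h n x)%:E = \int[mu]_x ((h n x)%:E * f x).
  by under eq_fun do rewrite hE.
under eq_integral do rewrite fimfunE -fsumEFin//.
rewrite ge0_integral_fsum//; last 2 first.
  - by move=> y; exact/measurable_EFinP/measurable_funM.
  - by move=> y x _; rewrite nnfun_muleindic_ge0.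
under [RHS]eq_integral => x _.
  rewrite fimfunE -fsumEFin// ge0_mule_fsuml; last first.
    by move=> y; exact: nnfun_muleindic_ge0.
  over.
rewrite ge0_integral_fsum//; last 2 first.
  - by move=> y; apply: emeasurable_funM => //;
      exact/measurable_EFinP/measurable_funM.
  - by move=> y x _; rewrite mule_ge0// nnfun_muleindic_ge0.
apply: eq_fsbigr => r; rewrite inE => -[t _ rE].
have r0 : (0 <= r)%R by rewrite -rE.
under eq_integral do rewrite EFinM.
rewrite integralZl_indic_nnsfun// integral_indic// setIT.
under [RHS]eq_integral do rewrite EFinM -muleA.
rewrite ge0_integralZl//; last first.
- by move=> x _; rewrite mule_ge0// lee_fin.
- by apply: emeasurable_funM => //; exact/measurable_EFinP.
under [in RHS]eq_integral do rewrite muleC.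
rewrite nuE// integral_mkcond; congr (_ * _).
by apply: eq_integral => x _; rewrite epatch_indic.
Qed.

End Density.

(** * Uniqueness of one-dimensional Laplace transforms *)

Section Threshold.
Variable R : realType.

Lemma bernoulli_ineq (u : R) (N : nat) : 0 <= u <= 1 -> 1 - N%:R * u <= (1 - u) ^+ N.
Proof.
move=> /andP[u0 u1]; elim: N => [|N IH]; first by rewrite mul0r subr0 expr0.
rewrite exprS (@le_trans _ _ ((1 - u) * (1 - N%:R * u)))//; last first.
  by rewrite ler_wpM2l// subr_ge0.
have : 0 <= N%:R * (u * u) :> R by rewrite !mulr_ge0.
rewrite -natr1; nra.
Qed.

(* With N ~ j e^(jc), the polynomial (1 - e^(-jx))^N in e^(-jx) tends to the
   indicator of x > c. *)
Definition threshold_exponent (c : R) (j : nat) : nat :=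
  (Num.truncn (j%:R * expR (j%:R * c))).+1.

Definition threshold (c : R) (j : nat) (x : R) : R :=
  (1 - expR (- (j%:R * x))) ^+ threshold_exponent c j.

Lemma threshold_itv01 (c : R) (j : nat) (x : R) : 0 <= x -> 0 <= threshold c j x <= 1.
Proof.
move=> x0; rewrite /threshold.
have u1 : expR (- (j%:R * x)) <= 1 by rewrite expR_le1 oppr_le0 mulr_ge0.
have u0 := expR_gt0 (- (j%:R * x)).
by rewrite exprn_ge0 ?subr_ge0// exprn_ile1 ?subr_ge0// lerBlDr lerDl ltW.
Qed.

(** Let N be the exponent. For x <= c, the bound 1 - u <= e^(-u) gives exp(- N e^(-jx)) <= e^(-j);
    the factor j in N is what settles x = c. For x > c, Bernoulli bounds the distance to 1 by N
    e^(-jx), of order j e^(-j(x - c)). Both are O(1/j). *)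
Lemma cvg_threshold (c x : R) : 0 <= c -> 0 <= x ->
  threshold c ^~ x @ \oo --> (\1_`]c, +oo[ x : R).
Proof.
move=> c0 x0.
suff [K HK] : exists K : R, forall j : nat, `|\1_`]c, +oo[ x - threshold c j x| <= K * j.+1%:R^-1.
  apply/cvgrPdist_le => e e0.
  have : K * harmonic n @[n --> \oo] --> K * 0.
    by apply: cvgM; [exact: cvg_cst|exact: cvg_harmonic].
  rewrite mulr0 => /cvgrPdist_le/(_ _ e0); apply: filterS => j.
  rewrite sub0r normrN => Hj; rewrite (le_trans (HK j))// (le_trans _ Hj)//.
  exact: ler_norm.
have [xc|cx] := leP x c.
  exists 1 => j; rewrite mul1r indicE memNset/=; last first.
    by rewrite in_itv/= andbT; apply/negP; rewrite -leNgt.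
  have /andP[t0 _] := threshold_itv01 c j x0.
  rewrite sub0r normrN ger0_norm//.
  have u0 := expR_gt0 (- (j%:R * x)).
  have u1 : expR (- (j%:R * x)) <= 1 by rewrite expR_le1 oppr_le0 mulr_ge0.
  rewrite /threshold (@le_trans _ _ (expR (- j%:R)))//; last first.
    by rewrite expRN lef_pV2 ?posrE ?expR_gt0//; have := expR_ge1Dx (j%:R : R); rewrite nat1r.
  rewrite (@le_trans _ _ (expR (- expR (- (j%:R * x))) ^+ threshold_exponent c j))//.
    by apply: lerXn2r; rewrite ?nnegrE ?subr_ge0 ?expR_ge0//; exact: expR_ge1Dx.
  rewrite -expRM_natl ler_expR mulrN lerN2.
  have : j%:R * expR (j%:R * c) <= (threshold_exponent c j)%:R.
    by rewrite /threshold_exponent ltW// truncnS_gt.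
  move=> h; apply: le_trans (ler_wpM2r (ltW u0) h).
  rewrite -mulrA -expRD ler_peMr// -mulrBr; rewrite -[leLHS]expR0 ler_expR.
  by rewrite mulr_ge0// subr_ge0.
pose d := x - c; have d0 : 0 < d by rewrite subr_gt0.
(* Since e^(jd/2) >= 1 + jd/2 >= m (j + 1), squaring gives e^(jd) >= m^2 (j + 1)^2, which beats the
   factor j + 1 coming from the exponent. *)
pose m := Num.min 1 (d / 2); have m0 : 0 < m by rewrite lt_min ltr01 divr_gt0.
exists (m ^+ 2)^-1 => j; rewrite indicE mem_set/=; last by rewrite in_itv/= cx.
have /andP[_ t1] := threshold_itv01 c j x0.
rewrite ger0_norm ?subr_ge0//.
have u0 := expR_gt0 (- (j%:R * x)).
have u1 : expR (- (j%:R * x)) <= 1 by rewrite expR_le1 oppr_le0 mulr_ge0.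
have := @bernoulli_ineq _ (threshold_exponent c j) (introT andP (conj (ltW u0) u1)).
rewrite -/(threshold c j x) => tB.
have NE : (threshold_exponent c j)%:R <= j.+1%:R * expR (j%:R * c) :> R.
  rewrite /threshold_exponent -natr1 -[X in _ <= X * _]natr1 mulrDl mul1r lerD//.
    have y0 : 0 <= j%:R * expR (j%:R * c) by rewrite mulr_ge0// expR_ge0.
    by have /andP[] := truncn_itv y0.
  by rewrite -[leLHS]expR0 ler_expR mulr_ge0.
have : (threshold_exponent c j)%:R * expR (- (j%:R * x)) <= j.+1%:R * expR (- (j%:R * d)).
  rewrite (le_trans (ler_wpM2r (ltW u0) NE))// -mulrA -expRD.
  by rewrite ler_pM2l// ler_expR /d; lra.
have le2 : m * j.+1%:R <= expR (j%:R * d / 2).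
  rewrite (le_trans _ (expR_ge1Dx _))// -natr1 mulrDr mulr1 addrC lerD//.
    by rewrite ge_min lexx.
  rewrite mulrC -mulrA ler_wpM2l// ge_min; apply/orP; right.
  by rewrite lexx.
have le3 : m ^+ 2 * j.+1%:R ^+ 2 <= expR (j%:R * d).
  rewrite -exprMn; have -> : j%:R * d = 2%:R * (j%:R * d / 2) by lra.
  by rewrite expRM_natl lerXn2r// nnegrE ?expR_ge0// mulr_ge0// ltW.
have le4 : j.+1%:R * expR (- (j%:R * d)) <= (m ^+ 2)^-1 / j.+1%:R.
  rewrite -invfM expRN ler_pdivrMr ?expR_gt0// ler_pdivlMl; last first.
    by rewrite mulr_gt0// exprn_gt0.
  by rewrite -mulrA -expr2.
by move=> h; rewrite (le_trans _ (le_trans h le4))// lerBlDl -lerBlDr.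
Qed.
End Threshold.

Section Uniqueness1.
Variable R : realType.
Local Notation D := (`[0%R, +oo[%classic : set R).

Section moments.
Variable m : {measure set R -> \bar R}.
Hypothesis moo : (m setT < +oo)%E.

Lemma integrable_bounded_halfline (f : R -> R) :
  measurable_fun setT f -> (forall x, 0 <= x -> `|f x| <= 1) ->
  m.-integrable D (EFin \o f).
Proof.
move=> mf f1; apply: measurable_bounded_integrable => //.
- by rewrite (le_lt_trans _ moo)// le_measure ?inE.
- exact: measurable_funTS.
- exists 1; split => // y y1 x /=; rewrite in_itv/= andbT => x0.
  by rewrite (le_trans (f1 _ x0))// ltW.
Qed.
End moments.

Lemma measurable_expRM (a : R) : measurable_fun setT (fun x : R => expR (- (a * x))).
Proof.
by do 2 apply: measurableT_comp => //.
Qed.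

(** Transforms at the naturals determine the integrals of polynomials in e^(-x), in particular of
    the thresholds; dominated convergence turns these into tail masses, and the tails generate the
    Borel sets. *)
Lemma laplace_unique_halfline (m1 m2 : {measure set R -> \bar R}) :
  (m1 setT < +oo)%E -> (m2 setT < +oo)%E ->
  m1 `]-oo, 0%R[%classic = 0%E -> m2 `]-oo, 0%R[%classic = 0%E ->
  (forall k : nat, \int[m1]_(x in D) (expR (- (k%:R * x)))%:E =
                   \int[m2]_(x in D) (expR (- (k%:R * x)))%:E)%E ->
  forall A, measurable A -> m1 A = m2 A.
Proof.
move=> m1oo m2oo m10 m20 m12.
have e01 (j : nat) (x : R) : 0 <= x -> 0 < expR (- (j%:R * x)) <= 1.
  by move=> x0; rewrite expR_gt0 expR_le1 oppr_le0 mulr_ge0.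
have mpow (j N k : nat) : measurable_fun setT
    (fun x : R => expR (- (k%:R * x)) * (1 - expR (- (j%:R * x))) ^+ N).
  apply: measurable_funM; first exact: measurable_expRM.
  by apply: measurable_funX; apply: measurable_funB => //; exact: measurable_expRM.
have ipow (m : {measure set R -> \bar R}) (j N k : nat) : (m setT < +oo)%E ->
    m.-integrable D (EFin \o (fun x : R => expR (- (k%:R * x)) * (1 - expR (- (j%:R * x))) ^+ N)).
  move=> moo; apply: integrable_bounded_halfline => // x x0.
  have /andP[k0 k1] := e01 k x x0; have /andP[j0 j1] := e01 j x x0.
  rewrite ger0_norm; last by rewrite mulr_ge0 ?exprn_ge0 ?subr_ge0// ltW.
  by rewrite mulr_ile1 ?exprn_ge0 ?exprn_ile1 ?subr_ge0// ?ltW// lerBlDr lerDl ltW.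
(* The exponent k is left free: multiplying by 1 - e^(-jx) produces the two exponents k and k + j in
   the induction on N. *)
have m12pow (j N k : nat) :
    (\int[m1]_(x in D) (expR (- (k%:R * x)) * (1 - expR (- (j%:R * x))) ^+ N)%:E =
     \int[m2]_(x in D) (expR (- (k%:R * x)) * (1 - expR (- (j%:R * x))) ^+ N)%:E)%E.
  elim: N k => [|N IH] k.
    by under eq_integral do rewrite expr0 mulr1;
       under [RHS]eq_integral do rewrite expr0 mulr1; exact: m12.
  have step (m : {measure set R -> \bar R}) : (m setT < +oo)%E ->
    (\int[m]_(x in D) (expR (- (k%:R * x)) * (1 - expR (- (j%:R * x))) ^+ N.+1)%:E =
     \int[m]_(x in D) (expR (- (k%:R * x)) * (1 - expR (- (j%:R * x))) ^+ N)%:E -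
     \int[m]_(x in D) (expR (- ((k + j)%:R * x)) * (1 - expR (- (j%:R * x))) ^+ N)%:E)%E.
    move=> moo; rewrite -integralB_EFin//; try exact: ipow.
    apply: eq_integral => x _; rewrite -EFinB; congr EFin.
    rewrite natrD mulrDl opprD expRD exprS; ring.
  by rewrite !step// !IH.
have tail c : 0 <= c -> m1 `]c, +oo[%classic = m2 `]c, +oo[%classic.
  move=> c0.
  have lim (m : {measure set R -> \bar R}) : (m setT < +oo)%E ->
      (\int[m]_(x in D) (threshold c j x)%:E)%E @[j --> \oo] --> m `]c, +oo[%classic.
    move=> moo.
    have -> : m `]c, +oo[%classic = (\int[m]_(x in D) (\1_(`]c, +oo[%classic) x)%:E)%E.
      rewrite integral_indic//; congr (m _); apply/seteqP; split => x /=.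
        by rewrite !in_itv/= !andbT => cx; split=> //; rewrite (le_trans c0)// ltW.
      by case.
    have [] // := @dominated_convergence _ _ _ m D _ (fun j x => (threshold c j x)%:E)
      (fun x => (\1_(`]c, +oo[%classic) x)%:E) (cst 1%:E).
    - move=> j; apply/measurable_EFinP/measurable_funTS; rewrite /threshold.
      by apply: measurable_funX; apply: measurable_funB => //; exact: measurable_expRM.
    - by apply/measurable_EFinP/measurable_funTS.
    - apply: aeW => x /=; rewrite in_itv/= andbT => x0.
      by apply: cvg_EFin; [exact: nearW|exact: cvg_threshold].
    - by apply: (@integrable_bounded_halfline m moo (cst 1)) => // x _; rewrite normr1.
    - apply: aeW => x j /=; rewrite in_itv/= andbT => x0.
      have /andP[t0 t1] := threshold_itv01 c j x0.
      by rewrite lee_fin ger0_norm.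
  have eqt (j : nat) : (\int[m1]_(x in D) (threshold c j x)%:E =
      \int[m2]_(x in D) (threshold c j x)%:E)%E.
    have e0 (m : {measure set R -> \bar R}) :
        (\int[m]_(x in D) (threshold c j x)%:E = \int[m]_(x in D)
          (expR (- (0%:R * x)) * (1 - expR (- (j%:R * x))) ^+ threshold_exponent c j)%:E)%E.
      by apply: eq_integral => x _; rewrite mul0r oppr0 expR0 mul1r.
    by rewrite !e0; exact: m12pow.
  have := lim m1 m1oo; under eq_fun do rewrite eqt.
  by move=> /cvg_unique; apply => //; exact: lim.
have m12D : m1 D = m2 D.
  have e0 (m : {measure set R -> \bar R}) :
      m D = (\int[m]_(x in D) (expR (- (0%:R * x)))%:E)%E.
    by under eq_integral do rewrite mul0r oppr0 expR0; rewrite integral_cst// mul1e.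
  by rewrite !e0.
have tail' c : m1 `]c, +oo[%classic = m2 `]c, +oo[%classic.
  have [c0|c0] := leP 0 c; first exact: tail.
  have split_ (m : {measure set R -> \bar R}) : m `]-oo, 0%R[%classic = 0%E ->
      m `]c, +oo[%classic = m D.
    move=> m0; apply/eqP; rewrite eq_le; apply/andP; split; last first.
      apply: le_measure; rewrite ?inE// => x /=.
      by rewrite !in_itv/= !andbT; exact: lt_le_trans.
    rewrite -[leRHS]add0e -m0 -measureU//; last first.
      by apply/seteqP; split => x //= []; rewrite !in_itv/= andbT => /lt_geF ->.
    apply: le_measure; rewrite ?inE//; first exact: measurableU.
    by move=> x /= _; rewrite !in_itv/= andbT; case: (ltP x 0); [left|right].
  by rewrite !split_.
apply: (@measure_unique _ _ _ (@RGenOInfty.G R)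
    (fun k => `](- k%:R)%R, +oo[%classic)) => //.
- exact: RGenOInfty.measurableE.
- move=> _ _ [x ->] [y ->]; exists (Num.max x y).
  by apply/seteqP; split => z /=; rewrite !in_itv/= !andbT gt_max => /andP.
- by move=> i; exists (- i%:R)%R.
- rewrite -subTset => x _; exists (Num.truncn `|x|).+1 => //=.
  rewrite in_itv/= andbT ltrNl (le_lt_trans (ler_norm _))// normrN.
  exact: truncnS_gt.
- by move=> _ [x ->]; exact: tail'.
- move=> k; rewrite (le_lt_trans _ m1oo)// le_measure ?inE//.
Qed.

Lemma ge0_integral_halfline (m : {measure set R -> \bar R}) (f : R -> \bar R) :
  m `]-oo, 0%R[%classic = 0%E -> measurable_fun setT f -> (forall x, 0 <= f x)%E ->
  (\int[m]_x f x = \int[m]_(x in D) f x)%E.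
Proof.
move=> m0 mf f0; rewrite (@ge0_negligible_integral _ _ _ m setT `]-oo, 0%R[%classic)//.
by congr (integral _ _ _); rewrite setTD setCitvl.
Qed.

Lemma laplace_unique1 (m1 m2 : {measure set R -> \bar R}) :
  (m1 setT < +oo)%E -> (m2 setT < +oo)%E ->
  m1 `]-oo, 0%R[%classic = 0%E -> m2 `]-oo, 0%R[%classic = 0%E ->
  (forall k : nat, \int[m1]_x (expR (- (k%:R * x)))%:E =
                   \int[m2]_x (expR (- (k%:R * x)))%:E)%E ->
  forall A, measurable A -> m1 A = m2 A.
Proof.
move=> m1oo m2oo m10 m20 m12; apply: laplace_unique_halfline => // k.
by rewrite -!ge0_integral_halfline//; apply/measurable_EFinP; exact: measurable_expRM.
Qed.
End Uniqueness1.

Section Pushforward.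
Local Open Scope ereal_scope.
Context d1 d2 (T1 : measurableType d1) (T2 : measurableType d2) (R : realType).
Variables (mu : {measure set T1 -> \bar R}) (phi : T1 -> T2).
Hypothesis mphi : measurable_fun setT phi.

Lemma image_measure : exists nu : {measure set T2 -> \bar R},
  (forall A, measurable A -> nu A = mu (phi @^-1` A)) /\
  (forall f : T2 -> \bar R, measurable_fun setT f -> (forall y, 0 <= f y) ->
     \int[nu]_y f y = \int[mu]_x f (phi x)).
Proof.
pose mixin := isMeasurableFun.Build _ _ _ _ _ mphi.
pose phi' : {mfun T1 >-> T2} := HB.pack phi mixin.
exists (pushforward mu phi'); split => // f mf f0.
by rewrite (ge0_integral_pushforward mphi)// preimage_setT.
Unshelve. exact: mphi.
Qed.
End Pushforward.

Lemma weighted_image d1 d2 (T1 : measurableType d1) (T2 : measurableType d2) (R : realType)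
    (mu : {measure set T1 -> \bar R}) (phi : T1 -> T2) (w : T1 -> \bar R) :
  measurable_fun setT phi -> measurable_fun setT w -> (forall x, 0 <= w x)%E ->
  exists nu : {measure set T2 -> \bar R}, forall f : T2 -> \bar R,
    measurable_fun setT f -> (forall y, 0 <= f y)%E ->
    (\int[nu]_y f y = \int[mu]_x (f (phi x) * w x))%E.
Proof.
move=> mphi mw w0; have [m mE] := density_measure mu mw w0.
have [nu [_ nuI]] := image_measure m mphi.
exists nu => f mf f0; rewrite nuI// (ge0_integral_density mw w0 mE)//.
exact: measurableT_comp mf mphi.
Qed.

(** * Uniqueness of Laplace transforms in several variables *)

Section UniquenessN.
Variable R : realType.

Definition rectangle n (B : 'I_n -> set R) : set (n.-tuple R) :=
  [set x | forall i, B i (tnth x i)].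

Lemma measurable_rectangle n (B : 'I_n -> set R) :
  (forall i, measurable (B i)) -> measurable (rectangle B).
Proof.
move=> mB; have -> : rectangle B =
    \bigcap_(i in [set: 'I_n]) ((fun x => tnth x i) @^-1` B i).
  by apply/seteqP; split => x Bx i; [move=> _|]; exact: Bx.
apply: fin_bigcap_measurable => // i _.
by rewrite -[X in measurable X]setTI; exact: measurable_tnth.
Qed.

Lemma measurable_tuple_rectangle n : (measurable : set (set (n.-tuple R))) =
  <<s [set rectangle B | B in [set B : 'I_n -> set R | forall i, measurable (B i)]] >>.
Proof.
rewrite eqEsubset; split => A; last first.
  apply: smallest_sub; first exact: sigma_algebra_measurable.
  by move=> _ [B mB <-]; exact: measurable_rectangle.
apply: smallest_sub; first exact: smallest_sigma_algebra.
rewrite -bigcup_seq/= => _ [i _ [B mB <-]]; apply: sub_sigma_algebra.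
exists (fun j => if j == i then B else setT); first by move=> j; case: ifP.
rewrite setTI; apply/seteqP; split => x /=.
  by move=> /(_ i); rewrite eqxx.
by move=> Bx j; case: eqP => [->|].
Qed.

Lemma measurable_tnth_lt n (i : 'I_n) (a : R) : measurable [set x : n.-tuple R | tnth x i < a].
Proof.
rewrite (_ : [set x | _] = setT `&` (@tnth n R ^~ i) @^-1` `]-oo, a[%classic).
  exact: measurable_tnth.
by rewrite setTI; apply/seteqP; split=> x /=; rewrite in_itv.
Qed.

Lemma measurable_tnth_le n (i : 'I_n) (a : R) : measurable [set x : n.-tuple R | tnth x i <= a].
Proof.
rewrite (_ : [set x | _] = setT `&` (@tnth n R ^~ i) @^-1` `]-oo, a]%classic).
  exact: measurable_tnth.
by rewrite setTI; apply/seteqP; split=> x /=; rewrite in_itv.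
Qed.

Lemma measurable_prod_tnth n (f : 'I_n -> R -> R) :
  (forall i, measurable_fun setT (f i)) ->
  measurable_fun setT (fun x : n.-tuple R => \prod_(i < n) f i (tnth x i)).
Proof.
move=> mf; apply: measurable_prod => i _.
apply: measurableT_comp; [exact: mf|exact: measurable_tnth].
Qed.

Lemma prod_indic n (B : 'I_n -> set R) (x : n.-tuple R) :
  \prod_(i < n) \1_(B i) (tnth x i) = \1_(rectangle B) x :> R.
Proof.
rewrite indicE; have [|] := boolP (x \in rectangle B).
  by rewrite inE => Bx; rewrite big1// => i _; rewrite indicE mem_set//; exact: Bx.
rewrite notin_setE => /existsNP[i nBx].
by rewrite (bigD1 i)//= indicE memNset// mul0r.
Qed.

Lemma measure_eq_rectangle n (m1 m2 : {measure set (n.-tuple R) -> \bar R}) :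
  (m1 setT < +oo)%E ->
  (forall B : 'I_n -> set R, (forall i, measurable (B i)) ->
    m1 (rectangle B) = m2 (rectangle B)) ->
  forall A, measurable A -> m1 A = m2 A.
Proof.
move=> m1oo m12.
have recT : setT = rectangle (fun _ : 'I_n => [set: R]) by apply/seteqP; split.
apply: (@measure_unique _ _ _ _ (fun=> setT) (measurable_tuple_rectangle n)) => //.
- move=> _ _ [B1 mB1 <-] [B2 mB2 <-]; exists (fun i => B1 i `&` B2 i).
    by move=> i; exact: measurableI.
  apply/seteqP; split => x; first by move=> Bx; split=> i; case: (Bx i).
  by move=> [B1x B2x] i; split; [exact: B1x|exact: B2x].
- by move=> _; rewrite recT; exists (fun=> setT).
- by rewrite bigcup_const.
- by move=> _ [B mB <-]; exact: m12.
Qed.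

Lemma measurable_expdot n (theta : 'rV[R]_n) : measurable_fun setT (@expdot R n theta).
Proof.
apply: measurableT_comp => //; apply: measurableT_comp => //.
apply: measurable_sum => i; apply: measurable_funM => //; exact: measurable_tnth.
Qed.

Lemma expdotE n (theta : 'rV[R]_n) x :
  expdot theta x = \prod_(i < n) expR (- (theta 0 i * tnth x i)).
Proof. by rewrite -expR_sum sumrN. Qed.

(* One coordinate at a time, exponentials are replaced by indicators. *)
Lemma laplace_unique_nat n (m1 m2 : {measure set (n.-tuple R) -> \bar R}) :
  (forall k : 'I_n -> nat, laplace m1 (\row_i (k i)%:R) < +oo)%E ->
  (forall i, m1 [set x | tnth x i < 0] = 0%E) ->
  (forall i, m2 [set x | tnth x i < 0] = 0%E) ->
  (forall k : 'I_n -> nat, laplace m1 (\row_i (k i)%:R) = laplace m2 (\row_i (k i)%:R)) ->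
  forall A, measurable A -> m1 A = m2 A.
Proof.
move=> m1oo m10 m20 m12.
have m2oo k : (laplace m2 (\row_i (k i)%:R) < +oo)%E by rewrite -m12.
pose ind (f : R -> R) := exists2 B : set R, measurable B & f = \1_B.
pose exn (f : R -> R) := exists k : nat, f = fun x => expR (- (k%:R * x)).
(* The first j factors are indicators, the others exponentials with natural exponents: stage 0 is
   the hypothesis, stage n is equality on rectangles. *)
pose ok (j : nat) (f : 'I_n -> R -> R) :=
  forall i : 'I_n, ((i < j)%N -> ind (f i)) /\ ((j <= i)%N -> exn (f i)).
have mok j f : ok j f -> forall i, measurable_fun setT (f i).
  move=> okf i; have [H1 H2] := okf i; have [/H1|/H2] := ltnP i j.
    by case=> // B mB ->.
  by case=> // k ->; exact: measurable_expRM.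
have ok0 j f : ok j f -> forall i x, 0 <= f i x.
  move=> okf i x; have [H1 H2] := okf i; have [/H1|/H2] := ltnP i j.
    by case=> // B mB ->; rewrite indicE.
  by case=> // k ->; rewrite expR_ge0.
have claim (j : nat) : (j <= n)%N -> forall f, ok j f ->
    (\int[m1]_x (\prod_(i < n) f i (tnth x i))%:E = 
     \int[m2]_x (\prod_(i < n) f i (tnth x i))%:E)%E.
  elim: j => [_ f okf|j IH jn f okf].
    have /choice[k fk] : forall i, exn (f i) by move=> i; case: (okf i) => _; exact.
    have e (m : {measure set (n.-tuple R) -> \bar R}) :
        (\int[m]_x (\prod_(i < n) f i (tnth x i))%:E = laplace m (\row_i (k i)%:R))%E.
      apply: eq_integral => x _; rewrite expdotE; congr EFin.
      by apply: eq_bigr => i _; rewrite fk mxE.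
    by rewrite !e.
  pose i0 := Ordinal jn.
  have [/(_ (ltnSn j))[B mB fB] _] := okf i0.
  (* The factors other than [i0] become a density; the weighted image along coordinate [i0] is a
     measure on the line, to which [laplace_unique1] applies. *)
  pose g := fun x : n.-tuple R => \prod_(i < n | i != i0) f i (tnth x i).
  have mf := mok _ _ okf.
  have mg : measurable_fun setT g.
    have -> : g = fun x => \prod_(i < n) (if i != i0 then f i else cst 1) (tnth x i).
      apply/funext => x; rewrite /g big_mkcond/=; apply: eq_bigr => i _.
      by case: ifP.
    have := @measurable_prod_tnth n (fun i => if i != i0 then f i else cst 1).
    by apply=> i; case: ifP => _ //; exact: measurable_cst.
  have g0 x : 0 <= g x by apply: prodr_ge0 => i _; exact: (ok0 _ _ okf).
  have mgE : measurable_fun setT (EFin \o g) by exact/measurable_EFinP.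
  have g0E x : (0 <= (EFin \o g) x)%E by rewrite lee_fin.
  have [r1 r1E] := density_measure m1 mgE g0E.
  have [r2 r2E] := density_measure m2 mgE g0E.
  have fsplit x : \prod_(i < n) f i (tnth x i) = f i0 (tnth x i0) * g x.
    by rewrite (bigD1 i0).
  have mt : measurable_fun setT (fun x : n.-tuple R => tnth x i0) by exact: measurable_tnth.
  have [q1 [q1E q1I]] := image_measure r1 mt.
  have [q2 [q2E q2I]] := image_measure r2 mt.
  have pexp (m r : {measure set (n.-tuple R) -> \bar R}) (q : {measure set R -> \bar R})
      (rE : forall A, measurable A -> r A = (\int[m]_(x in A) (EFin \o g) x)%E)
      (qI : forall f : R -> \bar R, measurable_fun setT f -> (forall y, 0 <= f y)%E ->
        (\int[q]_y f y = \int[r]_x f (tnth x i0))%E) (h : R -> R) :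
      measurable_fun setT h -> (forall x, 0 <= h x) ->
      (\int[q]_y (h y)%:E = \int[m]_x (h (tnth x i0) * g x)%:E)%E.
    move=> mh h0; have mhE : measurable_fun setT (EFin \o h) by exact/measurable_EFinP.
    have h0E y : (0 <= (EFin \o h) y)%E by rewrite lee_fin.
    rewrite (qI _ mhE h0E) (@ge0_integral_density _ _ _ m _ mgE g0E r rE)//.
    exact: (measurableT_comp mhE mt).
  have push0 (m r : {measure set (n.-tuple R) -> \bar R})
      (rE : forall A, measurable A -> r A = (\int[m]_(x in A) (EFin \o g) x)%E) :
      m [set x | tnth x i0 < 0] = 0%E ->
      r ((fun x => tnth x i0) @^-1` `]-oo, 0%R[%classic) = 0%E.
    move=> m0; rewrite rE; last first.
      by rewrite -[X in measurable X]setTI; exact: mt.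
    apply: null_set_integral => //.
    - by rewrite -[X in measurable X]setTI; exact: mt.
    - exact: measurable_funTS.
  have exps (k : nat) : (\int[m1]_x (expR (- (k%:R * tnth x i0)) * g x)%:E =
       \int[m2]_x (expR (- (k%:R * tnth x i0)) * g x)%:E)%E.
    pose f' i := if i == i0 then (fun x => expR (- (k%:R * x))) else f i.
    have e (m : {measure set (n.-tuple R) -> \bar R}) :
       (\int[m]_x (expR (- (k%:R * tnth x i0)) * g x)%:E =
        \int[m]_x (\prod_(i < n) f' i (tnth x i))%:E)%E.
      apply: eq_integral => x _; rewrite (bigD1 i0)//= /f' eqxx; congr (_ * _)%:E.
      by apply: eq_bigr => i /negbTE ->.
    rewrite !e; apply: IH; first exact: ltnW.
    move=> i; rewrite /f'; case: eqP => [->|/eqP ii0]; split => //=.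
    - by rewrite ltnn.
    - by move=> _; exists k.
    - by move=> ij; case: (okf i) => + _; apply; rewrite ltnW.
    - move=> ji; case: (okf i) => _; apply; rewrite ltn_neqAle ji andbT.
      by apply: contra_neq ii0 => ji'; apply/val_inj.
  have fin (m r : {measure set (n.-tuple R) -> \bar R})
      (rE : forall A, measurable A -> r A = (\int[m]_(x in A) (EFin \o g) x)%E) :
      (forall k : 'I_n -> nat, laplace m (\row_i (k i)%:R) < +oo)%E ->
      (r setT < +oo)%E.
    move=> moo; rewrite rE//.
    (* Each indicator is bounded by e^0, and coordinate [i0], absent from [g], also gets exponent 0,
       so that a transform at natural points dominates the mass. *)
    have /choice[k fk] : forall i, exists k : nat,
        forall x, (i != i0 -> f i x <= expR (- (k%:R * x))) /\ (i = i0 -> k = 0%N).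
      move=> i; have [->|ii0] := eqVneq i i0; first by exists 0%N.
      have [ij|ji] := ltnP i j.
        have [/(_ (ltnW ij))[C _ fC] _] := okf i; exists 0%N => x; split => // _.
        by rewrite mul0r oppr0 expR0 fC indicE; case: (_ \in _).
      have [_ /(_ _)[|l fl]] := okf i.
        rewrite ltn_neqAle ji andbT.
        by apply: contra_neq ii0 => ji'; apply/val_inj.
      by exists l => x; rewrite fl; split => //; move/eqP; rewrite (negbTE ii0).
    rewrite (le_lt_trans _ (moo k))//; apply: ge0_le_integral => //.
    - by apply/measurable_EFinP; exact: measurable_expdot.
    - move=> x _; rewrite lee_fin expdotE [leRHS](bigD1 i0)//= mxE.
      have [_ ->//] := fk i0 0; rewrite mul0r oppr0 expR0 mul1r.
      apply: ler_prod => i ii0; rewrite (ok0 _ _ okf)/= mxE.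
      by have [+ _] := fk i (tnth x i); exact.
  have pE : forall A, measurable A -> q1 A = q2 A.
    apply: laplace_unique1.
    - by rewrite q1E//; exact: fin r1E _.
    - by rewrite q2E//; exact: fin r2E _.
    - by rewrite q1E//; exact: push0 r1E _.
    - by rewrite q2E//; exact: push0 r2E _.
    - move=> k; have e0 (x : R) : 0 <= expR (- (k%:R * x)) by exact: expR_ge0.
      rewrite (pexp _ _ _ r1E q1I _ (measurable_expRM _) e0).
      by rewrite (pexp _ _ _ r2E q2I _ (measurable_expRM _) e0).
  under eq_integral do rewrite fsplit fB.
  under [RHS]eq_integral do rewrite fsplit fB.
  have mB1 : measurable_fun setT (\1_B : R -> R) by [].
  have B0 (x : R) : 0 <= \1_B x :> R by rewrite indicE.
  rewrite -(pexp _ _ _ r1E q1I _ mB1 B0) -(pexp _ _ _ r2E q2I _ mB1 B0).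
  by apply: eq_measure_integral => A mA _; exact: pE.
apply: measure_eq_rectangle => //.
  have := m1oo (fun=> 0%N); rewrite /laplace.
  rewrite (@eq_integral _ _ _ _ _ (cst 1%:E)); first by rewrite integral_cst// mul1e.
  by move=> x _; rewrite /expdot big1 ?oppr0 ?expR0// => i _; rewrite mxE mul0r.
move=> B mB; have e (m : {measure set (n.-tuple R) -> \bar R}) :
   m (rectangle B) = (\int[m]_x (\prod_(i < n) \1_(B i) (tnth x i))%:E)%E.
  under eq_integral do rewrite prod_indic.
  by rewrite integral_indic ?setIT//; exact: measurable_rectangle.
rewrite !e; apply: (claim n (leqnn n) (fun i => \1_(B i))) => i; split.
  by move=> _; exists (B i).
by rewrite leqNgt ltn_ord.
Qed.

Lemma expdotD n (theta eta : 'rV[R]_n) x :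
  expdot (theta + eta) x = expdot theta x * expdot eta x.
Proof.
rewrite /expdot -expRD -opprD -big_split/=; congr (expR (- _)).
by apply: eq_bigr => i _; rewrite mxE mulrDl.
Qed.

Lemma expdot0 n x : @expdot R n 0 x = 1.
Proof. by rewrite /expdot big1 ?oppr0 ?expR0// => i _; rewrite mxE mul0r. Qed.

(** Tilting with all exponents equal to M + 1 makes both measures finite and brings every natural
    point into the range of the hypothesis; tilting back with the opposite exponents recovers the
    original measures. *)
Lemma laplace_unique n (m1 m2 : {measure set (n.-tuple R) -> \bar R}) (M : R) :
  (forall i, m1 [set x | tnth x i < 0] = 0%E) ->
  (forall i, m2 [set x | tnth x i < 0] = 0%E) ->
  (forall theta : 'rV[R]_n, (forall i, M < theta 0 i) ->
    (laplace m1 theta < +oo)%E /\ laplace m1 theta = laplace m2 theta) ->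
  forall A, measurable A -> m1 A = m2 A.
Proof.
move=> m10 m20 m12.
pose a : 'rV[R]_n := const_mx (M + 1).
have mE (b : 'rV[R]_n) : measurable_fun setT (EFin \o expdot b).
  by apply/measurable_EFinP; exact: measurable_expdot.
have E0 (b : 'rV[R]_n) x : (0 <= (EFin \o expdot b) x)%E by rewrite lee_fin expR_ge0.
have [v1 v1E] := density_measure m1 (mE a) (E0 a).
have [v2 v2E] := density_measure m2 (mE a) (E0 a).
have lapE (m v : {measure set (n.-tuple R) -> \bar R}) theta
    (vE : forall A, measurable A -> v A = (\int[m]_(x in A) (EFin \o expdot a) x)%E) :
    laplace v theta = laplace m (theta + a).
  rewrite /laplace (ge0_integral_density (mE a) (E0 a) vE (mE theta) (E0 theta)).
  by apply: eq_integral => x _; rewrite expdotD.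
have v0 (m v : {measure set (n.-tuple R) -> \bar R}) i
    (vE : forall A, measurable A -> v A = (\int[m]_(x in A) (EFin \o expdot a) x)%E) :
    m [set x | tnth x i < 0] = 0%E -> v [set x | tnth x i < 0] = 0%E.
  have mN := @measurable_tnth_lt n i 0.
  by move=> m0; rewrite vE//; apply: null_set_integral => //; exact: measurable_funTS.
have v12 : forall A, measurable A -> v1 A = v2 A.
  have aM (k : 'I_n -> nat) i : M < ((\row_i (k i)%:R) + a) 0 i.
    by rewrite !mxE ltr_wpDl// ltrDl.
  apply: laplace_unique_nat.
  - by move=> k; rewrite (lapE _ _ _ v1E); have [] := m12 _ (aM k).
  - by move=> i; exact: v0 v1E _.
  - by move=> i; exact: v0 v2E _.
  - by move=> k; rewrite (lapE _ _ _ v1E) (lapE _ _ _ v2E); have [] := m12 _ (aM k).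
move=> A mA.
pose h x := ((\1_A x : R) * expdot (- a) x)%:E.
have mh : measurable_fun setT h.
  by apply/measurable_EFinP; apply: measurable_funM => //; exact: measurable_expdot.
have h0 x : (0 <= h x)%E by rewrite lee_fin mulr_ge0 ?expR_ge0// indicE.
have back (m v : {measure set (n.-tuple R) -> \bar R})
    (vE : forall A, measurable A -> v A = (\int[m]_(x in A) (EFin \o expdot a) x)%E) :
    m A = (\int[v]_x h x)%E.
  rewrite (ge0_integral_density (mE a) (E0 a) vE mh h0).
  rewrite -[in LHS](setIT A) -integral_indic//; apply: eq_integral => x _.
  by rewrite /h/= -EFinM -mulrA -expdotD addNr expdot0 mulr1.
by rewrite (back _ _ v1E) (back _ _ v2E); apply: eq_measure_integral => B mB _; exact: v12.
Qed.

End UniquenessN.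

(** * Power series *)

Section PowerSeries.
Variable R : realType.

Lemma natSM_geometric_bounded (t : R) : 0 < t < 1 ->
  exists2 K : R, 0 <= K & forall n, n.+1%:R * t ^+ n <= K.
Proof.
move=> /andP[t0 t1]; pose s := t^-1 - 1.
have s0 : 0 < s by rewrite subr_gt0 invf_gt1.
have s1 : 0 < 1 + s by rewrite addr_gt0.
have bern n : 1 + n%:R * s <= (1 + s) ^+ n.
  elim: n => [|n IH]; first by rewrite mul0r addr0 expr0.
  rewrite exprS (@le_trans _ _ ((1 + s) * (1 + n%:R * s)))//; last first.
    by rewrite ler_wpM2l// ltW.
  have : 0 <= n%:R * (s * s) by rewrite !mulr_ge0// ltW.
  rewrite -natr1; nra.
(* (1 + 1/s)(1 + n s) >= n + 1, and 1 + n s <= (1 + s)^n = t^(-n) by Bernoulli. *)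
exists (1 + s^-1) => [|n]; first by rewrite addr_ge0// invr_ge0 ltW.
have tE : t = (1 + s)^-1 by rewrite /s addrC subrK invrK.
rewrite [in leLHS]tE exprVn ler_pdivrMr ?exprn_gt0//.
rewrite (@le_trans _ _ ((1 + s^-1) * (1 + n%:R * s)))//; last first.
  by rewrite ler_wpM2l// addr_ge0// invr_ge0 ltW.
have : 0 <= n%:R * s by rewrite mulr_ge0// ltW.
have : 0 < s^-1 by rewrite invr_gt0.
have : s^-1 * (n%:R * s) = n%:R by rewrite mulrCA mulVf ?mulr1// gt_eqF.
rewrite -natr1; nra.
Qed.

Lemma is_cvg_pseries_diffs (A : R^nat) (e : R) :
  (forall h, `|h| < e -> cvgn (pseries A h)) ->
  forall h, `|h| < e -> cvgn (pseries (pseries_diffs A) h).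
Proof.
move=> cA h he.
(* Two intermediate radii: the terms are bounded at r', the factor n + 1 of the derivative is
   absorbed by (r / r')^n, and (|h| / r)^n remains as a convergent geometric series. *)
pose r := (`|h| + e) / 2; pose r' := (r + e) / 2.
have h0 := normr_ge0 h.
have hr : `|h| < r by rewrite /r; lra.
have rr' : r < r' by rewrite /r' /r; lra.
have r'e : r' < e by rewrite /r' /r; lra.
have r0 : 0 < r by lra.
have r'0 : 0 < r' by lra.
have cr' : cvgn (pseries A r') by apply: cA; rewrite gtr0_norm.
have [K [Kr HK]] := cvg_series_bounded cr'.
have {}HK n : `|A n| * r' ^+ n <= `|K| + 1.
  have KK : K < `|K| + 1 by rewrite (le_lt_trans (ler_norm _))// ltrDl.
  by have := HK _ KK n I; rewrite /= normrM normrX (gtr0_norm r'0).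
pose t := r / r'.
have t01 : 0 < t < 1 by rewrite divr_gt0//= ltr_pdivrMr// mul1r.
have [C C0 HC] := natSM_geometric_bounded t01.
pose q := `|h| / r.
have q1 : `|q| < 1 by rewrite /q normrM normr_id normfV (gtr0_norm r0) ltr_pdivrMr// mul1r.
have q0 : 0 <= q by rewrite /q divr_ge0// ltW.
have KC0 : 0 <= (`|K| + 1) / r' * C.
  by apply: mulr_ge0 => //; apply: divr_ge0; [rewrite addr_ge0|exact: ltW].
have cg := @is_cvg_geometric_series _ ((`|K| + 1) / r' * C) q q1.
apply: normed_cvg; apply: (series_le_cvg _ _ _ cg).
- by move=> n; exact: normr_ge0.
- by move=> n; rewrite /geometric/= mulr_ge0// exprn_ge0.
move=> n; rewrite /geometric/q/= /pseries_diffs !normrM normr_nat normrX.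
have -> : `|h| ^+ n = (`|h| / r) ^+ n * (t ^+ n * r' ^+ n).
  by rewrite -!exprMn /t divfK ?gt_eqF// divfK ?gt_eqF.
have -> : n.+1%:R * `|A n.+1| * ((`|h| / r) ^+ n * (t ^+ n * r' ^+ n)) =
    (`|A n.+1| * r' ^+ n.+1) / r' * (n.+1%:R * t ^+ n) * (`|h| / r) ^+ n.
  by rewrite exprSr; field; rewrite !gt_eqF.
have qn : 0 <= (`|h| / r) ^+ n by exact: exprn_ge0 q0.
rewrite ler_wpM2r//.
have tn : 0 <= t ^+ n by rewrite exprn_ge0// ltW//; case/andP: t01.
apply: ler_pM => //.
- by apply: divr_ge0; [apply: mulr_ge0 => //; apply: exprn_ge0|]; exact: ltW.
- by rewrite mulr_ge0.
- by apply: ler_wpM2r => //; rewrite invr_ge0; exact: ltW.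
Qed.

Lemma is_derive_pseries (A : R^nat) (e : R) :
  (forall h, `|h| < e -> cvgn (pseries A h)) ->
  forall h : R, `|h| < e ->
  is_derive h (1 : R) (fun x => limn (pseries A x)) (limn (pseries (pseries_diffs A) h)).
Proof.
move=> cA h he; pose r := (`|h| + e) / 2.
have h0 := normr_ge0 h.
have r0 : 0 < r by rewrite /r; lra.
have re : `|r| < e by rewrite (gtr0_norm r0) /r; lra.
have cA1 := is_cvg_pseries_diffs cA; have cA2 := is_cvg_pseries_diffs cA1.
apply: (@pseries_snd_diffs _ _ r); [exact: cA|exact: cA1|exact: cA2|].
by rewrite (gtr0_norm r0) /r; lra.
Qed.

Lemma pseries0 (A : R^nat) : limn (pseries A 0) = A 0%N.
Proof.
apply: cvg_lim => //; rewrite /pseries -cvg_shiftS.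
have -> : (fun n => series (fun i => A i * 0 ^+ i) n.+1) = cst (A 0%N).
  apply/funext => n; rewrite /series/= big_nat_recl//= expr0 mulr1 big1 ?addr0//.
  by move=> i _; rewrite exprS mul0r mulr0.
exact: cvg_cst.
Qed.

(** Only [G 0] is compared with the series; the other [G i] come from it by differentiation alone,
    so that formally computed derivatives can be plugged in. The induction shifts both the series
    and [G]. *)
Lemma pseries_coef_derive (A : R^nat) (G : nat -> R -> R) (e : R) : 0 < e ->
  (forall h, `|h| < e -> cvgn (pseries A h)) ->
  (forall h, `|h| < e -> limn (pseries A h) = G 0%N h) ->
  (forall i (h : R), `|h| < e -> is_derive h (1 : R) (G i) (G i.+1 h)) ->
  forall m, m`!%:R * A m = G m 0.
Proof.
move=> e0 cA AG dG m; elim: m A G cA AG dG => [|m IH] A G cA AG dG.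
  by rewrite mul1r -AG ?normr0// pseries0.
have cA1 := is_cvg_pseries_diffs cA.
rewrite factS mulnC natrM -mulrA -(IH (pseries_diffs A) (fun i => G i.+1))//.
move=> h he; have dA := is_derive_pseries cA he.
have nAG : \forall x \near h, limn (pseries A x) = G 0%N x.
  have : \forall x \near h, `|x| < e.
    have /cvgr_lt : (fun x : R => `|x|) @ h --> `|h| by apply: cvg_norm; exact: cvg_id.
    exact.
  by apply: filterS => x; exact: AG.
have := near_eq_is_derive nAG dA.
by move=> [_ <-]; have [_ ->] := dG 0%N h he.
Qed.

Lemma pseries_eq0 (A : R^nat) (e : R) : 0 < e ->
  (forall h, `|h| < e -> cvgn (pseries A h)) ->
  (forall h, `|h| < e -> limn (pseries A h) = 0) ->
  forall m, A m = 0.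
Proof.
move=> e0 cA A0 m.
have := @pseries_coef_derive A (fun _ _ => 0) e e0 cA A0.
move=> /(_ _ m) /eqP; rewrite mulf_eq0 pnatr_eq0 gtn_eqF ?fact_gt0//= => H.
by apply/eqP/H => i h _; exact: is_derive_cst.
Qed.
End PowerSeries.

(** * Extension of Laplace transforms *)

Section BilateralLaplace.
Variable R : realType.
Implicit Types (m mu nu : {measure set R -> \bar R}) (h t x : R).

Definition bilateral m t : \bar R := (\int[m]_x (expR (- (t * x)))%:E)%E.

(* The expansion of e^(hx) + e^(-hx) in powers of h has nonnegative coefficients,
   so by Tonelli the values of this integral near h = 0 determine all of them,
   with no convergence issue. *)
Definition symmetric_exp m h : \bar R :=
  (\int[m]_x (expR (h * x) + expR (- (h * x)))%:E)%E.

Definition pair_coeff x (j : nat) : R := (x ^+ j + (- x) ^+ j) / j`!%:R.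

Lemma pair_coeff_odd x j : odd j -> pair_coeff x j = 0.
Proof. by move=> oj; rewrite /pair_coeff exprNn -signr_odd oj expr1 mulN1r subrr mul0r. Qed.

Lemma pair_coeff_ge0 x j : 0 <= pair_coeff x j.
Proof.
have [oj|ej] := boolP (odd j); first by rewrite pair_coeff_odd.
by rewrite divr_ge0// addr_ge0// exprn_even_ge0.
Qed.

Lemma measurable_pair_coeff j : measurable_fun setT (pair_coeff ^~ j).
Proof.
apply: measurable_funM => //; apply: measurable_funD; first exact: measurable_funX.
have mN : measurable_fun setT (fun x : R => - x) by exact: oppr_measurable.
by apply: measurable_funX.
Qed.

Lemma expR_pair h x : 0 <= h ->
  ((expR (h * x) + expR (- (h * x)))%:E =
   \sum_(j <oo) (h ^+ j * pair_coeff x j)%:E)%E.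
Proof.
move=> h0; apply/esym/cvg_lim => //.
under eq_fun do rewrite sumEFin.
apply: cvg_EFin; first exact: nearW.
have -> : fine \o (fun n => (\sum_(0 <= i < n) (h ^+ i * pair_coeff x i))%:E) =
    series (exp_coeff (h * x)) \+ series (exp_coeff (- (h * x))).
  apply/funext => n; rewrite /series/= -big_split/=; apply: eq_bigr => i _.
  by rewrite /pair_coeff /exp_coeff/= -mulrN !exprMn; ring.
by apply: cvgD; apply: is_cvg_series_exp_coeff.
Qed.

Lemma symmetric_expE m h : 0 <= h ->
  (symmetric_exp m h = \sum_(j <oo) (h ^+ j)%:E * \int[m]_x (pair_coeff x j)%:E)%E.
Proof.
move=> h0; rewrite /symmetric_exp; under eq_integral do rewrite expR_pair//.
rewrite integral_nneseries//.
- apply: eq_eseriesr => j _; under eq_integral do rewrite EFinM.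
  rewrite ge0_integralZl_EFin//.
  + by move=> x _; rewrite lee_fin pair_coeff_ge0.
  + by apply/measurable_EFinP; exact: measurable_pair_coeff.
  + exact: exprn_ge0.
- by move=> j; apply/measurable_EFinP; apply: measurable_funM => //; exact: measurable_pair_coeff.
- by move=> j x _; rewrite lee_fin mulr_ge0 ?pair_coeff_ge0 ?exprn_ge0.
Qed.

Lemma symmetric_expN m h : symmetric_exp m (- h) = symmetric_exp m h.
Proof. by apply: eq_integral => x _; rewrite mulNr opprK addrC. Qed.

(** Finiteness near 0 makes the coefficient integrals finite, and uniqueness of power series
    identifies them. The expansion is an identity in [0, +oo] for every h >= 0, so equality
    propagates without any finiteness for large h. *)
Lemma symmetric_exp_eq mu nu (e : R) : 0 < e ->
  (forall h, 0 <= h < e ->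
    symmetric_exp mu h = symmetric_exp nu h /\ (symmetric_exp mu h < +oo)%E) ->
  forall h, symmetric_exp mu h = symmetric_exp nu h.
Proof.
move=> e0 H.
pose a m j := (\int[m]_x (pair_coeff x j)%:E)%E.
have a0 m j : (0 <= a m j)%E by apply: integral_ge0 => x _; rewrite lee_fin pair_coeff_ge0.
have t0 m h j : 0 <= h -> (0 <= (h ^+ j)%:E * a m j)%E.
  by move=> h0; rewrite mule_ge0// lee_fin exprn_ge0.
have fin m : (forall h, 0 <= h < e -> (symmetric_exp m h < +oo)%E) ->
    forall j, a m j \is a fin_num.
  move=> Hm j; pose h := e / 2.
  have h0 : 0 < h by rewrite divr_gt0.
  have he : 0 <= h < e by rewrite (ltW h0)/= /h; lra.
  have := Hm _ he; rewrite symmetric_expE ?(ltW h0)// => soo.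
  have : ((h ^+ j)%:E * a m j < +oo)%E.
    apply: le_lt_trans soo.
    have := @nneseries_lim_ge _ (fun j => (h ^+ j)%:E * a m j)%E xpredT 0 j.+1
      (fun j _ _ => t0 m h j (ltW h0)).
    apply: le_trans; rewrite big_nat_recr//= leeDr// sume_ge0// => i _.
    exact: t0 (ltW h0).
  rewrite ge0_fin_numE//; case: (a m j) (a0 m j) => [r||]//= _; first by move=> _; rewrite ltry.
  by rewrite gt0_muley// lte_fin exprn_gt0.
have Hmu h : 0 <= h < e -> (symmetric_exp mu h < +oo)%E by case/H.
have Hnu h : 0 <= h < e -> (symmetric_exp nu h < +oo)%E by case/H => <-.
have cv m : (forall h, 0 <= h < e -> (symmetric_exp m h < +oo)%E) ->
    forall h, `|h| < e ->
    pseries (fun j => fine (a m j)) h @ \oo --> fine (symmetric_exp m h).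
  move=> Hm h he.
  (* Uniqueness of power series needs both signs of h; the odd coefficients vanish, so the partial
     sums at h and |h| coincide. *)
  have eqh : pseries (fun j => fine (a m j)) h = pseries (fun j => fine (a m j)) `|h|.
    rewrite /pseries; congr series; apply/funext => j/=.
    have [oj|ej] := boolP (odd j).
      by rewrite /a integral0_eq ?mul0r// => x _; rewrite pair_coeff_odd.
    by rewrite -normrX ger0_norm// exprn_even_ge0.
  have -> : symmetric_exp m h = symmetric_exp m `|h|.
    by have [h0|h0] := leP 0 h; [rewrite (ger0_norm h0)|rewrite (ltr0_norm h0) symmetric_expN].
  rewrite eqh; have h0 := normr_ge0 h; set k := `|h| in h0 he *.
  have kfin : symmetric_exp m k \is a fin_num.
    by rewrite ge0_fin_numE ?Hm ?h0// symmetric_expE// nneseries_ge0// => j _ _; exact: t0.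
  have : (\sum_(0 <= j < n) (k ^+ j)%:E * a m j)%E @[n --> \oo] --> (fine (symmetric_exp m k))%:E.
    rewrite fineK// symmetric_expE//.
    by apply: is_cvg_nneseries => j _ _; exact: t0.
  move=> /fine_cvg; apply: cvg_trans; apply: near_eq_cvg; apply: nearW => n /=.
  rewrite (eq_bigr (fun j => (k ^+ j * fine (a m j))%:E)); last first.
    by move=> j _; rewrite EFinM fineK// fin.
  by rewrite sumEFin /pseries/series/=; apply: eq_bigr => j _; rewrite mulrC.
have aE j : a mu j = a nu j.
  rewrite -(fineK (fin _ Hmu j)) -(fineK (fin _ Hnu j)); congr EFin.
  apply/eqP; rewrite -subr_eq0; apply/eqP.
  pose d j := fine (a mu j) - fine (a nu j); rewrite -/(d j).
  have cd h : `|h| < e -> pseries d h @ \oo --> (0 : R).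
    move=> he; rewrite -[X in _ --> X](subrr (fine (symmetric_exp mu h))).
    have -> : pseries d h = pseries (fun j => fine (a mu j)) h \- pseries (fun j => fine (a nu j)) h.
      apply/funext => n; rewrite /pseries/series/= -sumrB; apply: eq_bigr => i _.
      by rewrite /d mulrBl.
    have nn : symmetric_exp mu h = symmetric_exp nu h.
      wlog h0 : h he / 0 <= h => [hw|].
        have [h0|h0] := leP 0 h; first exact: hw.
        by rewrite -(symmetric_expN mu) -(symmetric_expN nu) hw ?normrN// oppr_ge0 ltW.
      by have [] := H h; rewrite // h0 -(ger0_norm h0).
    apply: cvgB; first exact: cv.
    by rewrite nn; exact: cv.
  apply: (pseries_eq0 e0) => h he; first by apply/cvg_ex; exists 0; exact: cd.
  by apply/cvg_lim => //; exact: cd.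
move=> h; wlog h0 : h / 0 <= h => [hw|].
  have [h0|h0] := leP 0 h; first exact: hw.
  by rewrite -(symmetric_expN mu) -(symmetric_expN nu) hw// oppr_ge0 ltW.
by rewrite !symmetric_expE//; apply: eq_eseriesr => j _; rewrite -!/(a _ _) aE.
Qed.

Lemma bilateral_ge0 m t : (0 <= bilateral m t)%E.
Proof. by apply: integral_ge0 => x _; rewrite lee_fin expR_ge0. Qed.

Lemma measurable_expE t : measurable_fun setT (fun x : R => (expR (- (t * x)))%:E).
Proof. by apply/measurable_EFinP; exact: measurable_expRM. Qed.

Lemma symmetric_tilt m t : exists2 m' : {measure set R -> \bar R},
  (forall s, bilateral m' s = bilateral m (t + s)) &
  forall h, symmetric_exp m' h = (bilateral m (t + h) + bilateral m (t - h))%E.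
Proof.
have e0 s x : (0 <= (expR (- (s * x)))%:E)%E by rewrite lee_fin expR_ge0.
have [m' m'E] := density_measure m (measurable_expE t) (e0 t).
have bE s : bilateral m' s = bilateral m (t + s).
  rewrite /bilateral (ge0_integral_density (measurable_expE t) (e0 t) m'E (measurable_expE s) (e0 s)).
  by apply: eq_integral => x _; rewrite -EFinM -expRD mulrDl opprD addrC.
exists m' => // h; rewrite -!bE /symmetric_exp addeC.
under eq_integral do rewrite EFinD.
rewrite ge0_integralD//.
- by congr (_ + _)%E; apply: eq_integral => x _; rewrite mulNr opprK.
- rewrite (_ : (fun x => _) = (fun x => (expR (- (- h * x)))%:E)).
    exact: measurable_expE.
  by apply/funext => x; rewrite mulNr opprK.
- exact: measurable_expE.
Qed.

(** Tilting by e^(-tx) recentres the comparison of symmetrised transforms at t. Only the sum over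
    two mirror points is obtained: the values at one of them must be known to agree, and be finite,
    before the other can be extracted. *)
Lemma bilateral_reflect mu nu t (e : R) : 0 < e ->
  (forall s, `|s - t| < e -> bilateral mu s = bilateral nu s /\ (bilateral nu s < +oo)%E) ->
  forall h, (bilateral mu (t + h) + bilateral mu (t - h) =
             bilateral nu (t + h) + bilateral nu (t - h))%E.
Proof.
move=> e0 H h.
have [mu' _ muE] := symmetric_tilt mu t; have [nu' _ nuE] := symmetric_tilt nu t.
rewrite -muE -nuE; apply: (symmetric_exp_eq e0) => {}h /andP[h0 he].
have [E1 F1] : bilateral mu (t + h) = bilateral nu (t + h) /\ (bilateral nu (t + h) < +oo)%E.
  by apply: H; rewrite addrAC subrr add0r ger0_norm.
have [E2 F2] : bilateral mu (t - h) = bilateral nu (t - h) /\ (bilateral nu (t - h) < +oo)%E.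
  by apply: H; rewrite addrAC subrr add0r normrN ger0_norm.
by rewrite muE nuE E1 E2; split => //; rewrite lte_add_pinfty.
Qed.

(** Analytic continuation by reflections: equal finite values at the mirror image of t cancel and
    leave equality at t. To the right the known interval doubles in length at each step; to the left
    one reflection suffices once the right half-line is known. *)
Lemma bilateral_extend mu nu (a0 a b : R) : a0 <= a < b ->
  (forall t, a < t < b -> bilateral mu t = bilateral nu t) ->
  (forall t, a0 < t -> (bilateral nu t < +oo)%E) ->
  forall t, a0 < t -> bilateral mu t = bilateral nu t.
Proof.
move=> /andP[a0a ab] H F.
have cancel (t t1 c : R) : a < t1 < c -> (forall s, a < s < c -> bilateral mu s = bilateral nu s) ->
    a < t1 + t1 - t -> a0 < t ->
    bilateral mu (t1 + t1 - t) = bilateral nu (t1 + t1 - t) ->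
    bilateral mu t = bilateral nu t.
  move=> /andP[at1 t1c] Hc a2 a0t E2.
  pose e := Num.min (t1 - a) (c - t1).
  have e0 : 0 < e by rewrite lt_min !subr_gt0 at1.
  have He s : `|s - t1| < e -> bilateral mu s = bilateral nu s /\ (bilateral nu s < +oo)%E.
    rewrite lt_min !ltr_norml => /andP[/andP[s1 s2] /andP[s3 s4]].
    by split; [apply: Hc|apply: F]; lra.
  have := bilateral_reflect e0 He (t - t1).
  have -> : t1 + (t - t1) = t by ring.
  have -> : t1 - (t - t1) = t1 + t1 - t by ring.
  rewrite E2; have Fin : bilateral nu (t1 + t1 - t) \is a fin_num.
    by rewrite ge0_fin_numE ?bilateral_ge0// F// (le_lt_trans a0a).
  by move=> /(congr1 (fun z => z - bilateral nu (t1 + t1 - t))%E); rewrite !addeK.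
have L0 : 0 < b - a by rewrite subr_gt0.
have claim (N : nat) : forall t, a < t < a + (b - a) * 2 ^+ N -> bilateral mu t = bilateral nu t.
  elim: N => [t|N IH t /andP[at_ tN]].
    by rewrite expr0 mulr1 addrC subrK; exact: H.
  have L2 : 0 < (b - a) * 2 ^+ N by rewrite mulr_gt0// exprn_gt0.
  have {}tN : t < a + 2 * ((b - a) * 2 ^+ N) by move: tN; rewrite exprS mulrCA.
  set L := (b - a) * 2 ^+ N in IH L2 tN *.
  (* The mirror image of t will be a + g; g is small enough for a + g and the midpoint of t and a +
     g to lie in the known interval ]a, a + L[. *)
  pose g := Num.min (Num.min (t - a) (a + 2 * L - t)) L / 2.
  have [g0 [g1 [g2 g3]]] : 0 < g /\ g < t - a /\ g < a + 2 * L - t /\ g < L.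
    have m0 : 0 < Num.min (Num.min (t - a) (a + 2 * L - t)) L.
      by rewrite !lt_min L2 !subr_gt0 at_ tN.
    have m1 : Num.min (Num.min (t - a) (a + 2 * L - t)) L <= Num.min (t - a) (a + 2 * L - t).
      by rewrite ge_min lexx.
    have m2 : Num.min (t - a) (a + 2 * L - t) <= t - a by rewrite ge_min lexx.
    have m3 : Num.min (t - a) (a + 2 * L - t) <= a + 2 * L - t by rewrite ge_min lexx orbT.
    have m4 : Num.min (Num.min (t - a) (a + 2 * L - t)) L <= L by rewrite ge_min lexx orbT.
    by rewrite /g; split; [lra|split; [lra|split; lra]].
  have rE : (t + (a + g)) / 2 + (t + (a + g)) / 2 - t = a + g by field.
  apply: (cancel t ((t + (a + g)) / 2) (a + L)) => //.
  - by apply/andP; split; lra.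
  - by rewrite rE; lra.
  - lra.
  - by rewrite rE; apply: IH; apply/andP; split; lra.
have right_ t : a < t -> bilateral mu t = bilateral nu t.
  move=> at_; pose N := (Num.truncn ((t - a) / (b - a))).+1.
  apply: (claim N); rewrite at_/= -ltrBlDl mulrC -ltr_pdivrMr//.
  rewrite (lt_le_trans (truncnS_gt _))//.
  by rewrite -natrX ler_nat ltnW// ltn_expl.
move=> t a0t; have [ta|] := leP t a; last exact: right_.
(* The mirror image of t <= a about a + 1 is 2a + 2 - t >= a + 2, in the known region. *)
apply: (cancel t (a + 1) (a + 2)) => //.
- by apply/andP; split; lra.
- by move=> s /andP[s1 _]; exact: right_.
- lra.
- by apply: right_; lra.
Qed.
End BilateralLaplace.

(** * Gamma integrals and products of laws *)

Section GammaIntegral.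
Variable R : realType.
Local Notation leb := (@lebesgue_measure R).
Implicit Types (s a b w x c : R).

(** The image of Lebesgue measure under multiplication by c, scaled by c, has the right value on
    intervals, hence is Lebesgue measure. *)
Lemma ge0_integral_scale c (f : R -> \bar R) : 0 < c ->
  measurable_fun setT f -> (forall x, 0 <= f x)%E ->
  (\int[leb]_x f x = c%:E * \int[leb]_x f (c * x)%R)%E.
Proof.
move=> c0 mf f0.
have mc : measurable_fun setT (fun x : measurableTypeR R => c * x : measurableTypeR R).
  exact: measurable_funM.
have [nu [nuE nuI]] := image_measure leb mc.
have cnn : 0 <= c by exact: ltW.
pose m := mscale (NngNum cnn) nu.
have lm : forall A, measurable A -> leb A = m A.
  apply: lebesgue_measure_unique => _ [[x y] /= _ <-].
  rewrite /m /mscale/= nuE//.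
  have -> : (fun x => c * x) @^-1` `]x, y] = `]x / c, y / c]%classic.
    by apply/seteqP; split => z/=; rewrite !in_itv/= ltr_pdivrMr// ler_pdivlMr// ![z * c]mulrC.
  have e : (x / c < y / c) = (x < y) by rewrite ltr_pM2r ?invr_gt0.
  have E : leb `](x / c)%R, (y / c)%R]%classic = if x < y then (y / c - x / c)%:E else 0%E.
    by have := @lebesgue_measure_itv R `]x / c, y / c]; rewrite /= lte_fin e EFinB.
  transitivity (c%:E * if (x < y)%R then (y / c - x / c)%:E else 0)%E; last first.
    by congr (_ * _)%E; symmetry; exact: E.
  rewrite lebesgue_measure_itv/= lte_fin; case: ifP => _; last by rewrite mule0.
  by rewrite -EFinD -EFinM; congr EFin; field; exact: lt0r_neq0.
rewrite -nuI// -(ge0_integral_mscale _ _ (NngNum cnn))//.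
by apply: eq_measure_integral => A mA _; exact: lm.
Qed.

Definition gamma_density s a x : R :=
  \1_(`]0%R, +oo[%classic) x * (x `^ (s - 1) * expR (- (a * x))).

Lemma gamma_density_ge0 s a x : 0 <= gamma_density s a x.
Proof. by rewrite /gamma_density !mulr_ge0 ?powR_ge0 ?expR_ge0// indicE. Qed.

Lemma gamma_density_gt0 s a x : 0 < x -> gamma_density s a x = x `^ (s - 1) * expR (- (a * x)).
Proof. by move=> x0; rewrite /gamma_density indicE mem_set ?mul1r//= in_itv/= x0. Qed.

Lemma gamma_density_le0 s a x : x <= 0 -> gamma_density s a x = 0.
Proof.
move=> x0; rewrite /gamma_density indicE memNset ?mul0r//= in_itv/= andbT.
by apply/negP; rewrite -leNgt.
Qed.

Lemma measurable_gamma_density s a : measurable_fun setT (gamma_density s a).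
Proof.
apply: measurable_funM => //; apply: measurable_funM; last exact: measurable_expRM.
exact: measurable_powR.
Qed.

Definition gamma_int s a : \bar R := (\int[leb]_x (gamma_density s a x)%:E)%E.

Lemma GammaE s : Gamma s = fine (gamma_int s 1).
Proof.
rewrite /Gamma /Rintegral; congr fine; rewrite [LHS]integral_mkcond.
apply: eq_integral => x _; rewrite patchE; case: ifPn => [|/negP].
  by rewrite inE/= in_itv/= andbT => x0; rewrite gamma_density_gt0// mul1r.
rewrite inE/= in_itv/= andbT => /negP; rewrite -leNgt => x0.
by rewrite gamma_density_le0.
Qed.

Lemma gamma_intE s a : 0 < a -> gamma_int s a = ((a `^ (- s))%:E * gamma_int s 1)%E.
Proof.
move=> a0; rewrite /gamma_int.
rewrite [in RHS](ge0_integral_scale a0)//; last 2 first.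
- by apply/measurable_EFinP; exact: measurable_gamma_density.
- by move=> x; rewrite lee_fin gamma_density_ge0.
rewrite muleA -EFinM -ge0_integralZl_EFin//; last 3 first.
- by move=> x _; rewrite lee_fin gamma_density_ge0.
- apply/measurable_EFinP; apply: (measurableT_comp (measurable_gamma_density s 1)).
  exact: measurable_funM.
- by rewrite mulr_ge0 ?powR_ge0// ltW.
apply: eq_integral => x _; rewrite -EFinM; congr EFin.
have [x0|x0] := leP x 0.
  by rewrite !gamma_density_le0 ?mulr0// pmulr_rle0.
rewrite !gamma_density_gt0 ?mulr_gt0// mul1r powRM ?(ltW a0) ?(ltW x0)//.
have key : a `^ (- s) * a * a `^ (s - 1) = 1.
  rewrite -[X in _ * X * _](powRr1 (ltW a0)) -!powRD ?(gt_eqF a0) ?implybT//.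
  by rewrite (_ : - s + 1 + (s - 1) = 0) ?powRr0//; ring.
by rewrite !mulrA key mul1r.
Qed.

Lemma is_derive_powR s x : 0 < x ->
  is_derive x (1 : R) (fun y : R => y `^ s) (s * x `^ (s - 1)).
Proof.
move=> x0; have xi : x \in `]0, +oo[ by rewrite in_itv/= x0.
apply: DeriveDef; first exact: derivable_powR.
by rewrite -derive1E powR_derive1.
Qed.

(** The integrand may blow up at 0, so the fundamental theorem is applied on [1 / (i + 2), 1] and i
    tends to infinity; dropping the boundary term at the left end gives the bound. *)
Lemma integral_powR_unit_le s : 0 < s ->
  (\int[leb]_(x in `]0%R, 1%R]) (x `^ (s - 1))%:E <= (s^-1)%:E)%E.
Proof.
move=> s0.
pose F (i : nat) := `[i.+2%:R^-1, (1 : R)]%classic.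
have UF : \bigcup_i F i = `]0%R, 1%R]%classic.
  apply/seteqP; split => x /=.
    by move=> [i _]; rewrite /F/= !in_itv/= => /andP[+ ->]; rewrite andbT; exact: lt_le_trans.
  rewrite in_itv/= => /andP[x0 x1]; exists (Num.truncn x^-1) => //.
  rewrite /F/= in_itv/= x1 andbT invf_ple ?posrE//.
  by rewrite (le_trans (ltW (truncnS_gt _)))// ler_nat.
have mp : measurable_fun setT (fun x : R => (x `^ (s - 1))%:E).
  by apply/measurable_EFinP; exact: measurable_powR.
have cv : (\int[leb]_(x in F i) (x `^ (s - 1))%:E)%E @[i --> \oo] -->
    (\int[leb]_(x in \bigcup_i F i) (x `^ (s - 1))%:E)%E.
  apply: ge0_nondecreasing_set_cvg_integral => //.
  - move=> i j ij; apply/subsetPset => x; rewrite /F/= !in_itv/= => /andP[+ ->].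
    by rewrite andbT; apply: le_trans; rewrite lef_pV2 ?posrE// ler_nat !ltnS.
  - by move=> i; exact: measurable_itv.
  - by move=> i; exact: measurable_funTS.
  - by move=> i x _; rewrite lee_fin powR_ge0.
rewrite -UF; apply: (cvge_to_le cv).
apply: nearW => i.
have d0 : 0 < (i.+2%:R^-1 : R) by rewrite invr_gt0.
have d1 : (i.+2%:R^-1 : R) < 1 by rewrite invf_lt1// ltr1n.
pose G x := s^-1 * x `^ s.
have dG x : 0 < x -> is_derive x (1 : R) G (x `^ (s - 1)).
  move=> x0; have := @is_deriveZ _ _ _ (fun y : R => y `^ s) s^-1 x 1 _ (is_derive_powR s x0).
  by rewrite /GRing.scale/= mulKf// gt_eqF.
rewrite (@continuous_FTC2 _ _ G)//.
- rewrite /G powR1 mulr1 -EFinB lee_fin gerDl oppr_le0 mulr_ge0 ?powR_ge0//.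
  by rewrite invr_ge0 ltW.
- apply: continuous_in_subspaceT => x; rewrite inE/= in_itv/= => /andP[x0 _].
  apply: differentiable_continuous; apply/derivable1_diffP.
  by apply: derivable_powR; rewrite in_itv/= (lt_le_trans d0).
- have cG x : 0 < x -> {for x, continuous G}.
    by move=> x0; apply: differentiable_continuous; apply/derivable1_diffP; have [] := dG _ x0.
  split.
  + by move=> x; rewrite in_itv/= => /andP[x0 _]; have [] := dG _ (lt_trans d0 x0).
  + by apply: cvg_at_right_filter; exact: cG.
  + by apply: cvg_at_left_filter; exact: cG.
- move=> x; rewrite in_itv/= => /andP[x0 _].
  by rewrite derive1E; have [_ ->] := dG _ (lt_trans d0 x0).
Qed.

Lemma gamma_density_tail s : exists2 C : R, 0 <= C &
  forall x, 1 <= x -> x `^ (s - 1) * expR (- x) <= C * expR (- (x / 2)).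
Proof.
(* Chosen so that |s - 1| e <= 1/2: with ln x <= e x + |ln e|, the power of x costs at most half of
   the exponential decay. *)
pose e := (2 * (`|s - 1| + 1))^-1.
have N1 : 0 < `|s - 1| + 1 by rewrite ltr_wpDl.
have e0 : 0 < e by rewrite invr_gt0 mulr_gt0.
exists (expR (`|s - 1| * `|ln e|)) => [|x x1]; first exact: expR_ge0.
have x0 : 0 < x by exact: lt_le_trans x1.
rewrite /powR (gt_eqF x0) -!expRD ler_expR.
have l0 : 0 <= ln x by exact: ln_ge0.
have le1 : (s - 1) * ln x <= `|s - 1| * ln x by rewrite ler_wpM2r// ler_norm.
have le2 : ln x <= e * x + `|ln e|.
  have : ln (e * x) < e * x by apply: ln_sublinear; rewrite mulr_gt0.
  rewrite lnM ?posrE// => h; have := ler_norm (- ln e); rewrite normrN; lra.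
have le3 : `|s - 1| * ln x <= `|s - 1| * (e * x + `|ln e|) by rewrite ler_wpM2l.
have le4 : `|s - 1| * e * x <= x / 2.
  rewrite [leRHS]mulrC ler_pM2r// /e invfM mulrCA -[leRHS]mulr1 ler_pM2l ?invr_gt0//.
  by rewrite ler_pdivrMr// mul1r lerDl.
rewrite mulrDr mulrA in le3; lra.
Qed.

Lemma gamma_int_lty s : 0 < s -> (gamma_int s 1 < +oo)%E.
Proof.
move=> s0; have [C C0 HC] := gamma_density_tail s.
have h0 : 0 <= 2^-1 :> R by rewrite invr_ge0.
pose f1 x := ((x `^ (s - 1))%:E : \bar R).
pose f2 x := ((2 * C) * exponential_pdf 2^-1 x)%:E : \bar R.
have mf1 : measurable_fun setT f1 by apply/measurable_EFinP; exact: measurable_powR.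
have me : measurable_fun setT (EFin \o @exponential_pdf R 2^-1).
  by apply/measurable_EFinP; exact: measurable_exponential_pdf.
have mf2 : measurable_fun setT f2.
  by apply/measurable_EFinP; apply: measurable_funM => //; exact: measurable_exponential_pdf.
have f20 x : (0 <= f2 x)%E by rewrite lee_fin !mulr_ge0// exponential_pdf_ge0.
have f10 x : (0 <= f1 x)%E by rewrite lee_fin powR_ge0.
apply: (@le_lt_trans _ _ (\int[leb]_x ((f1 \_ `]0%R, 1%R]) x + f2 x))%E).
  apply: ge0_le_integral => //.
  - by move=> x _; rewrite lee_fin gamma_density_ge0.
  - by apply/measurable_EFinP; exact: measurable_gamma_density.
  - by apply: emeasurable_funD => //; apply/(measurable_restrictT _ _).1 => //; exact: measurable_funTS.
  move=> x _; have [x0|x0] := leP x 0.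
    rewrite gamma_density_le0// adde_ge0// erestrict_ge0//.
  rewrite gamma_density_gt0// mul1r; have [x1|x1] := leP x 1.
    rewrite patchE mem_set/=; last by rewrite in_itv/= x0.
    apply: le_trans (leeDl _ (f20 x)); rewrite lee_fin ler_piMr ?powR_ge0//.
    by rewrite expR_le1 oppr_le0 ltW.
  apply: (le_trans _ (leeDr _ _)); last exact: erestrict_ge0.
  rewrite lee_fin exponential_pdfE ?(ltW x0)// (le_trans (HC _ (ltW x1)))//.
  by rewrite mulrACA divff// mul1r mulNr [_^-1 * x]mulrC.
rewrite ge0_integralD//; last 2 first.
- by move=> x _; exact: erestrict_ge0.
- by apply/(measurable_restrictT _ _).1 => //; exact: measurable_funTS.
rewrite -integral_mkcond lte_add_pinfty//.
  by rewrite (le_lt_trans (integral_powR_unit_le s0))// ltry.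
rewrite /f2; under eq_integral do rewrite EFinM.
rewrite ge0_integralZl_EFin ?mulr_ge0//.
- by rewrite integral_exponential_pdf ?invr_gt0// mule1 ltry.
- by move=> x _; rewrite lee_fin exponential_pdf_ge0.
Qed.

Lemma gamma_int_gt0 s : (0 < gamma_int s 1)%E.
Proof.
(* A lower bound for the density on [1, 2], valid for either sign of s - 1. *)
pose c : R := expR (- (`|s - 1| * ln 2)) * expR (- 2).
have c0 : 0 < c by rewrite mulr_gt0 ?expR_gt0.
apply: (@lt_le_trans _ _ (\int[leb]_x (c * \1_(`[1%R, 2%R]%classic) x)%:E)%E).
  under eq_integral do rewrite EFinM.
  rewrite ge0_integralZl_EFin ?(ltW c0)//; last exact/measurable_EFinP.
  have E : leb `[1%R, 2%R]%classic = 1%:E.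
    have := @lebesgue_measure_itv R `[1, 2]; rewrite /= lte_fin ltr1n -EFinB => ->.
    by congr EFin; lra.
  have -> : (\int[leb]_x (\1_(`[1%R, 2%R]%classic) x)%:E = 1)%E.
    by rewrite integral_indic// setIT; exact: E.
  by rewrite mule1 lte_fin.
apply: ge0_le_integral => //.
- by move=> x _; rewrite lee_fin mulr_ge0 ?indicE// ltW.
- by apply/measurable_EFinP; exact: measurable_funM.
- by apply/measurable_EFinP; exact: measurable_gamma_density.
move=> x _; rewrite lee_fin indicE; have [|_] := boolP (x \in _); last first.
  by rewrite mulr0 gamma_density_ge0.
rewrite inE/= in_itv/= mulr1 => /andP[x1 x2].
have x0 : 0 < x by exact: lt_le_trans x1.
rewrite gamma_density_gt0// mul1r ler_pM ?expR_ge0//; last by rewrite ler_expR lerN2.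
rewrite /powR gt_eqF// ler_expR.
have l0 : 0 <= ln x by exact: ln_ge0.
have l2 : ln x <= ln 2 by rewrite ler_ln ?posrE.
have : `|s - 1| * ln x <= `|s - 1| * ln 2 by rewrite ler_wpM2l.
have : - (s - 1) * ln x <= `|s - 1| * ln x by rewrite ler_wpM2r// -normrN ler_norm.
lra.
Qed.

Lemma Gamma_gt0 s : 0 < s -> 0 < Gamma s.
Proof. by move=> s0; rewrite GammaE fine_gt0// gamma_int_gt0 gamma_int_lty. Qed.

Lemma integral_gamma_density s a : 0 < s -> 0 < a ->
  (\int[leb]_x (gamma_density s a x)%:E = (Gamma s * a `^ (- s))%:E)%E.
Proof.
move=> s0 a0; rewrite -/(gamma_int s a) gamma_intE// GammaE mulrC EFinM fineK//.
by rewrite ge0_fin_numE ?gamma_int_lty// ltW// gamma_int_gt0.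
Qed.

End GammaIntegral.

Section ProductOnTuples.
Variable R : realType.

Lemma probability_of_measure d (T : measurableType d) (nu : {measure set T -> \bar R}) :
  nu setT = 1%E -> exists G : probability T R, forall A, G A = nu A.
Proof.
move=> nu1; pose m (A : set T) : \bar R := nu A.
pose mm := isMeasure.Build _ _ _ m (measure0 nu) (measure_ge0 nu)
  (@measure_semi_sigma_additive _ _ _ nu).
pose m' : {measure set T -> \bar R} := HB.pack m mm.
pose mp := Measure_isProbability.Build _ _ _ m' nu1.
pose G : probability T R := HB.pack m mm mp.
by exists G.
Qed.

(** Built by recursion from binary products. The formula for products of nonnegative functions of
    single coordinates is the form in which independence is used later. *)
Lemma tuple_product_measure n (mu : 'I_n -> probability R R) :
  exists G : probability (n.-tuple R) R, forall (f : 'I_n -> R -> R) (a : 'I_n -> R),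
    (forall i, measurable_fun setT (f i)) -> (forall i x, 0 <= f i x) ->
    (forall i, \int[mu i]_x (f i x)%:E = (a i)%:E)%E ->
    (\int[G]_x (\prod_(i < n) f i (tnth x i))%:E = (\prod_(i < n) a i)%:E)%E.
Proof.
elim: n mu => [|n IH] mu.
  exists \d_([tuple] : 0.-tuple R) => f a mf f0 fa.
  under eq_integral do rewrite big_ord0.
  by rewrite big_ord0 integral_cst//= diracT mul1e.
have [G' G'E] := IH (fun i => mu (lift ord0 i)).
pose phi (z : R * n.-tuple R) : n.+1.-tuple R := [tuple of z.1 :: z.2].
have mphi : measurable_fun setT phi by exact: measurable_cons.
have [nu [nuA nuI]] := image_measure (mu ord0 \x G')%E mphi.
have nu1 : nu setT = 1%E.
  rewrite nuA// preimage_setT -setXTT.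
  apply: (etrans (product_measure1E (mu ord0) G' measurableT measurableT)).
  by rewrite -[RHS]mule1; congr (_ * _)%E; exact: probability_setT.
have [G GE] := probability_of_measure nu1.
exists G => f a mf f0 fa.
pose g x := \prod_(i < n) f (lift ord0 i) (tnth x i).
have mg : measurable_fun setT g.
  by apply: (@measurable_prod_tnth _ n (fun i => f (lift ord0 i))) => i.
have g0 x : 0 <= g x by exact: prodr_ge0.
have mF : measurable_fun setT (fun x : n.+1.-tuple R => (\prod_(i < n.+1) f i (tnth x i))%:E).
  by apply/measurable_EFinP; exact: (@measurable_prod_tnth _ n.+1 f).
have F0 (x : n.+1.-tuple R) : (0 <= (\prod_(i < n.+1) f i (tnth x i))%:E)%E.
  by rewrite lee_fin prodr_ge0.
rewrite (@eq_measure_integral _ _ _ _ nu) => [|A mA _]; last exact: GE.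
rewrite nuI// fubini_tonelli1//=; last exact: (measurableT_comp mF mphi).
transitivity (\int[mu ord0]_x ((f ord0 x)%:E * (\prod_(i < n) a (lift ord0 i))%:E))%E.
  apply: eq_integral => x _; rewrite /fubini_F.
  have -> : (\prod_(i < n) a (lift ord0 i))%:E = (\int[G']_y (g y)%:E)%E.
    by rewrite -(G'E (fun i => f (lift ord0 i)) (fun i => a (lift ord0 i))).
  rewrite -ge0_integralZl_EFin//; last 2 first.
  - by move=> y _; rewrite lee_fin.
  - exact/measurable_EFinP.
  apply: eq_integral => y _; rewrite -EFinM big_ord_recl; congr (_ * _)%:E.
  by apply: eq_bigr => i _; rewrite tnthS.
have P0 : 0 <= \prod_(i < n) a (lift ord0 i).
  by apply: prodr_ge0 => i _; rewrite -lee_fin -fa integral_ge0// => x _; rewrite lee_fin.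
rewrite (eq_integral (fun x => (\prod_(i < n) a (lift ord0 i))%:E * (f ord0 x)%:E))%E; last first.
  by move=> x _; rewrite muleC.
rewrite ge0_integralZl_EFin//; last 2 first.
- by move=> x _; rewrite lee_fin.
- exact/measurable_EFinP.
by rewrite fa -EFinM mulrC big_ord_recl.
Qed.
End ProductOnTuples.

(** * Affine polynomials *)

Section RealDerivatives.
Variable R : realType.
Implicit Types (f g : R -> R) (h df dg s : R).

Lemma is_derive_add f g h df dg : is_derive h (1 : R) f df -> is_derive h (1 : R) g dg ->
  is_derive h (1 : R) (fun t => f t + g t) (df + dg).
Proof. exact: is_deriveD. Qed.

Lemma is_derive_opp f h df : is_derive h (1 : R) f df ->
  is_derive h (1 : R) (fun t => - f t) (- df).
Proof. exact: is_deriveN. Qed.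

Lemma is_derive_mul f g h df dg : is_derive h (1 : R) f df -> is_derive h (1 : R) g dg ->
  is_derive h (1 : R) (fun t => f t * g t) (df * g h + f h * dg).
Proof.
move=> Hf Hg; apply: is_derive_eq (is_deriveM Hf Hg) _.
by rewrite /GRing.scale/=; ring.
Qed.

Lemma is_derive_comp f g h df dg : is_derive h (1 : R) f df -> is_derive (f h) (1 : R) g dg ->
  is_derive h (1 : R) (fun t => g (f t)) (dg * df).
Proof. by move=> Hf Hg; apply: is_derive_eq (is_derive1_comp Hg Hf) _. Qed.

Lemma is_derive_inv f h df : f h != 0 -> is_derive h (1 : R) f df ->
  is_derive h (1 : R) (fun t => (f t)^-1) (- df / f h ^+ 2).
Proof.
move=> fh0 Hf; apply: is_derive_eq (is_deriveV fh0 Hf) _.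
by rewrite /GRing.scale/= mulrC mulrN mulNr.
Qed.

Lemma is_derive_ln_comp f h df : 0 < f h -> is_derive h (1 : R) f df ->
  is_derive h (1 : R) (fun t => ln (f t)) (df / f h).
Proof.
by move=> fh0 Hf; apply: is_derive_eq (is_derive_comp Hf (is_derive1_ln fh0)) _; rewrite mulrC.
Qed.
End RealDerivatives.

Section Affine.
Variables (R : realType) (n : nat).
Implicit Types (a p : {set 'I_n} -> R) (S T : {set 'I_n}) (z w theta : 'rV[R]_n) (j : 'I_n).
Local Open Scope set_scope.

(** The summands are ordered as in the difference quotient that defines ['D_v], so that [pderiv]
    unfolds to it. *)
Definition line j z (t : R) : 'rV[R]_n := t *: delta_mx 0 j + z.

Lemma lineE j z t i : line j z t 0 i = (if i == j then t else 0) + z 0 i.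
Proof. by rewrite !mxE/=; case: eqP; rewrite ?mulr1 ?mulr0. Qed.

Lemma affine_poly0 a : affine_poly a 0 = a finset.set0.
Proof.
rewrite /affine_poly (bigD1 finset.set0)//= big_set0 mulr1 big1 ?addr0 => [//|S].
by move=> /finset.set0Pn[x xS]; rewrite (bigD1 x)//= mxE mul0r mulr0.
Qed.

(** Coefficients of the mixed partial derivative along T of the affine polynomial [a]; they vanish
    where S meets T because no variable survives its own differentiation. *)
Definition shift_coef a T S : R := if T \subset ~: S then a (T :|: S) else 0.

Lemma subsetC_sym S T : (T \subset ~: S) = (S \subset ~: T).
Proof. by rewrite -finset.setCS finset.setCK. Qed.

Lemma setU1_subC j T S : (j |: T \subset ~: S) = (j \notin S) && (T \subset ~: S).
Proof. by rewrite finset.subUset finset.sub1set finset.inE. Qed.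

Lemma shift_coef1 a j S : shift_coef a [set j] S = if j \in S then 0 else a (j |: S).
Proof. by rewrite /shift_coef finset.sub1set finset.inE; case: (j \in S). Qed.

Lemma shift_coef0 a : shift_coef a finset.set0 = a.
Proof. by apply/funext => S; rewrite /shift_coef finset.sub0set finset.set0U. Qed.

Lemma shift_coef_shift a j T : shift_coef (shift_coef a T) [set j] =
  if j \in T then fun=> 0 else shift_coef a (j |: T).
Proof.
apply/funext => S; rewrite shift_coef1 /shift_coef subsetC_sym !setU1_subC.
case: (boolP (j \in T)) => jT /=; first by case: ifP.
rewrite setU1_subC (subsetC_sym T S); case: (j \in S) => //=.
by rewrite finset.setUCA finset.setUA.
Qed.

Lemma affine_poly_line a j z t :
  affine_poly a (line j z t) = affine_poly a z + t * affine_poly (shift_coef a [set j]) z.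
Proof.
rewrite /affine_poly (bigID (fun T => j \in T))/= [in RHS](bigID (fun T => j \in T))/=.
have -> : \sum_(T : {set 'I_n} | j \notin T) a T * \prod_(i in T) line j z t 0 i =
    \sum_(T : {set 'I_n} | j \notin T) a T * \prod_(i in T) z 0 i.
  apply: eq_bigr => T jT; congr (_ * _); apply: eq_bigr => i iT; rewrite lineE.
  by case: eqP => [ij|_]; [rewrite -ij iT in jT|rewrite add0r].
have -> : \sum_(T : {set 'I_n} | j \in T) a T * \prod_(i in T) line j z t 0 i =
    \sum_(T : {set 'I_n} | j \in T) a T * \prod_(i in T) z 0 i +
    t * \sum_(T : {set 'I_n} | j \in T) a T * \prod_(i in T :\ j) z 0 i.
  rewrite mulr_sumr -big_split/=; apply: eq_bigr => T jT.
  rewrite (finset.big_setD1 j)//= [in RHS](finset.big_setD1 j)//= lineE eqxx.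
  rewrite (eq_bigr (fun i => z 0 i)); first by ring.
  by move=> i; rewrite !finset.inE => /andP[/negbTE ij _]; rewrite lineE ij add0r.
suff -> : \sum_(T : {set 'I_n}) shift_coef a [set j] T * \prod_(i in T) z 0 i =
  \sum_(T : {set 'I_n} | j \in T) a T * \prod_(i in T :\ j) z 0 i by ring.
rewrite (bigID (fun T : {set 'I_n} => j \in T))/= big1 ?add0r; last first.
  by move=> T jT; rewrite shift_coef1 jT mul0r.
rewrite [RHS](reindex_onto (fun T => j |: T) (fun T => T :\ j))/=; last first.
  by move=> T jT; rewrite finset.setD1K.
apply: eq_big => [T|T jT]; last by rewrite shift_coef1 (negbTE jT) finset.setU1K.
rewrite finset.setU11/=; apply/idP/eqP => [jT|<-]; first by rewrite finset.setU1K.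
by rewrite !finset.inE eqxx.
Qed.

Lemma is_derive_affine_line a j z (h : R) :
  is_derive h (1 : R) (fun t => affine_poly a (line j z t))
    (affine_poly (shift_coef a [set j]) (line j z h)).
Proof.
have -> : affine_poly (shift_coef a [set j]) (line j z h) = affine_poly (shift_coef a [set j]) z.
  rewrite affine_poly_line shift_coef_shift finset.inE eqxx.
  by rewrite [X in _ * X]big1 ?mulr0 ?addr0// => T _; rewrite mul0r.
under eq_fun do rewrite affine_poly_line.
set A := affine_poly a z; set B := affine_poly _ z.
have -> : (fun x : R => A + x * B) = cst A + B \*: (@id R).
  by apply/funext => x; rewrite mulrC.
apply: is_derive_eq (is_deriveD (is_derive_cst A h (1 : R)) (is_deriveZ B (is_derive_id h (1 : R)))) _.
by rewrite add0r /GRing.scale/= mulr1.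
Qed.

Lemma pderiv_affine j a : pderiv j (affine_poly a) = affine_poly (shift_coef a [set j]).
Proof.
apply/funext => z; rewrite /pderiv /derive; apply: cvg_lim => //.
apply: cvg_near_cst; near=> h.
have h0 : h != 0 by near: h; exact: nbhs_dnbhs_neq.
change (h^-1 *: (affine_poly a (line j z h) - affine_poly a z) = affine_poly (shift_coef a [set j]) z).
rewrite affine_poly_line addrC addKr.
by rewrite /GRing.scale/= mulKf.
Unshelve. all: by end_near. Qed.

(** Taylor's formula at w, finite and exact, with one derivative for each set of variables. *)
Lemma affine_polyD a z w :
  affine_poly a (z + w) =
  \sum_(T : {set 'I_n}) affine_poly (shift_coef a T) w * \prod_(i in T) z 0 i.
Proof.
rewrite /affine_poly; under [RHS]eq_bigr do rewrite mulr_suml.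
have prodD S : \prod_(i in S) (z + w) 0 i =
    \sum_(T : {set 'I_n} | T \subset S) (\prod_(i in T) z 0 i * \prod_(i in S :\: T) w 0 i).
  rewrite big_mkcond/=.
  rewrite (eq_bigr (fun i => (if i \in S then z 0 i else 0) + (if i \in S then w 0 i else 1))); last first.
    by move=> i _; case: ifP; rewrite ?mxE ?add0r.
  rewrite bigA_distr/= [RHS]big_mkcond/=; apply: eq_bigr => T _.
  case: ifPn => [TS|/subsetPn[i iT iS]].
    rewrite (big_mkcond (mem T))/= (big_mkcond (mem (S :\: T)))/= -big_split/=.
    apply: eq_bigr => i _; rewrite !finset.inE; case: ifP => /= [iT|iT].
      by rewrite (fintype.subsetP TS)// mulr1.
    by case: ifP; rewrite mul1r.
  by rewrite (bigD1 i)//= iT (negbTE iS) mul0r.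
rewrite (eq_bigr (fun S => \sum_(T : {set 'I_n}) if T \subset S then
    a S * (\prod_(i in T) z 0 i * \prod_(i in S :\: T) w 0 i) else 0)); last first.
  by move=> S _; rewrite prodD mulr_sumr big_mkcond.
rewrite exchange_big/=; apply: eq_bigr => T _.
rewrite -big_mkcond/= [RHS](bigID (fun S => T \subset ~: S))/=.
rewrite [X in _ + X]big1 ?addr0; last first.
  by move=> S /negbTE nd; rewrite /shift_coef nd !mul0r.
rewrite (reindex_onto (fun S => T :|: S) (fun S => S :\: T))/=; last first.
  move=> S TS; apply/finset.setP => i; rewrite !finset.inE.
  by case: (boolP (i \in T)) => //= /(fintype.subsetP TS) ->.
apply: eq_big => [S|S].
  rewrite finset.subsetUl/= finset.setDUl finset.setDv finset.set0U subsetC_sym.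
  by rewrite finset.setDE; apply/eqP/idP => /finset.setIidPl.
move=> /andP[_ /eqP TS]; rewrite /shift_coef subsetC_sym.
have -> : S \subset ~: T.
  by rewrite -TS finset.setDE finset.subsetIr.
by rewrite TS; ring.
Qed.

Lemma pderivs_affine a S : pderivs S (affine_poly a) = affine_poly (shift_coef a S).
Proof.
have H s : uniq s -> foldr (@pderiv R n) (affine_poly a) s = affine_poly (shift_coef a [set x in s]).
  elim: s => [_|x s IH /= /andP[xs us]].
    by rewrite (_ : [set x in [::]] = finset.set0) ?shift_coef0//; apply/finset.setP => x; rewrite !finset.inE.
  rewrite IH// pderiv_affine shift_coef_shift finset.inE (negbTE xs).
  by congr (affine_poly (shift_coef a _)); apply/finset.setP => y; rewrite !finset.inE.
by rewrite /pderivs H ?enum_uniq// finset.set_enum.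
Qed.

Section ShiftedCoefficients.
Variable p : {set 'I_n} -> R.
Hypothesis pT : p [set: 'I_n] != 0.

(** The coefficients of 1 - R_n as a single affine polynomial: the same formula gives 1 at the empty
    set and 0 at singletons, where R_n has no term. *)
Definition qcoef T : R := - rcoef p T.

Lemma qcoefE T : qcoef T = affine_poly (shift_coef p (~: T)) (theta_P p) / p [set: 'I_n].
Proof. by rewrite /qcoef /rcoef opprK pderivs_affine mulrC. Qed.

Lemma qcoef_sum T : qcoef T =
  (\sum_(S : {set 'I_n} | S \subset T) p (~: T :|: S) * \prod_(i in S) theta_P p 0 i) / p [set: 'I_n].
Proof.
rewrite qcoefE; congr (_ / _); rewrite [RHS]big_mkcond/=; apply: eq_bigr => S _.
by rewrite /shift_coef finset.setCS; case: ifP; rewrite ?mul0r.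
Qed.

Lemma qcoef0 : qcoef finset.set0 = 1.
Proof.
rewrite qcoef_sum (big_pred1 finset.set0); last by move=> S; rewrite finset.subset0.
by rewrite big_set0 mulr1 finset.setU0 finset.setC0 divff.
Qed.

(** The derivative of P_n in all variables but j is an affine function of theta_j alone, and
    [theta_P] collects the zeros of these functions. *)
Lemma qcoef1 j : qcoef [set j] = 0.
Proof.
rewrite qcoef_sum (bigD1 finset.set0) ?finset.sub0set//= (bigD1 [set j])/=; last first.
  by rewrite subxx -finset.cards_eq0 finset.cards1.
rewrite [X in _ + (_ + X)]big1 ?addr0; last first.
  by move=> S; rewrite finset.subset1 => /andP[/andP[/orP[]/eqP->]]; rewrite eqxx.
rewrite big_set0 mulr1 finset.setU0 big_set1 finset.setUC finset.setUCr mxE /ptilde1 /ptilde.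
by field.
Qed.

Lemma one_sub_Rpoly z : 1 - Rpoly p z = affine_poly qcoef z.
Proof.
rewrite /Rpoly -sumrN /affine_poly [RHS](bigD1 finset.set0)//= qcoef0 big_set0 mulr1.
congr (_ + _); rewrite [RHS](bigID (fun T : {set 'I_n} => (2 <= #|T|)%N))/=.
rewrite [X in _ = _ + X]big1 ?addr0; last first.
  move=> T /andP[T0]; rewrite -ltnNge ltnS leq_eqVlt ltnS leqn0 finset.cards_eq0 (negbTE T0) orbF.
  by move=> /cards1P[j ->]; rewrite qcoef1 mul0r.
apply: eq_big => [T|T T2]; last by rewrite -mulNr.
by case: eqP => [->|_]; rewrite ?finset.cards0.
Qed.

Lemma affine_poly_factor theta : (forall i, theta 0 i != theta_P p 0 i) ->
  affine_poly p theta = p [set: 'I_n] * \prod_i (theta 0 i - theta_P p 0 i) *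
    affine_poly qcoef (\row_i (theta 0 i - theta_P p 0 i)^-1).
Proof.
move=> Hth; rewrite -[theta in LHS](subrK (theta_P p)) affine_polyD.
(* Taylor's formula at [theta_P], summed over complements: a monomial over the complement of T is
   the full product times the inverse monomial over T. *)
rewrite (reindex_inj (inv_inj (@finset.setCK _)))/= /affine_poly [RHS]mulr_sumr.
apply: eq_bigr => T _; rewrite qcoefE -/(affine_poly _ _).
rewrite [\prod_(i < n) _](bigID (fun i => i \in T))/=.
set A := affine_poly _ _.
have -> : \prod_(i in ~: T) (theta - theta_P p) 0 i = \prod_(i < n | i \notin T) (theta 0 i - theta_P p 0 i).
  by apply: eq_big => [i|i _]; rewrite ?finset.inE ?mxE.
have e : \prod_(i < n | i \in T) (theta 0 i - theta_P p 0 i) *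
    \prod_(i in T) (\row_i (theta 0 i - theta_P p 0 i)^-1 : 'rV[R]_n) 0 i = 1.
  rewrite -big_split/= big1// => i _; rewrite !mxE mulfV// subr_eq0.
  by have := Hth i; rewrite mxE.
have key (B C D : R) : B * D = 1 -> A * C = p [set: 'I_n] * (B * C) * (A / p [set: 'I_n] * D).
  by move=> BD; rewrite -[LHS]mulr1 -BD; field.
exact: key e.
Qed.
End ShiftedCoefficients.
End Affine.

(** * Derivatives of the logarithm and of powers of an affine polynomial *)

Section Dexpr.
Variables (R : realType) (n : nat).
Variables (a : {set 'I_n} -> R) (lambda : R).
Implicit Types (T : {set 'I_n}) (z : 'rV[R]_n) (i j : 'I_n) (s : seq 'I_n).
Local Notation q := (affine_poly a).

(* Iterated derivatives of -ln q and q^-lambda, for q affine, as formal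
   expressions in the functions DU T = - (d^T q) / q. *)
Inductive dexpr : Type :=
| DU of {set 'I_n} | DL | DW | DC of R | DA of dexpr & dexpr | DM of dexpr & dexpr.

Fixpoint eval (e : dexpr) z : R := match e with
  | DU T => - affine_poly (shift_coef a T) z / q z
  | DL => - ln (q z)
  | DW => q z `^ (- lambda)
  | DC r => r
  | DA e1 e2 => eval e1 z + eval e2 z
  | DM e1 e2 => eval e1 z * eval e2 z
  end.

(** The rule d_j (- q_T / q) = - q_(T + j) / q + (q_T / q)(q_j / q) is the origin of the minus sign
    in [DU]: it introduces no negative coefficient. The first term is 0 when j is in T, since q is
    affine. *)
Fixpoint der j (e : dexpr) : dexpr := match e with
  | DU T => DA (if j \in T then DC 0 else DU (j |: T)%SET) (DM (DU T) (DU [set j]%SET))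
  | DL => DU [set j]%SET
  | DW => DM (DC lambda) (DM (DU [set j]%SET) DW)
  | DC _ => DC 0
  | DA e1 e2 => DA (der j e1) (der j e2)
  | DM e1 e2 => DA (DM (der j e1) e2) (DM e1 (der j e2))
  end.

Definition ders s e := foldr der e s.

Lemma eval_der j e z (h : R) : 0 < q (line j z h) ->
  is_derive h (1 : R) (fun t => eval e (line j z t)) (eval (der j e) (line j z h)).
Proof.
move=> q0; have dq := is_derive_affine_line a j z h.
have qn0 : q (line j z h) != 0 by rewrite gt_eqF.
elim: e => [T| | |r|e1 IH1 e2 IH2|e1 IH1 e2 IH2] /=.
- have dT := is_derive_affine_line (shift_coef a T) j z h.
  apply: is_derive_eq (is_derive_mul (is_derive_opp dT) (is_derive_inv qn0 dq)) _.
  have -> : eval (if j \in T then DC 0 else DU (j |: T)%SET) (line j z h) =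
      - affine_poly (shift_coef (shift_coef a T) [set j]%SET) (line j z h) / q (line j z h).
    rewrite shift_coef_shift; case: ifP => //= _.
    by rewrite [affine_poly (fun=> _) _]big1 ?oppr0 ?mul0r// => S _; rewrite mul0r.
  by field.
- by apply: is_derive_eq (is_derive_opp (is_derive_ln_comp q0 dq)) _; rewrite mulNr.
- apply: is_derive_eq (is_derive_comp dq (is_derive_powR (- lambda) q0)) _.
  rewrite powRB; last by rewrite qn0 implybT.
  by rewrite powRr1 ?(ltW q0)//; field.
- exact: is_derive_cst.
- exact: is_derive_add.
- exact: is_derive_mul.
Qed.

Definition deq (e1 e2 : dexpr) := forall z, 0 < q z -> eval e1 z = eval e2 z.

Lemma der_comm i j e : deq (der i (der j e)) (der j (der i e)).
Proof.
have [->//|ij] := eqVneq i j; move=> z _.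
have D2 (k l : 'I_n) : k != l ->
    eval (if k \in [set l]%SET then DC 0 else DU [set k; l]%SET) z = eval (DU [set k; l]%SET) z.
  by move=> kl; rewrite finset.inE (negbTE kl).
have D1 (k l : 'I_n) T : k != l -> eval (der k (if l \in T then DC 0 else DU (l |: T)%SET)) z =
    eval (if (k \in T) || (l \in T) then DC 0 else DU (k |: (l |: T))%SET) z +
    eval (if l \in T then DC 0 else DU (l |: T)%SET) z * eval (DU [set k]%SET) z.
  move=> kl; case: (boolP (l \in T)) => lT /=; first by rewrite orbT/= mul0r addr0.
  by rewrite !finset.inE (negbTE kl) orbF.
have ji : j != i by rewrite eq_sym.
elim: e => [T| | |r|e1 IH1 e2 IH2|e1 IH1 e2 IH2] //=.
- rewrite !D1// !D2// orbC finset.setUCA [[set i; j]%SET]finset.setUC /=; ring.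
- rewrite !D2// [[set i; j]%SET]finset.setUC /=; ring.
- rewrite !D2// [[set i; j]%SET]finset.setUC /=; ring.
- by rewrite IH1 IH2.
- by rewrite IH1 IH2; ring.
Qed.

Lemma line0 j z : line j z 0 = z.
Proof. by rewrite /line scale0r add0r. Qed.

Lemma near_line_gt0 j z : 0 < q z -> \forall t \near (0 : R), 0 < q (line j z t).
Proof.
move=> qz; have [dq _] := is_derive_affine_line a j z 0.
have : {for (0 : R), continuous (fun t : R => q (line j z t))}.
  by apply: differentiable_continuous; apply/derivable1_diffP.
move=> /cvgr_gt; apply; by rewrite line0.
Qed.

(** Differentiation respects [deq] because positivity of q is an open condition along lines. *)
Lemma der_congr j e1 e2 : deq e1 e2 -> deq (der j e1) (der j e2).
Proof.
move=> e12 z qz; rewrite -(line0 j z).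
have q0 : 0 < q (line j z 0) by rewrite line0.
have [_ <-] := eval_der e1 q0; have [_ <-] := eval_der e2 q0.
by apply: near_eq_derive; apply: filterS (near_line_gt0 j qz) => t; exact: e12.
Qed.

Lemma ders_congr s e1 e2 : deq e1 e2 -> deq (ders s e1) (ders s e2).
Proof. by move=> e12; elim: s => //= j s IH; exact: der_congr. Qed.

Lemma deq_trans e2 e1 e3 : deq e1 e2 -> deq e2 e3 -> deq e1 e3.
Proof. by move=> e12 e23 z qz; rewrite e12// e23. Qed.

Lemma ders_cat s1 s2 e : ders (s1 ++ s2) e = ders s1 (ders s2 e).
Proof. by rewrite /ders foldr_cat. Qed.

Lemma ders_perm s1 s2 e : perm_eq s1 s2 -> deq (ders s1 e) (ders s2 e).
Proof.
elim: s1 s2 => [|x s1 IH] s2 s12.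
  by have /eqP -> : s2 == [::] by rewrite -size_eq0 -(perm_size s12).
have xs2 : x \in s2 by rewrite -(perm_mem s12) mem_head.
move: s12; case/splitPr: xs2 => p1 p2.
rewrite perm_sym -cat1s perm_catCA cat1s perm_cons perm_sym => s12.
have move_x : deq (der x (ders (p1 ++ p2) e)) (ders (p1 ++ x :: p2) e).
  elim: p1 {s12} => [|y p1 IHp] //=.
  by apply: deq_trans (der_comm _ _ _) _; exact: der_congr.
by apply: deq_trans move_x; apply: der_congr; exact: IH.
Qed.

Definition nnders (k : nat) e := forall s, (size s <= k)%N -> 0 <= eval (ders s e) 0.

(** Peels off the innermost derivative, the last entry of the list, so that inductions act on the
    function being differentiated. *)
Lemma nndersS k e : nnders k.+1 e <-> 0 <= eval e 0 /\ forall j, nnders k (der j e).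
Proof.
split=> [H|[H0 H1] s].
  split=> [|j s sk]; first exact: (H [::]).
  by have := H (rcons s j); rewrite size_rcons -cats1 ders_cat; exact.
case: (lastP s) => [//|s' j]; rewrite size_rcons ltnS => sk.
by rewrite -cats1 ders_cat; exact: H1.
Qed.

Lemma nnders_le k k' e : (k' <= k)%N -> nnders k e -> nnders k' e.
Proof. by move=> kk H s sk; apply: H; exact: leq_trans kk. Qed.

Lemma nndersA k e1 e2 : nnders k e1 -> nnders k e2 -> nnders k (DA e1 e2).
Proof.
move=> H1 H2 s sk; have -> : ders s (DA e1 e2) = DA (ders s e1) (ders s e2).
  by elim: s {sk} => //= j s ->.
by rewrite /= addr_ge0 ?H1 ?H2.
Qed.

Lemma nndersM k e1 e2 : nnders k e1 -> nnders k e2 -> nnders k (DM e1 e2).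
Proof.
elim: k e1 e2 => [|k IH] e1 e2 H1 H2.
  move=> s; rewrite leqn0 size_eq0 => /eqP -> /=.
  by rewrite mulr_ge0//; [exact: (H1 [::])|exact: (H2 [::])].
have [p1 d1] := (nndersS k e1).1 H1; have [p2 d2] := (nndersS k e2).1 H2.
apply/nndersS; split=> [|j /=]; first exact: mulr_ge0.
by apply: nndersA; apply: IH => //; exact: nnders_le (leqnSn k) _.
Qed.

Lemma nndersC k (r : R) : 0 <= r -> nnders k (DC r).
Proof.
move=> r0 s _; have [r' r'0 ->] : exists2 r', 0 <= r' & ders s (DC r) = DC r'.
  elim: s => [|j s [r' r'0 IH]]; first by exists r.
  by exists 0 => //=; rewrite IH.
exact: r'0.
Qed.

(* For affine q, d_i^2 (-ln q) = (d_i (-ln q))^2: repeated derivatives reduce to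
   derivatives of lower order. *)
Lemma ders_log_ge0 : 0 < q 0 ->
  (forall s, uniq s -> s != [::] -> 0 <= eval (ders s DL) 0) ->
  forall s, s != [::] -> 0 <= eval (ders s DL) 0.
Proof.
move=> q0 base s; have [k] := ubnP (size s); elim: k s => // k IH s sk s0.
have [us|nus] := boolP (uniq s); first exact: base.
(* A repeated index can be moved to the innermost position, where the second derivative of - ln q
   becomes the square of the first; each factor then carries fewer derivatives than s. *)
have [i [r sr]] : exists i r, perm_eq s (r ++ [:: i; i]).
  elim: s nus {sk s0} => //= x s IHs; rewrite negb_and negbK => /orP[xs|/IHs[i [r sr]]].
    exists x; exists (rem x s); rewrite (perm_trans (_ : perm_eq _ (x :: x :: rem x s)))//.
      by rewrite perm_cons perm_to_rem.
    by rewrite -[_ :: _]/([:: x; x] ++ rem x s) perm_catC.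
  by exists i; exists (x :: r); rewrite /= perm_cons.
rewrite (ders_perm DL sr)// ders_cat.
have -> : eval (ders r (ders [:: i; i] DL)) 0 = eval (ders r (DM (DU [set i]%SET) (DU [set i]%SET))) 0.
  by apply: ders_congr => // z _ /=; rewrite finset.inE eqxx add0r.
have sE := perm_size sr; rewrite size_cat/= addn2 in sE.
have nnU : nnders (size r) (DU [set i]%SET).
  move=> s' s'r; have -> : ders s' (DU [set i]%SET) = ders (s' ++ [:: i]) DL by rewrite ders_cat.
  apply: IH; last by rewrite -size_eq0 size_cat addn1.
  by rewrite size_cat addn1; move: sk; rewrite sE ltnS; apply: leq_trans; rewrite !ltnS.
exact: (nndersM nnU nnU (leqnn _)).
Qed.

(** Since d_j q^(- lambda) = lambda d_j(- ln q) q^(- lambda), Leibniz's rule raises the order by one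
    at each step of the induction. *)
Lemma ders_pow_ge0 : 0 <= lambda -> 0 < q 0 ->
  (forall s, uniq s -> s != [::] -> 0 <= eval (ders s DL) 0) ->
  forall s, 0 <= eval (ders s DW) 0.
Proof.
move=> l0 q0 base.
have nnU k j : nnders k (DU [set j]%SET).
  move=> s _; have -> : ders s (DU [set j]%SET) = ders (s ++ [:: j]) DL by rewrite ders_cat.
  by apply: ders_log_ge0 => //; rewrite -size_eq0 size_cat addn1.
suff H k : nnders k DW by move=> s; exact: (H (size s)).
elim: k => [s|k IH].
  by rewrite leqn0 size_eq0 => /eqP -> /=; exact: powR_ge0.
apply/nndersS; split=> [|j]; first exact: powR_ge0.
by apply: nndersM; [exact: nndersC|exact: nndersM].
Qed.

End Dexpr.

(** * Mixed differences and their passage to derivatives *)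

Section MixedDifferences.
Variables (R : realType) (n : nat).
Implicit Types (f g : 'rV[R]_n -> R) (y : 'rV[R]_n) (z w : 'I_n -> R) (i j : 'I_n) (s r : seq 'I_n).

Definition upd i (v : R) y : 'rV[R]_n := \row_k if k == i then v else y 0 k.

(** Each coordinate in s contributes the value at z minus the value at w, so decreasing exponentials
    call for z <= w; y fixes the coordinates outside s. *)
Fixpoint mdiff s z w f y : R :=
  if s is i :: s' then mdiff s' z w f (upd i (z i) y) - mdiff s' z w f (upd i (w i) y)
  else f y.

Lemma updE i v y k : upd i v y 0 k = if k == i then v else y 0 k.
Proof. by rewrite mxE. Qed.

Lemma updC i j u v y : i != j -> upd i u (upd j v y) = upd j v (upd i u y).
Proof.
by move=> ij; apply/rowP => k; rewrite !mxE; case: eqP => [->|//]; rewrite (negbTE ij).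
Qed.

Lemma line_upd i y v : line i (upd i 0 y) v = upd i v y.
Proof. by apply/rowP => k; rewrite lineE !updE; case: eqP; rewrite ?addr0 ?add0r. Qed.

Lemma upd_id i y : upd i (y 0 i) y = y.
Proof. by apply/rowP => k; rewrite updE; case: eqP => [->|]. Qed.

Lemma mdiffD s z w f g y :
  mdiff s z w (fun x => f x + g x) y = mdiff s z w f y + mdiff s z w g y.
Proof. by elim: s y => //= i s IH y; rewrite !IH; ring. Qed.

Lemma mdiffZ s z w (c : R) f y : mdiff s z w (fun x => c * f x) y = c * mdiff s z w f y.
Proof. by elim: s y => //= i s IH y; rewrite !IH; ring. Qed.

Lemma mdiff_ext s z w f g y : (forall x, f x = g x) -> mdiff s z w f y = mdiff s z w g y.
Proof. by move=> fg; elim: s y => //= i s IH y; rewrite !IH. Qed.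

Lemma mdiff_cst s z w (c : R) y : s != [::] -> mdiff s z w (fun=> c) y = 0.
Proof.
case: s => // i s _ /=.
have H s' y1 y2 : mdiff s' z w (fun=> c) y1 = mdiff s' z w (fun=> c) y2.
  by elim: s' y1 y2 => //= j s' IH y1 y2; congr (_ - _).
by rewrite (H s _ (upd i (w i) y)) subrr.
Qed.

(** One of two distinct coordinates is not k, and differencing in it kills a function of coordinate
    k. This removes the logarithms of the single factors when - ln P_n is traded for - ln q. *)
Lemma mdiff_coord s z w (h : R -> R) k y : uniq s -> (2 <= size s)%N ->
  mdiff s z w (fun x => h (x 0 k)) y = 0.
Proof.
have H0 s' : k \notin s' -> s' != [::] -> forall y, mdiff s' z w (fun x => h (x 0 k)) y = 0.
  elim: s' => //= j s' IH; rewrite inE negb_or => /andP[kj ks'] _ y'.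
  have [->|s'0] := eqVneq s' [::]; last by rewrite !IH// subrr.
  by rewrite /= !updE (negbTE kj) subrr.
elim: s y => //= i s IH y /andP[is_ us]; rewrite ltnS => s1.
have s0 : s != [::] by rewrite -size_eq0 -lt0n.
have [ks|ks] := boolP (k \in s); last by rewrite !H0// subrr.
have ki : k != i by apply: contraNneq is_ => <-.
have H1 s' v y' : i \notin s' -> mdiff s' z w (fun x => h (x 0 k)) (upd i v y') =
    mdiff s' z w (fun x => h (x 0 k)) y'.
  elim: s' y' => [|j s' IHs] y' /=; first by rewrite updE (negbTE ki).
  rewrite inE negb_or => /andP[ij is'].
  by rewrite ![upd j _ (upd i _ _)]updC 1?eq_sym// !IHs.
by rewrite !H1// subrr.
Qed.

Lemma mdiff_sum_coord s z w (h : 'I_n -> R -> R) y : uniq s -> (2 <= size s)%N ->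
  mdiff s z w (fun x => \sum_k h k (x 0 k)) y = 0.
Proof.
move=> us s2; have H (t : seq 'I_n) : mdiff s z w (fun x => \sum_(k <- t) h k (x 0 k)) y = 0.
  elim: t => [|k t IH].
    rewrite (mdiff_ext _ _ _ _ (g := fun=> 0)); last by move=> x; rewrite big_nil.
    by rewrite mdiff_cst// -size_eq0 -lt0n (leq_trans _ s2).
  rewrite (mdiff_ext _ _ _ _ (g := fun x => h k (x 0 k) + \sum_(k <- t) h k (x 0 k))); last first.
    by move=> x; rewrite big_cons.
  by rewrite mdiffD IH addr0 mdiff_coord.
exact: H.
Qed.

Lemma mdiff_map s z w (phi : 'I_n -> R -> R) f y :
  mdiff s z w (fun x => f (\row_k phi k (x 0 k))) y =
  mdiff s (fun k => phi k (z k)) (fun k => phi k (w k)) f (\row_k phi k (y 0 k)).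
Proof.
elim: s y => //= i s IH y; rewrite !IH.
have e v : \row_k phi k (upd i v y 0 k) = upd i (phi i v) (\row_k phi k (y 0 k)).
  by apply/rowP => k; rewrite !mxE; case: eqP => [->|].
by rewrite !e.
Qed.

Lemma mdiff_local s z w f g (A : 'I_n -> set R) y :
  (forall x : 'rV[R]_n, (forall k, A k (x 0 k)) -> f x = g x) ->
  (forall k, A k (z k)) -> (forall k, A k (w k)) -> (forall k, A k (y 0 k)) ->
  mdiff s z w f y = mdiff s z w g y.
Proof.
move=> fg Az Aw; elim: s y => [|i s IH] y Ay /=; first exact: fg.
by congr (_ - _); apply: IH => k; rewrite updE; case: eqP => [->|].
Qed.

Lemma mdiff_cvg s z w (F : set_system R) (FF : Filter F) (f : R -> 'rV[R]_n -> R) g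
    (A : 'I_n -> set R) y :
  (forall x : 'rV[R]_n, (forall k, A k (x 0 k)) -> f t x @[t --> F] --> g x) ->
  (forall k, A k (z k)) -> (forall k, A k (w k)) -> (forall k, A k (y 0 k)) ->
  mdiff s z w (f t) y @[t --> F] --> mdiff s z w g y.
Proof.
move=> fg Az Aw; elim: s y => [|i s IH] y Ay /=; first exact: fg.
by apply: cvgB; apply: IH => k; rewrite updE; case: eqP => [->|].
Qed.

Lemma mdiff_eq_at s z z' w w' f y : (forall k, k \in s -> z k = z' k /\ w k = w' k) ->
  mdiff s z w f y = mdiff s z' w' f y.
Proof.
elim: s y => //= i s IH y H; have [-> ->] := H i (mem_head _ _).
by rewrite !IH// => k ks; apply: H; rewrite inE ks orbT.
Qed.

Lemma derive_ge0_of_nondecreasing (phi : R -> R) (v d e : R) : 0 < v < e ->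
  is_derive v (1 : R) phi d ->
  (forall u1 u2, 0 < u1 < u2 -> u2 < e -> phi u1 <= phi u2) -> 0 <= d.
Proof.
move=> /andP[v0 ve] [dphi <-] H; apply: limr_ge; first exact: dphi.
have [hv hve] : (\forall h \near (0 : R)^', 0 < h + v) /\ (\forall h \near (0 : R)^', h + v < e).
  have cv : (fun h : R => h + v) @ (0 : R)^' --> 0 + v.
    by apply: cvgD; [exact: cvg_within|exact: cvg_cst].
  rewrite add0r in cv.
  by split; [exact: (cvgr_gt v cv)|exact: (cvgr_lt v cv)].
near=> h.
have h1 : 0 < h + v by near: h.
have h2 : h + v < e by near: h.
rewrite /GRing.scale/= mulr1.
have [h0|h0] := leP 0 h.
  rewrite mulr_ge0 ?invr_ge0// subr_ge0.
  have [->|hn0] := eqVneq h 0; first by rewrite add0r.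
  by apply: H => //; rewrite v0/= ltrDr lt_neqAle eq_sym hn0.
rewrite mulr_le0// ?invr_le0 ?(ltW h0)// subr_le0.
by apply: H => //; rewrite h1/= gtrDr.
Unshelve. all: by end_near. Qed.

Section LogPositive.
Variables (a : {set 'I_n} -> R) (lambda : R).
Local Notation q := (affine_poly a).
Variable e : R.
Hypothesis e0 : 0 < e.
Hypothesis qe : forall y, (forall k, 0 < y 0 k < e) -> 0 < q y.
Hypothesis Hd : forall s z w y, uniq s -> (2 <= size s)%N ->
  (forall k, 0 < w k < z k) -> (forall k, z k < e) -> (forall k, 0 < y 0 k < e) ->
  0 <= mdiff s z w (fun x => - ln (q x)) y.

Lemma is_derive_mdiff r z w (E : dexpr R n) i v y : i \notin r ->
  (forall k, 0 < w k < e) -> (forall k, 0 < z k < e) -> (forall k, 0 < y 0 k < e) -> 0 < v < e ->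
  is_derive v (1 : R) (fun t => mdiff r z w (eval a lambda E) (upd i t y))
    (mdiff r z w (eval a lambda (der lambda i E)) (upd i v y)).
Proof.
move=> ir Hw Hz Hy Hv; elim: r y ir Hy => [|k r IH] y ir Hy /=.
  rewrite (_ : (fun t => _) = fun t => eval a lambda E (line i (upd i 0 y) t)); last first.
    by apply/funext => t; rewrite line_upd.
  have -> : upd i v y = line i (upd i 0 y) v by rewrite line_upd.
  apply: eval_der; rewrite line_upd; apply: qe => k; rewrite updE.
  by case: eqP => _.
move: ir; rewrite inE negb_or => /andP[ik ir].
have e1 u t : upd k u (upd i t y) = upd i t (upd k u y) by rewrite updC// eq_sym.
rewrite (_ : (fun t => _) = fun t => mdiff r z w (eval a lambda E) (upd i t (upd k (z k) y)) -
    mdiff r z w (eval a lambda E) (upd i t (upd k (w k) y))); last first.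
  by apply/funext => t; rewrite !e1.
rewrite !e1.
apply: is_derive_add; first by apply: IH => // l; rewrite updE; case: eqP => _.
by apply: is_derive_opp; apply: IH => // l; rewrite updE; case: eqP => _.
Qed.

(** Trades differences for derivatives one coordinate at a time: s is already differentiated, r
    still differenced. Nonnegative differences for every pair of values of coordinate i mean
    monotonicity in it, hence a nonnegative derivative. *)
Lemma ders_log_mdiff_ge0 s r z w y : uniq (s ++ r) -> (2 <= size (s ++ r))%N ->
  (forall k, 0 < w k < z k) -> (forall k, z k < e) -> (forall k, 0 < y 0 k < e) ->
  0 <= mdiff r z w (eval a lambda (ders lambda s (@DL R n))) y.
Proof.
elim: s r z w y => [|i s IH] r z w y usr ssr Hw Hz Hy; first exact: Hd.
have usr' : uniq (s ++ i :: r) by rewrite -cat1s uniq_catCA.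
have ssr' : (2 <= size (s ++ i :: r))%N by move: ssr; rewrite /= !size_cat/= addnS.
have ir : i \notin r by move: usr'; rewrite cat_uniq/= => /and3P[_ _ /andP[]].
have Hwe k : 0 < w k < e by have /andP[-> h] := Hw k; rewrite (lt_trans h).
have Hze k : 0 < z k < e by have /andP[h1 h2] := Hw k; rewrite (lt_trans h1 h2) Hz.
rewrite -(upd_id i y).
apply: (derive_ge0_of_nondecreasing (Hy i) (is_derive_mdiff _ ir Hwe Hze Hy (Hy i))) => u1 u2 /andP[u10 u12] u2e.
pose z' k := if k == i then u2 else z k.
pose w' k := if k == i then u1 else w k.
have hz : z' i = u2 by rewrite /z' eqxx.
have hw : w' i = u1 by rewrite /w' eqxx.
have := IH (i :: r) z' w' y usr' ssr'.
rewrite [mdiff (i :: r) z' w' _ _]/= hz hw.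
rewrite !(@mdiff_eq_at r z' z w' w); last first.
- by move=> k kr; rewrite /z' /w'; case: eqP kr => // ->; rewrite (negbTE ir).
- by move=> k kr; rewrite /z' /w'; case: eqP kr => // ->; rewrite (negbTE ir).
rewrite subr_ge0; apply => // k.
- by rewrite /w' /z'; case: eqP => // _; rewrite u10.
- by rewrite /z'; case: eqP.
Qed.

Lemma cvg_affine_diag (b : {set 'I_n} -> R) :
  affine_poly b (const_mx t) @[t --> (0 : R)^'+] --> affine_poly b 0.
Proof.
apply: cvg_at_right_filter.
rewrite /affine_poly; apply: cvg_big => [|T _]; first by apply: add_continuous.
apply: cvgM; first exact: cvg_cst.
have -> : (fun t : R => \prod_(i in T) (const_mx t : 'rV[R]_n) 0 i) = fun t => t ^+ #|T|.
  by apply/funext => t; under eq_bigr do rewrite mxE; rewrite prodr_const.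
have -> : \prod_(i in T) (0 : 'rV[R]_n) 0 i = 0 ^+ #|T|.
  by under eq_bigr do rewrite mxE; rewrite prodr_const.
exact: exprn_continuous.
Qed.

Lemma cvg_eval_diag (E : dexpr R n) : 0 < q 0 ->
  eval a lambda E (const_mx t) @[t --> (0 : R)^'+] --> eval a lambda E 0.
Proof.
move=> q0; elim: E => [T| | |r|E1 IH1 E2 IH2|E1 IH1 E2 IH2] /=.
- apply: cvgM; first by apply: cvgN; exact: cvg_affine_diag.
  by apply: cvgV; [rewrite gt_eqF|exact: cvg_affine_diag].
- apply: cvgN; apply: cvg_comp; first exact: cvg_affine_diag.
  exact: continuous_ln.
- have : {for q 0, continuous (fun y : R => y `^ (- lambda))}.
    apply: differentiable_continuous; apply/derivable1_diffP.
    by have [] := is_derive_powR (- lambda) q0.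
  move=> H; apply: (@cvg_comp _ _ _ (fun t : R => q (const_mx t)) (fun y : R => y `^ (- lambda)) _ (nbhs (q 0))).
    exact: cvg_affine_diag.
  exact: H.
- exact: cvg_cst.
- exact: cvgD.
- exact: cvgM.
Qed.

(** The origin lies on the boundary of the open cube where the differences are controlled; it is
    reached along the diagonal from the positive side. *)
Lemma ders_log_set_ge0 s : 0 < q 0 -> uniq s -> (2 <= size s)%N ->
  0 <= eval a lambda (ders lambda s (@DL R n)) 0.
Proof.
move=> q0 us s2; have cl := @cvg_eval_diag (ders lambda s (@DL R n)) q0.
rewrite -(cvg_lim _ cl)//; apply: limr_ge; first by apply: cvgP cl.
have te : \forall t \near (0 : R)^'+, t < e by exact: nbhs_right_lt.
near=> t.
have t0 : 0 < t by near: t; exact: nbhs_right_gt.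
have t1 : t < e by near: t.
(* No coordinate is left to be differenced; e / 4 < e / 2 are just admissible values below e. *)
have := @ders_log_mdiff_ge0 s [::] (fun=> e / 2) (fun=> e / 4) (const_mx t).
rewrite cats0; apply => //= [_|_|k]; last by rewrite mxE t0.
- by have := e0; lra.
- by have := e0; lra.
Unshelve. all: by end_near. Qed.

End LogPositive.
End MixedDifferences.

(** * Coefficients of power series *)

Section SignedSums.
Variables (R : realType) (I : choiceType).
Implicit Types (D : set I) (f g : I -> R).

Lemma esumZ D (r : R) (u : I -> \bar R) : 0 <= r -> (forall i, 0 <= u i)%E ->
  (\esum_(i in D) (r%:E * u i) = r%:E * \esum_(i in D) u i)%E.
Proof.
move=> r0 u0.
have le (s : R) (v : I -> \bar R) : 0 <= s -> (forall i, 0 <= v i)%E ->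
    (\esum_(i in D) (s%:E * v i) <= s%:E * \esum_(i in D) v i)%E.
  move=> s0 v0; apply: ge_ereal_sup => _ [Y DY <-].
  rewrite -ge0_mule_fsumr//; apply: lee_wpmul2l; first by rewrite lee_fin.
  by apply: ereal_sup_ubound; exists Y.
have [->|rn0] := eqVneq r 0.
  by rewrite mul0e esum1// => i _; rewrite mul0e.
apply/eqP; rewrite eq_le le//=.
have ri0 : 0 <= r^-1 by rewrite invr_ge0.
have ru0 i : (0 <= r%:E * u i)%E by rewrite mule_ge0.
have := le r^-1 (fun i => (r%:E * u i)%E) ri0 ru0.
rewrite (_ : (fun i => _) = u); last first.
  by apply/funext => i; rewrite muleA -EFinM mulVf// mul1e.
move=> /(lee_wpmul2l (x := r%:E)); rewrite lee_fin => /(_ r0).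
by rewrite muleA -EFinM divff// mul1e.
Qed.

Lemma abs_summableE D f : abs_summable D f = (\esum_(i in D) (`|f i|)%:E < +oo)%E :> Prop.
Proof. by []. Qed.

Lemma abs_summable_sub D D' f : D' `<=` D -> abs_summable D f -> abs_summable D' f.
Proof.
move=> DD; rewrite !abs_summableE; apply: le_lt_trans.
rewrite esum_mkcond [leRHS]esum_mkcond; apply: le_esum => i _.
case: ifPn => [|_]; first by rewrite !inE => /DD Di; rewrite ifT// inE.
by case: ifP => // _; rewrite lee_fin.
Qed.

Lemma eq_abs_summable D f g : (forall i, D i -> f i = g i) -> abs_summable D f -> abs_summable D g.
Proof. by move=> fg; rewrite !abs_summableE; under eq_esum => i /fg -> do []. Qed.

Lemma eq_real_sum D f g : (forall i, D i -> f i = g i) -> real_sum D f = real_sum D g.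
Proof.
by move=> fg; rewrite /real_sum; congr (fine (_ - _)); apply: eq_esum => i Di;
  rewrite ?funeposE ?funenegE /= fg.
Qed.

Lemma abs_summableZ D f (r : R) : abs_summable D f -> abs_summable D (fun i => r * f i).
Proof.
rewrite !abs_summableE => H; rewrite (eq_esum (b := fun i => (`|r|%:E * `|f i|%:E)%E)); last first.
  by move=> i _; rewrite normrM.
rewrite esumZ// lte_mul_pinfty//.
Qed.

Lemma abs_summable_fin D f : abs_summable D f ->
  (\esum_(i in D) (EFin \o f)^\+%E i \is a fin_num)%E /\ (\esum_(i in D) (EFin \o f)^\-%E i \is a fin_num)%E.
Proof.
move=> H; split.
  have := summable_funepos H; rewrite summableE (eq_esum (b := (EFin \o f)^\+%E))//.
  by move=> i _; rewrite gee0_abs.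
have := summable_funeneg H; rewrite summableE (eq_esum (b := (EFin \o f)^\-%E))//.
by move=> i _; rewrite gee0_abs.
Qed.

Lemma real_sumE D f : abs_summable D f -> real_sum D f =
  fine (\esum_(i in D) (EFin \o f)^\+%E i) - fine (\esum_(i in D) (EFin \o f)^\-%E i).
Proof. by move=> /abs_summable_fin[? ?]; rewrite /real_sum fineB. Qed.

Lemma real_sumZ D f (r : R) : abs_summable D f -> real_sum D (fun i => r * f i) = r * real_sum D f.
Proof.
move=> H; rewrite (real_sumE (abs_summableZ r H)) (real_sumE H).
have [Hp Hn] := abs_summable_fin H.
have e : EFin \o (fun i => r * f i) = (fun i => r%:E * (EFin \o f) i)%E by [].
have [r0|/ltW r0] := leP 0 r; rewrite e.
  by rewrite ge0_funeposM// ge0_funenegM// !esumZ// !fineM//= mulrBr.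
rewrite le0_funeposM// le0_funenegM// -EFinN !esumZ ?oppr_ge0// !fineM//=; ring.
Qed.

Lemma ge0_real_sum D f : (forall i, D i -> 0 <= f i) -> real_sum D f = fine (\esum_(i in D) (f i)%:E)%E.
Proof.
move=> f0; rewrite /real_sum [X in (_ - X)%E]esum1 ?sube0.
  by congr fine; apply: eq_esum => i Di; rewrite funeposE max_l// lee_fin f0.
by move=> i Di; rewrite funenegE max_r// leeNl oppe0 lee_fin f0.
Qed.

Lemma real_sum_set1 i f : real_sum [set i] f = f i.
Proof.
have H : abs_summable [set i] f by rewrite abs_summableE esum_set1// ltry.
rewrite real_sumE// !esum_set1// funeposE funenegE /=.
case: (leP 0 (f i)) => h.
  by rewrite max_l ?lee_fin// max_r ?lee_fin ?oppr_le0//= subr0.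
by rewrite max_r ?lee_fin ?(ltW h)// max_l ?lee_fin ?oppr_ge0 ?(ltW h)//= sub0r opprK.
Qed.

(** With [rk] the exponent of one variable, this reads a multivariate series as a power series in
    that variable. Positive and negative parts are grouped separately. *)
Lemma real_sum_fibers D f (rk : I -> nat) : abs_summable D f ->
  series (fun m => real_sum (D `&` [set i | rk i = m]) f) N @[N --> \oo] --> real_sum D f.
Proof.
move=> H; pose Dm m := D `&` [set i | rk i = m].
have Hm m : abs_summable (Dm m) f by apply: abs_summable_sub H => i [].
have cvg_part (u : I -> \bar R) : (forall i, 0 <= u i)%E -> (\esum_(i in D) u i \is a fin_num)%E ->
    (forall m, \esum_(i in Dm m) u i \is a fin_num)%E ->
    series (fun m => fine (\esum_(i in Dm m) u i)%E) N @[N --> \oo] --> fine (\esum_(i in D) u i)%E.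
  move=> u0 uD um.
  have DE : D = \bigcup_m Dm m.
    by apply/seteqP; split=> [i Di|i [m _ []]//]; exists (rk i).
  have tD : trivIset setT Dm by move=> j k _ _ [i [[_ <-] [_ <-]]].
  have E : (\esum_(i in D) u i = \sum_(0 <= m <oo) \esum_(i in Dm m) u i)%E.
    by rewrite [in LHS]DE nneseries_sum_bigcup.
  have c1 : (\sum_(0 <= m < N) \esum_(i in Dm m) u i)%E @[N --> \oo] --> (fine (\esum_(i in D) u i))%:E%E.
    by rewrite fineK// E; apply: is_cvg_nneseries => m _ _; exact: esum_ge0.
  rewrite (_ : series _ = fine \o (fun N => \sum_(0 <= m < N) \esum_(i in Dm m) u i)%E); last first.
    apply/funext => N; rewrite /series/= -[LHS]/(fine (_%:E)) -sumEFin; congr fine.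
    by apply: eq_bigr => m _; rewrite fineK.
  exact: fine_cvg c1.
have [Hp Hn] := abs_summable_fin H.
rewrite (real_sumE H) (_ : (fun N => _) = fun N =>
   series (fun m => fine (\esum_(i in Dm m) (EFin \o f)^\+%E i)) N -
   series (fun m => fine (\esum_(i in Dm m) (EFin \o f)^\-%E i)) N); last first.
  apply/funext => N; rewrite /series/= -sumrB; apply: eq_bigr => m _.
  exact: real_sumE (Hm m).
by apply: cvgB; apply: cvg_part => // m; have [] := abs_summable_fin (Hm m).
Qed.
End SignedSums.

Section Coefficients.
Variables (R : realType) (n : nat).
Variables (a : {set 'I_n} -> R) (lambda : R).
Implicit Types (z : 'rV[R]_n) (i j : 'I_n) (s : seq 'I_n) (alpha beta : {ffun 'I_n -> nat}).
Local Notation q := (affine_poly a).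

Lemma continuous_affine_poly : continuous q.
Proof.
move=> z; have FF : Filter (nbhs z) by exact: nbhs_filter.
rewrite /continuous_at /affine_poly; apply: (@cvg_big _ _ _ _ _ _ _ (nbhs z)) => [|T _]; first by apply: add_continuous.
apply: cvgM; first exact: cvg_cst.
apply: (@cvg_big _ _ _ _ _ _ _ (nbhs z)) => [|i _]; first by apply: mul_continuous.
exact: coord_continuous.
Qed.

Lemma near0_box (Q : set 'rV[R]_n) : (\forall z \near (0 : 'rV[R]_n), Q z) ->
  exists2 e : R, 0 < e & forall z, (forall i, `|z 0 i| < e) -> Q z.
Proof.
move=> /nbhs_ballP[e /= e0 H]; exists e => // z Hz; apply: H; split => // i j.
by rewrite ord1 mxE /ball/= sub0r normrN.
Qed.

Variables (c : {ffun 'I_n -> nat} -> R) (e : R).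
Hypothesis e0 : 0 < e.
Hypothesis qe : forall z, (forall i, `|z 0 i| < e) -> 0 < q z.
Let term z alpha := c alpha * \prod_(i < n) z 0 i ^+ alpha i.
Hypothesis ce : forall z, (forall i, `|z 0 i| < e) ->
  abs_summable setT (term z) /\ q z `^ (- lambda) = real_sum setT (term z).

Let fiber s alpha : set {ffun 'I_n -> nat} := [set beta | forall i, i \in s -> beta i = alpha i].
Let pterm s z beta := c beta * \prod_(i | i \notin s) z 0 i ^+ beta i.
Let zeroed s z : 'rV[R]_n := \row_k if k \in s then 0 else z 0 k.
Let expo s alpha := flatten [seq nseq (alpha i) i | i <- s].
Let facs s alpha : R := \prod_(i <- s) (alpha i)`!%:R.

Let fiberS i s alpha : fiber (i :: s) alpha = fiber s alpha `&` [set beta : {ffun 'I_n -> nat} | beta i = alpha i].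
Proof.
apply/seteqP; split=> beta /= H.
  by split=> [k ks|]; apply: H; rewrite inE ?eqxx// ks orbT.
by move=> k; rewrite inE => /orP[/eqP->|]; [exact: H.2|exact: H.1].
Qed.

Let ptermS i s (h : R) z beta : i \notin s ->
  pterm s (line i (zeroed (i :: s) z) h) beta = h ^+ beta i * pterm (i :: s) z beta.
Proof.
move=> is_; rewrite /pterm (bigD1 i)//= lineE eqxx mxE mem_head addr0.
rewrite mulrCA; congr (_ * (_ * _)); apply: eq_big => k.
  by rewrite inE negb_or andbC.
by move=> /andP[ks ki]; rewrite lineE (negbTE ki) add0r mxE inE (negbTE ki) (negbTE ks).
Qed.

(* The coordinates in s have been processed: summing over the exponents that
   agree with alpha on s gives a derivative at a point where they vanish. *)
Lemma power_series_partial s : uniq s -> forall alpha z, (forall i, `|z 0 i| < e) ->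
  abs_summable (fiber s alpha) (pterm s z) /\
  facs s alpha * real_sum (fiber s alpha) (pterm s z) =
    eval a lambda (ders lambda (expo s alpha) (@DW R n)) (zeroed s z).
Proof.
elim: s => [_ alpha z ze|i s IH /= /andP[is_ us] alpha z ze].
  have [H1 H2] := ce ze.
  have -> : fiber [::] alpha = setT by apply/seteqP; split.
  have -> : pterm [::] z = term z by apply/funext => beta.
  have -> : zeroed [::] z = z by apply/rowP => k; rewrite mxE.
  by split=> //; rewrite /facs big_nil mul1r -H2.
pose y := zeroed (i :: s) z.
have ye h : `|h| < e -> forall k, `|line i y h 0 k| < e.
  move=> he k; rewrite lineE mxE inE; case: eqP => _ /=; first by rewrite addr0.
  by rewrite add0r; case: ifP => // _; rewrite normr0.
have ys h : zeroed s (line i y h) = line i y h.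
  apply/rowP => k; rewrite mxE lineE [y _ _]mxE inE.
  case: (boolP (k \in s)) => // ks; rewrite orbT addr0.
  by case: eqP ks is_ => // -> ->.
pose D m := fiber s alpha `&` [set beta : {ffun 'I_n -> nat} | beta i = m].
pose A m := real_sum (D m) (pterm (i :: s) z).
have HD h m beta : D m beta -> pterm s (line i y h) beta = h ^+ m * pterm (i :: s) z beta.
  by case=> _ /= <-; exact: ptermS.
(* At h = e / 2, which is nonzero, every term of this part carries the factor h^m, which can be
   divided out. *)
have AS m : abs_summable (D m) (pterm (i :: s) z).
  have e2 : `|e / 2| < e by rewrite gtr0_norm ?divr_gt0//; have := e0; lra.
  have [H _] := IH us alpha _ (ye _ e2).
  have DD : D m `<=` fiber s alpha by move=> b [].
  have /(abs_summableZ ((e / 2) ^- m)) := abs_summable_sub DD H.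
  apply: eq_abs_summable => beta Db; rewrite (HD _ m)// mulrA mulVf ?mul1r//.
  by rewrite expf_neq0// gt_eqF// divr_gt0.
have As h : `|h| < e -> series (fun m => A m * h ^+ m) N @[N --> \oo] --> real_sum (fiber s alpha) (pterm s (line i y h)).
  move=> he; have [H _] := IH us alpha _ (ye _ he).
  have := @real_sum_fibers R _ _ _ (fun beta : {ffun 'I_n -> nat} => beta i) H.
  rewrite (_ : (fun m => real_sum _ _) = fun m => A m * h ^+ m)//.
  by apply/funext => m; rewrite mulrC -real_sumZ//; apply: eq_real_sum => beta; exact: HD.
(* The candidate m-th derivative in coordinate i. The factorials of the coordinates already
   processed are divided out; m! is supplied by the one-variable lemma. *)
pose G m h := (facs s alpha)^-1 * eval a lambda (ders lambda (nseq m i ++ expo s alpha) (@DW R n)) (line i y h).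
have f0 : facs s alpha != 0.
  by rewrite /facs prodf_seq_neq0; apply/allP => k _; rewrite pnatr_eq0 -lt0n fact_gt0.
have HG : forall m, m`!%:R * A m = G m 0.
  apply: (@pseries_coef_derive R A G e e0).
  - by move=> h he; apply: cvgP (As h he).
  - move=> h he; rewrite /pseries (cvg_lim _ (As h he))// /G.
    have [_ H] := IH us alpha _ (ye _ he).
    by rewrite ys in H; rewrite /= -H mulrA mulVf// mul1r.
  - move=> m h he; rewrite /G.
    have D0 := @eval_der R n a lambda i (ders lambda (nseq m i ++ expo s alpha) (@DW R n)) y h (qe (ye _ he)).
    have := is_derive_mul (is_derive_cst (facs s alpha)^-1 h (1 : R)) D0.
    by rewrite mul0r add0r.
rewrite fiberS; split; first exact: AS.
rewrite /facs big_cons -/(facs s alpha) mulrAC (HG (alpha i)) /G line0.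
by rewrite mulrAC mulVf// mul1r.
Qed.

Lemma power_series_coef alpha :
  facs (enum 'I_n) alpha * c alpha = eval a lambda (ders lambda (expo (enum 'I_n) alpha) (@DW R n)) 0.
Proof.
have z0 : forall i, `|(0 : 'rV[R]_n) 0 i| < e by move=> i; rewrite mxE normr0.
have [_] := power_series_partial (enum_uniq 'I_n) alpha z0.
have -> : fiber (enum 'I_n) alpha = [set alpha].
  apply/seteqP; split=> [beta H|beta -> //]; apply/ffunP => i; apply: H; exact: mem_enum.
rewrite real_sum_set1 /pterm big1 ?mulr1 => [->|i]; last by rewrite mem_enum.
by congr eval; apply/rowP => k; rewrite !mxE; case: ifP.
Qed.

Lemma power_series_coef0 : c [ffun=> 0%N] = q 0 `^ (- lambda).
Proof.
have := power_series_coef [ffun=> 0%N].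
have -> : facs (enum 'I_n) [ffun=> 0%N] = 1 by rewrite /facs big1// => i _; rewrite ffunE fact0.
rewrite mul1r => ->; rewrite (_ : expo _ _ = [::])// /expo.
by elim: (enum 'I_n) => //= i s ->; rewrite ffunE.
Qed.

Lemma power_series_coef_ge0 : (forall s, 0 <= eval a lambda (ders lambda s (@DW R n)) 0) ->
  forall alpha, 0 <= c alpha.
Proof.
move=> H alpha; have := H (expo (enum 'I_n) alpha); rewrite -power_series_coef pmulr_rge0//.
by rewrite /facs prodr_gt0// => i _; rewrite ltr0n fact_gt0.
Qed.
End Coefficients.

(** * Supports and signs *)

Section PowerTransforms.
Variable R : realType.
Implicit Types (nu : {measure set R -> \bar R}) (s A B a b t : R).

Lemma powRN_onto s (y : R) : 0 < s -> 0 < y -> exists2 x : R, 0 < x & x `^ (- s) = y.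
Proof.
move=> s0 y0; exists (y `^ (- s^-1)); first exact: powR_gt0.
by rewrite -powRrM mulrNN mulVf ?gt_eqF// powRr1 ?ltW.
Qed.

Lemma ltr_powRN s (x y : R) : 0 < s -> 0 < x -> x < y -> y `^ (- s) < x `^ (- s).
Proof.
move=> s0 x0 xy; have y0 : 0 < y by exact: lt_trans xy.
rewrite !powRN ltf_pV2 ?posrE ?powR_gt0//.
by apply: gt0_ltr_powR => //; rewrite nnegrE ltW.
Qed.

Lemma powRN_le s (x y : R) : 0 < s -> 0 < x -> 0 < y -> x `^ (- s) <= y `^ (- s) -> y <= x.
Proof. by move=> s0 x0 y0; apply: contraTT; rewrite -!ltNge; exact: ltr_powRN. Qed.

Lemma null_of_integral_eq0 d (T : measurableType d) (mu : {measure set T -> \bar R})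
    (D : set T) (f : T -> R) : measurable D -> measurable_fun setT f -> (forall x, D x -> 0 < f x) ->
  (\int[mu]_(x in D) (f x)%:E = 0)%E -> mu D = 0%E.
Proof.
move=> mD mf f0 H; apply/negligibleP => //.
have mDf : measurable_fun D (EFin \o f) by apply: measurable_funTS; exact/measurable_EFinP.
have H' : (\int[mu]_(x in D) `|(EFin \o f) x| = 0)%E.
  rewrite -[RHS]H; apply: eq_integral => x /[1!inE] Dx.
  by rewrite gee0_abs//= lee_fin ltW// f0.
have [N [mN N0 sN]] := (ae_eq_integral_abs mu mD mDf).1 H'.
exists N; split => // x Dx; apply: sN => /= /(_ Dx) [] fx.
by have := f0 x Dx; rewrite fx ltxx.
Qed.

Lemma lebesgue_density (f : R -> \bar R) : measurable_fun setT f -> (forall x, 0 <= f x)%E ->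
  exists g : {measure set R -> \bar R}, forall h : R -> \bar R, measurable_fun setT h ->
    (forall x, 0 <= h x)%E -> (\int[g]_x h x = \int[lebesgue_measure]_x (h x * f x))%E.
Proof.
move=> mf f0.
have mid : measurable_fun setT (fun x : measurableTypeR R => (x : R)) by exact: measurable_id.
exact: (weighted_image (@lebesgue_measure R) mid).
Qed.

(** A reference measure: a multiple of the point mass at 0 when B = 0, otherwise of the gamma
    density of shape s and rate A / B. The rate may be negative, and the measure then infinite. *)
Lemma power_transform s A B : 0 < s -> 0 <= B -> (B = 0 -> 0 < A) ->
  exists g : {measure set R -> \bar R}, forall t, 0 < A + B * t ->
    bilateral g t = ((A + B * t) `^ (- s))%:E.
Proof.
move=> s0; rewrite le_eqVlt => /predU1P[<- /(_ erefl) A0|B0 _].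
  pose f (x : R) := (A `^ (- s))%:E.
  have f0 x : (0 <= f x)%E by rewrite lee_fin powR_ge0.
  have mf : measurable_fun setT f by exact: measurable_cst.
  have [g gE] := density_measure (dirac (0 : R) : {measure set R -> \bar R}) mf f0.
  exists g => t _; rewrite mul0r addr0 /bilateral.
  rewrite (ge0_integral_density mf f0 gE)//; last exact: measurable_expE.
  rewrite integral_dirac//; last by apply: emeasurable_funM => //; exact: measurable_expE.
  by rewrite diracT mul1e mulr0 oppr0 expR0 mul1e.
pose K := B `^ (- s) / Gamma s.
have G0 := Gamma_gt0 s0.
have K0 : 0 <= K by rewrite divr_ge0// ?powR_ge0// ltW.
pose f x : \bar R := (K * gamma_density s (A / B) x)%:E.
have f0 x : (0 <= f x)%E by rewrite lee_fin mulr_ge0 ?gamma_density_ge0.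
have mf : measurable_fun setT f.
  by apply/measurable_EFinP; apply: measurable_funM => //; exact: measurable_gamma_density.
have [g gE] := lebesgue_density mf f0.
exists g => t ABt; rewrite /bilateral gE; [|exact: measurable_expE|by move=> x; rewrite lee_fin expR_ge0].
rewrite (_ : (fun x => _) = fun x => (K%:E * (gamma_density s (A / B + t) x)%:E)%E); last first.
  apply/funext => x; rewrite /f -!EFinM; congr EFin.
  by rewrite /gamma_density mulrDl opprD expRD; ring.
have ABt' : 0 < A / B + t.
  by rewrite -(pmulr_rgt0 _ B0) mulrDr mulrCA divff ?gt_eqF// mulr1.
rewrite ge0_integralZl_EFin//; last 2 first.
- by move=> x _; rewrite lee_fin gamma_density_ge0.
- by apply/measurable_EFinP; exact: measurable_gamma_density.
rewrite integral_gamma_density// -EFinM /K; congr EFin.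
rewrite mulrA divfK ?gt_eqF// -powRM ?ltW//.
by congr (_ `^ _); rewrite mulrDr mulrCA divff ?gt_eqF// mulr1.
Qed.

Definition power_law_on nu s A B (D : set R) :=
  forall t, D t -> 0 < A + B * t /\ bilateral nu t = ((A + B * t) `^ (- s))%:E.

(** Comparison with the reference measure, whose transform is finite to the right of a because A + B
    t does not decrease with t. *)
Lemma power_law_extend nu s A B a b : 0 < s -> 0 <= B -> a < b ->
  power_law_on nu s A B [set t | a < t < b] -> power_law_on nu s A B [set t | a < t].
Proof.
move=> s0 B0 ab H.
have pos t : a < t -> 0 < A + B * t.
  (* A point of ]a, b[ to the left of t: positivity there passes to t since B >= 0. *)
  move=> a_t; pose t' := Num.min ((a + t) / 2) ((a + b) / 2).
  have [|p _] := H t'.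
    by rewrite /t' /= lt_min gt_min; apply/andP; split; [apply/andP; split|apply/orP; right]; lra.
  apply: (lt_le_trans p); rewrite lerD2l ler_wpM2l// ge_min; apply/orP; left; lra.
have [g gE] : exists g : {measure set R -> \bar R}, forall t, 0 < A + B * t ->
    bilateral g t = ((A + B * t) `^ (- s))%:E.
  apply: power_transform => // B00; have := pos ((a + b) / 2); rewrite B00 mul0r addr0; apply; lra.
move=> t /= a_t; split; first exact: pos.
rewrite -gE; last exact: pos.
apply: (@bilateral_extend R nu g a a b) => //.
- by rewrite lexx.
- by move=> u /[dup] /andP[au _] /H[p ->]; rewrite gE.
- by move=> u au; rewrite gE ?ltry// pos.
Qed.

Lemma bilateral_nonincreasing nu t1 t2 : nu `]-oo, 0%R[%classic = 0%E -> t1 <= t2 ->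
  (bilateral nu t2 <= bilateral nu t1)%E.
Proof.
move=> n0 t12; rewrite /bilateral !ge0_integral_halfline//; last 2 first.
- exact: measurable_expE.
- exact: measurable_expE.
apply: ge0_le_integral => //.
- by apply: measurable_funTS; exact: measurable_expE.
- by apply: measurable_funTS; exact: measurable_expE.
- move=> x; rewrite /= in_itv/= andbT => x0.
  by rewrite lee_fin ler_expR lerN2 ler_wpM2r.
Qed.

(** The transform of a measure without mass on the negative half-line does not increase, and the
    power - s reverses inequalities. *)
Lemma power_law_slope_ge0 nu s A B a b : 0 < s -> a < b -> nu `]-oo, 0%R[%classic = 0%E ->
  power_law_on nu s A B [set t | a < t < b] -> 0 <= B.
Proof.
move=> s0 ab n0 H; pose t1 := a + (b - a) / 3; pose t2 := a + (b - a) * (2 / 3).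
have [|p1 e1] := H t1; first by rewrite /t1 /=; apply/andP; split; lra.
have [|p2 e2] := H t2; first by rewrite /t2 /=; apply/andP; split; lra.
have t12 : t1 < t2 by rewrite /t1 /t2; lra.
have := bilateral_nonincreasing n0 (ltW t12); rewrite e1 e2 lee_fin => /(powRN_le s0 p2 p1).
by rewrite lerD2l -subr_ge0 -mulrBr pmulr_lge0// subr_gt0.
Qed.

Lemma power_law_extend_right nu s A B a b : 0 < s -> a < b -> nu `]-oo, 0%R[%classic = 0%E ->
  power_law_on nu s A B [set t | a < t < b] -> power_law_on nu s A B [set t | a < t].
Proof.
by move=> s0 ab n0 H; apply: (power_law_extend s0 (power_law_slope_ge0 s0 ab n0 H) ab H).
Qed.

(** The mass of the negative half-line is at most the transform at any t >= 0, and with B > 0 the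
    transform tends to 0 as t grows. *)
Lemma power_law_null nu s A B a b : 0 < s -> a < b -> 0 < B ->
  power_law_on nu s A B [set t | a < t < b] -> nu `]-oo, 0%R[%classic = 0%E.
Proof.
move=> s0 ab B0 H; have {}H := power_law_extend s0 (ltW B0) ab H.
apply/eqP; rewrite eq_le measure_ge0 andbT; apply/lee_addgt0Pr => e e0; rewrite add0e.
have [x x0 <-] := powRN_onto s0 e0.
pose t := Num.max (Num.max (x - A) 0 / B) (Num.max (a + 1) 0).
have t0 : 0 <= t by rewrite /t !le_max lexx !orbT.
have [|p eq] := H t.
  by rewrite /t /= !lt_max ltrDl ltr01 orbT.
have xt : x <= A + B * t.
  rewrite -lerBlDl; apply: (@le_trans _ _ (B * (Num.max (x - A) 0 / B))).
    by rewrite mulrCA divff ?gt_eqF// mulr1 le_max lexx.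
  by rewrite ler_wpM2l ?(ltW B0)// /t le_max lexx.
apply: (@le_trans _ _ (bilateral nu t)); last first.
  rewrite eq lee_fin; have [->//|nx] := eqVneq x (A + B * t).
  by rewrite ltW// ltr_powRN// lt_neqAle nx.
rewrite -[leLHS]mul1e -integral_cst// /bilateral.
apply: (@le_trans _ _ (\int[nu]_(x in `]-oo, 0%R[%classic) (expR (- (t * x)))%:E)%E).
  apply: ge0_le_integral => //.
  - by apply: measurable_funTS; exact: measurable_expE.
  - move=> y; rewrite /= in_itv/= => y0.
    by rewrite lee_fin -[leLHS]expR0 ler_expR oppr_ge0 mulr_ge0_le0// ltW.
apply: ge0_subset_integral => //; first exact: measurable_expE.
Qed.

(** Equality of transforms comes first, from the finiteness of that of [nu]. Positivity of A + B t
    follows: at a positive root t' the reference transform would be unbounded just to the right of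
    t', whereas that of [nu] is bounded there by its finite value at t'. *)
Lemma power_law_extend_left nu s A B M : 0 < s -> 0 < M -> nu `]-oo, 0%R[%classic = 0%E ->
  (forall t, 0 < t -> (bilateral nu t < +oo)%E) ->
  power_law_on nu s A B [set t | M < t] -> power_law_on nu s A B [set t | 0 < t].
Proof.
move=> s0 M0 n0 fin H.
have HM : power_law_on nu s A B [set t | M < t < M + 1] by move=> t /andP[Mt _]; exact: H.
have MM : M < M + 1 by rewrite ltrDl.
have B0 := power_law_slope_ge0 s0 MM n0 HM.
have [M1 _] : 0 < A + B * (M + 1) /\ True by split=> //; have [] := H (M + 1) MM.
have [g gE] : exists g : {measure set R -> \bar R}, forall t, 0 < A + B * t ->
    bilateral g t = ((A + B * t) `^ (- s))%:E.
  by apply: power_transform => // B00; move: M1; rewrite B00 mul0r addr0.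
have gnu t : 0 < t -> bilateral g t = bilateral nu t.
  apply: (@bilateral_extend R g nu 0 M (M + 1)) => //; first by rewrite (ltW M0).
  by move=> u /andP[Mu _]; have [p ->] := H u Mu; rewrite gE.
suff pos t : 0 < t -> 0 < A + B * t by move=> t /= t0; rewrite -gnu// gE ?pos.
move=> t0; rewrite ltNge; apply/negP => neg.
have Bp : 0 < B.
  by rewrite lt_neqAle B0 andbT eq_sym; apply/negP => /eqP B00; move: neg M1; rewrite B00 !mul0r; lra.
pose t' := - A / B.
have t't : t <= t' by rewrite /t' ler_pdivlMr//; lra.
have t'0 : 0 < t' by exact: lt_le_trans t't.
have At' : A + B * t' = 0 by rewrite /t' mulrCA divff ?gt_eqF//; lra.
pose K := fine (bilateral nu t').
have KE : bilateral nu t' = K%:E.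
  by rewrite fineK// ge0_fin_numE ?bilateral_ge0// fin.
have K0 : 0 <= K by rewrite fine_ge0// bilateral_ge0.
(* At t' + x / B the reference transform equals x^(- s) = K + 1, above the bound K. *)
have [x x0 xE] := powRN_onto s0 (ltr_wpDl K0 ltr01).
have ABx : A + B * (t' + x / B) = x by rewrite mulrDr addrA At' add0r mulrCA divff ?gt_eqF// mulr1.
have xB : 0 < x / B by rewrite divr_gt0.
have := @bilateral_nonincreasing nu t' (t' + x / B) n0.
rewrite lerDl ltW// => /(_ isT); rewrite -gnu ?addr_gt0// gE ABx// xE KE lee_fin; lra.
Qed.

(** The other coordinates are frozen by weighting with their exponential, and the result is
    projected onto coordinate i. The weight is positive, so vanishing on a half-space passes in both
    directions. *)
Lemma slice_measure n (m : {measure set (n.-tuple R) -> \bar R}) (i : 'I_n) (theta : 'rV[R]_n) :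
  exists nu : {measure set R -> \bar R},
    (forall t, bilateral nu t = laplace m (\row_k if k == i then t else theta 0 k)) /\
    (nu `]-oo, 0%R[%classic = 0%E <-> m [set x | tnth x i < 0] = 0%E).
Proof.
pose th0 : 'rV[R]_n := \row_k if k == i then 0 else theta 0 k.
pose f x : \bar R := (expdot th0 x)%:E.
have f0 x : (0 <= f x)%E by rewrite lee_fin expR_ge0.
have mf : measurable_fun setT f by apply/measurable_EFinP; exact: measurable_expdot.
have [m1 m1E] := density_measure m mf f0.
have mt : measurable_fun setT (fun x : n.-tuple R => tnth x i) by exact: measurable_tnth.
have [nu [nuE nuI]] := image_measure m1 mt.
exists nu; split=> [t|].
  rewrite /bilateral nuI; [|exact: measurable_expE|by move=> y; rewrite lee_fin expR_ge0].
  rewrite (ge0_integral_density mf f0 m1E); last first.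
  - by move=> x; rewrite lee_fin expR_ge0.
  - apply: (measurableT_comp (measurable_expE t) mt).
  apply: eq_integral => x _; rewrite /f -EFinM /expdot -expRD; congr (EFin (expR _)).
  rewrite -opprD; congr (- _); rewrite (bigD1 i)//= [in RHS](bigD1 i)//= !mxE eqxx mul0r add0r.
  by congr (_ + _); apply: eq_bigr => k /negbTE ki; rewrite !mxE ki.
have E : (fun x : n.-tuple R => tnth x i) @^-1` `]-oo, 0%R[%classic = [set x | tnth x i < 0].
  by apply/seteqP; split=> x /=; rewrite in_itv.
have mE := @measurable_tnth_lt R n i 0.
rewrite nuE// E m1E//; split=> H.
  by apply: null_of_integral_eq0 H => //; [exact: measurable_expdot|move=> x _; exact: expR_gt0].
by apply: null_set_integral => //; exact: measurable_funTS.
Qed.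
End PowerTransforms.

Section Slopes.
Variables (R : realType) (n : nat).
Implicit Types (a : {set 'I_n} -> R) (i j : 'I_n) (theta c : 'rV[R]_n) (S T : {set 'I_n}).

Definition slope a i theta : R := affine_poly a (upd i 1 theta) - affine_poly a (upd i 0 theta).

Lemma affine_poly_upd a i theta t :
  affine_poly a (upd i t theta) = affine_poly a (upd i 0 theta) + slope a i theta * t.
Proof. by rewrite /slope -(line_upd i theta t) -(line_upd i theta 1) !affine_poly_line; ring. Qed.

Lemma affine_shift1 a i theta : affine_poly (shift_coef a [set i]%SET) theta = slope a i theta.
Proof.
rewrite /slope -(line_upd i theta 1) affine_poly_line -{1}(upd_id i theta) -(line_upd i theta (theta 0 i)) affine_poly_line.
rewrite shift_coef_shift finset.inE eqxx /affine_poly [X in _ * X]big1; last by move=> *; rewrite mul0r.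
by ring.
Qed.

Definition box c (e : R) : set 'rV[R]_n := [set theta | forall i, `|theta 0 i - c 0 i| < e].

Lemma box_upd c e i t theta : box c e theta -> `|t - c 0 i| < e -> box c e (upd i t theta).
Proof. by move=> bt te k; rewrite updE; case: eqP => [->|]. Qed.

Lemma affine_shift_eq0 a c e i S : 0 < e -> i \notin S ->
  (forall theta, box c e theta -> affine_poly (shift_coef a S) theta = 0) ->
  (forall theta, box c e theta -> affine_poly (shift_coef a (i |: S)%SET) theta = 0).
Proof.
move=> e0 iS H theta bt.
have -> : shift_coef a (i |: S)%SET = shift_coef (shift_coef a S) [set i]%SET.
  by rewrite shift_coef_shift (negbTE iS).
rewrite affine_shift1.
have H1 : affine_poly (shift_coef a S) (upd i (c 0 i) theta) = 0.
  by apply: H; apply: box_upd => //; rewrite subrr normr0.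
have H2 : affine_poly (shift_coef a S) (upd i (c 0 i + e / 2) theta) = 0.
  by apply: H; apply: box_upd => //; rewrite addrC addKr gtr0_norm ?divr_gt0//; lra.
move: H1 H2; rewrite !(affine_poly_upd _ i theta (_ + _)) !(affine_poly_upd _ i theta (c 0 i)) => H1.
rewrite mulrDr addrA H1 add0r => /eqP; rewrite mulf_eq0 => /orP[/eqP//|/eqP]; lra.
Qed.

(** If the derivative in coordinate i vanished on a box, so would all its further derivatives, down
    to the constant given by the top coefficient. *)
Lemma exists_slope_neq0 a c e i : 0 < e -> a [set: 'I_n]%SET != 0 ->
  exists2 theta, box c e theta & slope a i theta != 0.
Proof.
move=> e0 aT; apply: contrapT => /forall2NP H.
have H1 theta : box c e theta -> affine_poly (shift_coef a [set i]%SET) theta = 0.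
  by move=> bt; rewrite affine_shift1; have [//|/negP] := H theta; rewrite negbK => /eqP.
have H2 (s : seq 'I_n) theta : box c e theta ->
    affine_poly (shift_coef a (i |: [set x in s])%SET) theta = 0.
  elim: s theta => [|j s IH] theta bt.
    have -> : [set x in [::]]%SET = finset.set0 :> {set 'I_n}.
      by apply/finset.setP => x; rewrite !finset.inE.
    by rewrite finset.setU0 H1.
  have -> : (i |: [set x in j :: s])%SET = (j |: (i |: [set x in s]))%SET.
    by apply/finset.setP => x; rewrite !finset.inE orbCA.
  have [jS|jS] := boolP (j \in (i |: [set x in s])%SET); last by apply: (affine_shift_eq0 e0 jS IH bt).
  by rewrite (finset.setUidPr _) ?finset.sub1set// IH.
have bc : box c e c by move=> k; rewrite subrr normr0.
have := H2 (enum 'I_n) c bc.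
have -> : (i |: [set x in enum 'I_n])%SET = [set: 'I_n]%SET.
  by apply/finset.setP => x; rewrite !finset.inE mem_enum orbT.
rewrite /affine_poly (bigD1 finset.set0)//= big_set0 mulr1 big1 ?addr0 => [|T T0].
  by rewrite /shift_coef finset.setC0 subxx finset.setU0 => /eqP; rewrite (negbTE aT).
rewrite /shift_coef ifF ?mul0r//; apply/negbTE.
by rewrite finset.subTset -finset.setC0 (inj_eq (inv_inj (@finset.setCK _))).
Qed.

(** With coordinates 1 / u on T and 0 elsewhere, u^|T| times the polynomial tends to [a T] as u
    decreases to 0. *)
Lemma affine_poly_top_ge0 a T : (forall theta, (forall i, 0 < theta 0 i) -> 0 <= affine_poly a theta) ->
  0 <= a T.
Proof.
(* The polynomial with reversed coefficients on the subsets of T; its value at 0 is [a T]. *)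
move=> H; pose b S := if S \subset T then a (T :\: S)%SET else 0.
have bE (u : R) : 0 < u -> affine_poly b (const_mx u) = u ^+ #|T| * affine_poly a (\row_k if k \in T then u^-1 else 0).
  move=> u0; rewrite /affine_poly mulr_sumr (bigID (fun S : {set 'I_n} => S \subset T))/=.
  rewrite [X in _ + X]big1 ?addr0; last by move=> S /negbTE ST; rewrite /b ST mul0r.
  rewrite [RHS](bigID (fun S : {set 'I_n} => S \subset T))/= [X in _ = _ + X]big1 ?addr0; last first.
    move=> S /subsetPn[x xS xT]; rewrite (bigD1 x)//= mxE (negbTE xT) mul0r !mulr0//.
  rewrite (reindex_onto (fun S => T :\: S)%SET (fun S => T :\: S)%SET)/=; last first.
    by move=> S ST; rewrite finset.setDDr finset.setDv finset.set0U; apply/finset.setIidPr.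
  apply: eq_big => S; first by rewrite finset.subsetDl finset.setDDr finset.setDv finset.set0U; apply/eqP/idP => [<-|/finset.setIidPr//]; exact: finset.subsetIl.
  move=> /andP[_ /eqP TS]; have ST : S \subset T by rewrite -TS finset.subsetDl.
  rewrite /b finset.subsetDl TS mulrCA; congr (_ * _).
  under eq_bigr do rewrite mxE; rewrite prodr_const.
  rewrite (eq_bigr (fun=> u^-1)); last by move=> k kS; rewrite mxE (fintype.subsetP ST).
  rewrite prodr_const exprVn cardsD (finset.setIidPr ST).
  by rewrite expfB_cond// -?subn_gt0 ?(gt_eqF u0)//= subset_leq_card.
have cl := @cvg_affine_diag R n b.
have b0 : affine_poly b 0 = a T by rewrite affine_poly0 /b finset.sub0set finset.setD0.
rewrite -b0 -(cvg_lim _ cl)//; apply: limr_ge; first by apply: cvgP cl.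
near=> u; have u0 : 0 < u by near: u; exact: nbhs_right_gt.
rewrite bE//; apply: mulr_ge0; first by rewrite exprn_ge0// ltW.
pose v := \row_k (if k \in T then u^-1 else 0) : 'rV[R]_n.
(* v has zero coordinates outside T, so it is in general only a limit of points of the open
   orthant. *)
have cv : affine_poly a (v + const_mx w) @[w --> (0 : R)^'+] --> affine_poly a v.
  rewrite (_ : (fun w => _) = fun w => affine_poly (fun T => affine_poly (shift_coef a T) v) (const_mx w)); last first.
    by apply/funext => w; rewrite addrC affine_polyD.
  have -> : affine_poly a v = affine_poly (fun T => affine_poly (shift_coef a T) v) 0.
    by rewrite -[in LHS](add0r v) affine_polyD.
  exact: cvg_affine_diag.
rewrite -/v -(cvg_lim _ cv)//; apply: limr_ge; first by apply: cvgP cv.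
near=> w; apply: H => i; rewrite !mxE.
have w0 : 0 < w by near: w; exact: nbhs_right_gt.
by case: ifP => _; rewrite ?add0r// addr_gt0// invr_gt0.
Unshelve. all: by end_near. Qed.

End Slopes.

Section LaplaceLaw.
Variables (R : realType) (n : nat) (p : {set 'I_n} -> R) (s : R).
Hypothesis s0 : 0 < s.
Implicit Types (m : {measure set (n.-tuple R) -> \bar R}) (D : set 'rV[R]_n) (theta c : 'rV[R]_n).

Definition laplace_law m D :=
  forall theta, D theta -> 0 < affine_poly p theta /\ laplace m theta = (affine_poly p theta `^ (- s))%:E.

Lemma slice_law m i theta : exists nu : {measure set R -> \bar R},
  (nu `]-oo, 0%R[%classic = 0%E <-> m [set x | tnth x i < 0] = 0%E) /\
  (forall t, bilateral nu t = laplace m (upd i t theta)) /\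
  forall D : set R, (forall t, D t -> 0 < affine_poly p (upd i t theta) /\
      laplace m (upd i t theta) = (affine_poly p (upd i t theta) `^ (- s))%:E) <->
    power_law_on nu s (affine_poly p (upd i 0 theta)) (slope p i theta) D.
Proof.
have [nu [nuE nu0]] := slice_measure m i theta.
exists nu; split => //; split => // D; rewrite /power_law_on.
by split=> H t /H; rewrite nuE -affine_poly_upd.
Qed.

Lemma laplace_law_right m (lo hi : 'I_n -> R) : (forall i, m [set x | tnth x i < 0] = 0%E) ->
  (forall i, lo i < hi i) ->
  laplace_law m [set theta | forall i, lo i < theta 0 i < hi i] ->
  laplace_law m [set theta | forall i, lo i < theta 0 i].
Proof.
move=> m0 lohi H.
(* r lists the coordinates already freed of their upper bound, each by the one-dimensional extension
   along a slice. *)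
suff G (r : seq 'I_n) : laplace_law m [set theta | forall i, lo i < theta 0 i /\ (i \notin r -> theta 0 i < hi i)].
  by move=> theta ht; apply: (G (enum 'I_n)) => i; split => //; rewrite mem_enum.
elim: r => [|i r IH] theta ht.
  by apply: H => i; have [-> /(_ isT) ->] := ht i.
have [nu [nu0 [nuE L]]] := slice_law m i theta.
rewrite -(upd_id i theta); apply: (L [set t | lo i < t]).2; last by have [] := ht i.
apply: (power_law_extend_right s0 (lohi i)); first by apply/nu0.
apply/L => t /= /andP[lot thi]; apply: IH => k; rewrite updE.
case: eqP => [->//|/eqP ki]; have [h1 h2] := ht k; split => // kr.
by apply: h2; rewrite inE negb_or ki.
Qed.

Lemma laplace_law_right_box m c e : 0 < e -> (forall i, m [set x | tnth x i < 0] = 0%E) ->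
  laplace_law m (box c e) -> laplace_law m [set theta | forall i, c 0 i - e < theta 0 i].
Proof.
move=> e0 m0 H; apply: (@laplace_law_right _ _ (fun i => c 0 i + e)) => // [i|theta ht]; first lra.
by apply: H => i; have := ht i; rewrite ltr_norml => /andP[? ?]; apply/andP; split; lra.
Qed.

Lemma laplace_law_left m (M : R) : (forall i, m [set x | tnth x i < 0] = 0%E) -> 0 < M ->
  (forall theta, (forall i, 0 < theta 0 i) -> (laplace m theta < +oo)%E) ->
  laplace_law m [set theta | forall i, M < theta 0 i] ->
  laplace_law m [set theta | forall i, 0 < theta 0 i].
Proof.
move=> m0 M0 fin H.
suff G (r : seq 'I_n) : laplace_law m [set theta | forall i, 0 < theta 0 i /\ (i \notin r -> M < theta 0 i)].
  by move=> theta ht; apply: (G (enum 'I_n)) => i; split => //; rewrite mem_enum.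
elim: r => [|i r IH] theta ht.
  by apply: H => i; have [_ ->] := ht i.
have [nu [nu0 [nuE L]]] := slice_law m i theta.
rewrite -(upd_id i theta); apply: (L [set t | 0 < t]).2; last by have [] := ht i.
apply: (power_law_extend_left s0 M0); first by apply/nu0.
  by move=> t t0; rewrite nuE; apply: fin => k; rewrite updE; case: eqP => // _; have [] := ht k.
apply/L => t /= Mt; apply: IH => k; rewrite updE.
case: eqP => [_|/eqP ki]; first by rewrite (lt_trans M0).
have [h1 h2] := ht k; split => // kr.
by apply: h2; rewrite inE negb_or ki.
Qed.

Lemma laplace_law_null m c e i theta : 0 < e -> box c e theta -> 0 < slope p i theta ->
  laplace_law m (box c e) -> m [set x | tnth x i < 0] = 0%E.
Proof.
move=> e0 bt sl H; have [nu [nu0 [nuE L]]] := slice_law m i theta.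
apply/nu0; apply: (@power_law_null _ _ s _ _ (c 0 i - e) (c 0 i + e) s0 _ sl); first lra.
apply/L => t /= /andP[t1 t2]; apply: H; apply: box_upd => //.
by rewrite ltr_norml; apply/andP; split; lra.
Qed.

Lemma ae_tnth_ge0 m : (forall i, m [set x | tnth x i < 0] = 0%E) ->
  \forall x \ae m, forall i, 0 <= tnth x i.
Proof.
move=> m0; apply: filter_forall => i; exists [set x | tnth x i < 0]; split => //.
  exact: measurable_tnth_lt.
by move=> x /= /negP; rewrite -ltNge.
Qed.

Lemma laplace_le_total m theta : (forall i, m [set x | tnth x i < 0] = 0%E) ->
  (forall i, 0 <= theta 0 i) -> (laplace m theta <= m setT)%E.
Proof.
move=> m0 t0; rewrite -[leRHS]mul1e -integral_cst// /laplace.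
apply: ae_ge0_le_integral => //.
- by move=> x _; rewrite lee_fin expR_ge0.
- by apply/measurable_EFinP; exact: measurable_expdot.
- apply: filterS (ae_tnth_ge0 m0) => x H _; rewrite lee_fin /expdot expR_le1 oppr_le0.
  by apply: sumr_ge0 => i _; rewrite mulr_ge0.
Qed.

(** Extending to the right, then to the left as far as 0, where the total mass bounds the transform,
    shows that P is positive on the open orthant; scaling then isolates each coefficient. *)
Lemma laplace_law_coef_ge0 m c e T : 0 < e -> (forall i, m [set x | tnth x i < 0] = 0%E) ->
  (m setT <= 1)%E -> laplace_law m (box c e) -> 0 <= p T.
Proof.
move=> e0 m0 m1 H.
have H1 := laplace_law_right_box e0 m0 H.
pose M := 1 + \sum_i `|c 0 i - e|.
have M0 : 0 < M by rewrite ltr_pwDl// sumr_ge0.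
have H2 : laplace_law m [set theta | forall i, M < theta 0 i].
  move=> theta ht; apply: H1 => i; apply: le_lt_trans (ht i).
  rewrite /M (bigD1 i)//=; have := ler_norm (c 0 i - e).
  have : 0 <= \sum_(j | j != i) `|c 0 j - e| by rewrite sumr_ge0.
  lra.
have LT theta : (forall i, 0 < theta 0 i) -> (laplace m theta <= 1)%E.
  by move=> t0; apply: le_trans m1; apply: laplace_le_total => // i; exact: ltW.
have H3 := laplace_law_left m0 M0 (fun theta t0 => le_lt_trans (LT theta t0) (ltry 1)) H2.
apply: affine_poly_top_ge0 => theta t0; by have [/ltW] := H3 theta t0.
Qed.
End LaplaceLaw.

Section Reflection.
Variables (R : realType) (n : nat) (p : {set 'I_n} -> R) (lambda : R).
Hypothesis lambda_gt0 : 0 < lambda.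
Hypothesis p_neq0 : forall T, p T != 0.
Hypothesis p_init_gt0 : forall j : nat, (1 <= j <= n)%N -> 0 < p [set i : 'I_n | (i < j)%N]%SET.
Variables (mu : {measure set (n.-tuple R) -> \bar R}) (c : 'rV[R]_n) (e : R).
Hypothesis e0 : 0 < e.
Hypothesis mu1 : mu setT = 1%E.
Hypothesis mu_law : laplace_law p lambda mu (box c e).

(* Reflecting the coordinates along which P decreases somewhere moves the mass
   into the nonnegative orthant and makes all the coefficients positive; as the
   [p_[j]] were positive already, there was no such coordinate. *)
Lemma affine_gamma_positive :
  (forall T, 0 < p T) /\ forall i, exists2 theta, box c e theta & 0 < slope p i theta.
Proof.
have /choice[th hth] i : exists theta, box c e theta /\ slope p i theta != 0.
  by have [theta] := exists_slope_neq0 c i e0 (p_neq0 _); exists theta.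
(* The sign of the derivative along coordinate i at a point of the box where it is nonzero; flipping
   by it makes that derivative positive. *)
pose sg i : R := Num.sg (slope p i (th i)).
have sg2 i : sg i * sg i = 1 by rewrite -expr2 sqr_sg (hth i).2.
pose flip (theta : 'rV[R]_n) : 'rV[R]_n := \row_i (sg i * theta 0 i).
have flipK theta : flip (flip theta) = theta.
  by apply/rowP => i; rewrite !mxE mulrA sg2 mul1r.
pose p' (T : {set 'I_n}) := p T * \prod_(i in T) sg i.
have pE theta : affine_poly p' theta = affine_poly p (flip theta).
  apply: eq_bigr => T _; rewrite /p' -mulrA -big_split/=; congr (_ * _).
  by apply: eq_bigr => i _; rewrite mxE.
pose phi (x : n.-tuple R) : n.-tuple R := [tuple sg i * tnth x i | i < n].
have mphi : measurable_fun setT phi.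
  apply/measurable_fun_tnthP => i.
  rewrite (_ : _ \o _ = fun x : n.-tuple R => sg i * tnth x i); last first.
    by apply/funext => x /=; rewrite tnth_mktuple.
  by apply: measurable_funM => //; exact: measurable_tnth.
have [mu' [mu'E mu'I]] := image_measure mu mphi.
have LE theta : laplace mu' theta = laplace mu (flip theta).
  rewrite /laplace mu'I; last 2 first.
  - by apply/measurable_EFinP; exact: measurable_expdot.
  - by move=> x; rewrite lee_fin expR_ge0.
  apply: eq_integral => x _; rewrite /expdot; congr (EFin (expR (- _))).
  by apply: eq_bigr => i _; rewrite mxE tnth_mktuple mulrCA mulrA.
have box_flip theta : box (flip c) e theta -> box c e (flip theta).
  move=> bt i; have := bt i; rewrite !mxE -[X in _ -> `|_ - X| < _]mul1r -(sg2 i) -mulrA -mulrBr normrM.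
  by rewrite /sg normr_sg (hth i).2 mul1r.
have law' : laplace_law p' lambda mu' (box (flip c) e).
  by move=> theta /box_flip /mu_law; rewrite pE LE.
have mu'0 i : mu' [set x | tnth x i < 0] = 0%E.
  have [bt st] := hth i.
  apply: (@laplace_law_null _ _ p' _ lambda_gt0 _ (flip c) e i (flip (th i))) => //.
    by move=> k; have := bt k; rewrite !mxE -mulrBr normrM normr_sg (hth k).2 mul1r.
  have fu v : flip (upd i v (flip (th i))) = upd i (sg i * v) (th i).
    by apply/rowP => k; rewrite !mxE; case: eqP => [->//|_]; rewrite mulrA sg2 mul1r.
  rewrite /slope !pE !fu mulr1 mulr0 affine_poly_upd addrC addKr.
  by rewrite mulrC /sg -normrEsg normr_gt0.
have p'_gt0 T : 0 < p' T.
  rewrite lt_neqAle eq_sym; apply/andP; split.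
    rewrite mulf_neq0// prodf_seq_neq0; apply/allP => i _; apply/implyP => _.
    by rewrite sgr_eq0 (hth i).2.
  apply: (laplace_law_coef_ge0 lambda_gt0 T e0 mu'0 _ law').
  by rewrite mu'E// preimage_setT mu1.
have sg_gt0 i : 0 < sg i.
  (* Both [p'] and [p] are positive at [j], so the product of the first j signs is positive;
     quotients of consecutive products give each sign. *)
  have sgp (j : nat) : (j <= n)%N -> 0 < \prod_(k < n | (k < j)%N) sg k.
    case: j => [_|j jn]; first by rewrite big_pred0.
    have := p'_gt0 [set k : 'I_n | (k < j.+1)%N]%SET; rewrite /p' pmulr_rgt0 ?p_init_gt0//.
    by congr (0 < _); apply: eq_bigl => k; rewrite finset.inE.
  have := sgp i.+1 (ltn_ord i); rewrite (bigD1 i)//= (eq_bigl (fun k : 'I_n => (k < i)%N)); last first.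
    by move=> k; rewrite ltnS ltn_neqAle andbC.
  by rewrite pmulr_lgt0// sgp// ltnW.
split=> [T|i].
  have := p'_gt0 T; rewrite /p' pmulr_lgt0// prodr_gt0// => i _; exact: sg_gt0.
by exists (th i); [exact: (hth i).1|rewrite -sgr_gt0; exact: sg_gt0].
Qed.
End Reflection.

(** * Infinite divisibility and the signs of the derivatives *)

Section MixedDifferencesLaplace.
Variables (R : realType) (n : nat).
Implicit Types (m : {measure set (n.-tuple R) -> \bar R}) (y theta : 'rV[R]_n) (z w : 'I_n -> R) (s : seq 'I_n).

Lemma mdiff_prod (h : 'I_n -> R -> R) s z w y : uniq s ->
  mdiff s z w (fun theta => \prod_k h k (theta 0 k)) y =
  \prod_k if k \in s then h k (z k) - h k (w k) else h k (y 0 k).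
Proof.
elim: s y => [//|i s IH] y /=.
move=> /andP[is_ us]; rewrite !IH// (bigD1 i)//= [X in _ - X](bigD1 i)//= [RHS](bigD1 i)//=.
rewrite (negbTE is_) mem_head !updE eqxx mulrBl.
congr (_ * _ - _ * _); apply: eq_bigr => k ki; rewrite inE (negbTE ki) updE (negbTE ki)//.
Qed.

Lemma mdiff_expdot_ge0 s z w y (x : n.-tuple R) : uniq s -> (forall k, z k <= w k) ->
  (forall k, 0 <= tnth x k) -> 0 <= mdiff s z w (fun theta => expdot theta x) y.
Proof.
move=> us zw x0; rewrite (mdiff_ext _ _ _ _ (g := fun theta => \prod_k expR (- (theta 0 k * tnth x k)))); last first.
  by move=> theta; exact: expdotE.
rewrite (mdiff_prod (fun k t => expR (- (t * tnth x k))))//; apply: prodr_ge0 => k _.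
case: ifP => _; last exact: expR_ge0.
by rewrite subr_ge0 ler_expR lerN2 ler_wpM2r.
Qed.

(** Under the integral sign, the mixed difference is a product of exponentials and of factors e^(-z
    x) - e^(-w x), nonnegative for z <= w on the orthant that carries the measure. *)
Lemma mdiff_laplace_ge0 m (D : 'I_n -> set R) s z w y : (forall i, m [set x | tnth x i < 0] = 0%E) ->
  (forall theta, (forall k, D k (theta 0 k)) -> (laplace m theta < +oo)%E) ->
  uniq s -> (forall k, z k <= w k) ->
  (forall k, D k (z k)) -> (forall k, D k (w k)) -> (forall k, D k (y 0 k)) ->
  0 <= mdiff s z w (fun theta => fine (laplace m theta)) y.
Proof.
move=> m0 fin us zw Dz Dw Dy.
have [I E] : m.-integrable setT (fun x => (mdiff s z w (fun theta => expdot theta x) y)%:E) /\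
    (\int[m]_x (mdiff s z w (fun theta => expdot theta x) y)%:E)%E =
    (mdiff s z w (fun theta => fine (laplace m theta)) y)%:E.
  elim: s y {us} Dy => [|i s IH] y Dy /=.
    have F := fin _ Dy; have L0 : (0 <= laplace m y)%E by apply: integral_ge0 => x _; rewrite lee_fin expR_ge0.
    rewrite fineK ?ge0_fin_numE//; split => //; apply/integrableP; split.
      by apply/measurable_EFinP; exact: measurable_expdot.
    by under eq_integral do rewrite gee0_abs ?lee_fin ?expR_ge0//.
  have Du v : D i v -> forall k, D k (upd i v y 0 k) by move=> Dv k; rewrite updE; case: eqP => [->|].
  have [I1 E1] := IH _ (Du _ (Dz i)); have [I2 E2] := IH _ (Du _ (Dw i)).
  split; first by under eq_fun do rewrite EFinB; exact: integrableB.
  by under eq_integral do rewrite EFinB; rewrite integralB_EFin// E1 E2.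
rewrite -lee_fin -E.
have [N [mN N0 sN]] := ae_tnth_ge0 m0.
rewrite (negligible_integral mN measurableT I N0); apply: integral_ge0 => x [_ Nx].
rewrite lee_fin; apply: mdiff_expdot_ge0 => //.
by apply: contrapT => H; apply: Nx; exact: sN.
Qed.

Lemma cvg_powR_sub1_div (a x : R) : 0 < x ->
  (fun t => t^-1 * (x `^ (- (a * t)) - 1)) @ (0 : R)^'+ --> - (a * ln x).
Proof.
move=> x0.
have D : is_derive (0 : R) (1 : R) (fun t : R => expR (t * (- (a * ln x)))) (- (a * ln x)).
  have D1 : is_derive (0 : R) (1 : R) (fun t : R => t * (- (a * ln x))) (- (a * ln x)).
    apply: is_derive_eq (is_derive_mul (is_derive_id (0 : R) (1 : R)) (is_derive_cst (- (a * ln x)) (0 : R) (1 : R))) _.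
    by rewrite mul1r mulr0 addr0.
  have := is_derive_comp D1 (is_derive_expR (0 * (- (a * ln x)))).
  by rewrite mul0r expR0 mul1r.
have [dD vD] := D.
apply: cvg_dnbhs_at_right; rewrite -vD; apply: cvg_trans dD; apply: near_eq_cvg.
apply: nearW => t; rewrite /GRing.scale/= mulr1 addr0 mul0r expR0 /powR gt_eqF//.
by congr (_ * (expR _ - _)); ring.
Qed.
End MixedDifferencesLaplace.

Section QuadraticCoefficients.
Variables (R : realType) (n : nat) (p : {set 'I_n} -> R) (lambda : R).
Hypothesis lambda_gt0 : 0 < lambda.
Hypothesis p_gt0 : forall T, 0 < p T.
Variables (c : 'rV[R]_n) (e : R).
Hypothesis e0 : 0 < e.
Hypothesis slope_gt0 : forall i, exists2 theta, box c e theta & 0 < slope p i theta.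
Hypothesis infdiv : forall t, 0 < t -> exists m : {measure set (n.-tuple R) -> \bar R},
  laplace_law p (lambda * t) m (box c e).

Lemma laplace_law_extended s m : 0 < s -> laplace_law p s m (box c e) ->
  (forall i, m [set x | tnth x i < 0] = 0%E) /\
  laplace_law p s m [set theta | forall i, c 0 i - e < theta 0 i].
Proof.
move=> s0 H; have m0 i : m [set x | tnth x i < 0] = 0%E.
  by have [theta bt st] := slope_gt0 i; apply: (laplace_law_null s0 e0 bt st H).
by split => //; exact: laplace_law_right_box.
Qed.

Lemma affine_gt0_extended (theta : 'rV[R]_n) : (forall i, c 0 i - e < theta 0 i) -> 0 < affine_poly p theta.
Proof.
move=> ht; have [m H] := infdiv ltr01.
have l1 : 0 < lambda * 1 by rewrite mulr1.
by have [_ /(_ theta ht) []] := laplace_law_extended l1 H.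
Qed.

(* Mixed differences of P^(-lambda t) are integrals of nonnegative functions;
   infinite divisibility allows t -> 0. *)
Lemma mdiff_ln_affine_ge0 (s : seq 'I_n) (z w : 'I_n -> R) (y : 'rV[R]_n) : uniq s -> s != [::] -> (forall k, z k <= w k) ->
  (forall k, c 0 k - e < z k) -> (forall k, c 0 k - e < y 0 k) ->
  0 <= mdiff s z w (fun theta => - ln (affine_poly p theta)) y.
Proof.
move=> us sn zw cz cy.
have cw k : c 0 k - e < w k by exact: lt_le_trans (zw k).
(* This tends to - lambda ln P as t decreases to 0, and the - 1 disappears in any mixed difference
   of order at least one. *)
pose F (t : R) theta := t^-1 * (affine_poly p theta `^ (- (lambda * t)) - 1).
pose D k : set R := [set t | c 0 k - e < t].
have cv : mdiff s z w (F t) y @[t --> (0 : R)^'+] --> mdiff s z w (fun theta => - (lambda * ln (affine_poly p theta))) y.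
  apply: (@mdiff_cvg R n s z w _ _ F _ D y) => // theta ht; apply: cvg_powR_sub1_div; exact: affine_gt0_extended.
have -> : mdiff s z w (fun theta => - ln (affine_poly p theta)) y =
    lambda^-1 * mdiff s z w (fun theta => - (lambda * ln (affine_poly p theta))) y.
  rewrite -mdiffZ; apply: mdiff_ext => theta.
  by rewrite mulrN mulrA mulVf ?gt_eqF// mul1r.
rewrite mulr_ge0 ?invr_ge0 ?(ltW lambda_gt0)// -(cvg_lim _ cv)//; apply: limr_ge; first by apply: cvgP cv.
near=> t; have t0 : 0 < t by near: t; exact: nbhs_right_gt.
have lt0 : 0 < lambda * t by exact: mulr_gt0.
have [m /(laplace_law_extended lt0)[m0 law]] := infdiv t0.
rewrite mdiffZ mulr_ge0 ?invr_ge0 ?(ltW t0)// mdiffD mdiff_cst// addr0.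
rewrite (@mdiff_local R n s z w _ (fun theta => fine (laplace m theta)) D y)//; last first.
  by move=> theta /law[_ ->].
apply: (mdiff_laplace_ge0 (D := D)) => //.
by move=> theta /law[_ ->]; rewrite ltry.
Unshelve. all: by end_near. Qed.

Let beta k := - theta_P p 0 k.

Let beta_gt0 k : 0 < beta k.
Proof. by rewrite /beta mxE /ptilde1 /ptilde opprK divr_gt0. Qed.

Let qE (z : 'rV[R]_n) : (forall k, 0 < z 0 k) ->
  affine_poly p (\row_k ((z 0 k)^-1 - beta k)) =
  p [set: 'I_n]%SET * \prod_k (z 0 k)^-1 * affine_poly (qcoef p) z.
Proof.
move=> z0; rewrite affine_poly_factor ?gt_eqF//.
  congr (_ * _ * _).
    by apply: eq_bigr => k _; rewrite mxE /beta opprK addrK.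
  by congr affine_poly; apply/rowP => k; rewrite !mxE /beta mxE opprK addrK invrK.
by move=> k; rewrite mxE /beta opprK -subr_eq0 addrK invr_eq0 gt_eqF.
Qed.

(** In the variables z = 1 / (theta + beta), - ln q is - ln P plus a constant and functions of
    single coordinates, so both have the same mixed differences of order at least two; order one is
    settled by the absence of linear terms in q. *)
Lemma qcoef_ders_ge0 (s : seq 'I_n) : 0 <= eval (qcoef p) lambda (ders lambda s (@DW R n)) 0.
Proof.
(* Chosen so that 0 < z_k < 1 / M puts theta_k = 1 / z_k - beta_k to the right of c_k - e, where P
   is known to be positive. *)
pose M := 1 + \sum_k `|c 0 k - e + beta k|.
have M0 : 0 < M by rewrite ltr_pwDl// sumr_ge0.
have inM (t : R) k : 0 < t < M^-1 -> c 0 k - e < t^-1 - beta k.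
  move=> /andP[t0 tM]; rewrite ltrBrDr.
  have : M < t^-1 by rewrite -[M]invrK ltf_pV2// posrE ?invr_gt0.
  apply: le_lt_trans; rewrite /M (bigD1 k)//=; have := ler_norm (c 0 k - e + beta k).
  have : 0 <= \sum_(j | j != k) `|c 0 j - e + beta j| by rewrite sumr_ge0.
  lra.
have q_gt0 (z : 'rV[R]_n) : (forall k, 0 < z 0 k < M^-1) -> 0 < affine_poly (qcoef p) z.
  move=> hz; have z0 k : 0 < z 0 k by have /andP[] := hz k.
  have P0 : 0 < p [set: 'I_n]%SET * \prod_k (z 0 k)^-1.
    by rewrite mulr_gt0// prodr_gt0// => k _; rewrite invr_gt0.
  rewrite -(pmulr_rgt0 _ P0) -qE//; apply: affine_gt0_extended => k.
  by rewrite mxE; exact: inM.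
have q00 : affine_poly (qcoef p) 0 = 1 by rewrite affine_poly0 qcoef0// gt_eqF.
have q0 : 0 < affine_poly (qcoef p) 0 by rewrite q00.
apply: ders_pow_ge0 => //; first exact: ltW.
move=> {}s us sn.
case: s us sn => [//|i [|j r]] us _.
  rewrite /= affine_shift1.
  have H0 (t : R) : affine_poly (qcoef p) (upd i t 0) = 1.
    rewrite /affine_poly (bigD1 finset.set0)//= big_set0 mulr1 qcoef0 ?gt_eqF//.
    rewrite big1 ?addr0// => S S0.
    have [->|Si] := eqVneq S [set i]%SET; first by rewrite qcoef1 ?mul0r// gt_eqF.
    have /subsetPn[x xS xi] : ~~ (S \subset [set i]%SET).
      by rewrite finset.subset1 negb_or Si S0.
    rewrite (bigD1 x)//= updE; move: xi; rewrite finset.inE => /negbTE ->.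
    by rewrite mxE mul0r mulr0.
  by rewrite /slope !H0 subrr oppr0 mul0r.
apply: (@ders_log_set_ge0 R n (qcoef p) lambda M^-1) => //; first by rewrite invr_gt0.
move=> {us} {}s z w y us s2 wz zM yM.
have wM k : 0 < w k < M^-1 by have /andP[-> h] := wz k; rewrite (lt_trans h).
have zM' k : 0 < z k < M^-1 by have /andP[h1 h2] := wz k; rewrite (lt_trans h1)// zM.
pose A (k : 'I_n) : set R := [set t | 0 < t < M^-1].
rewrite (@mdiff_local R n s z w _ (fun x => - ln (affine_poly p (\row_k ((x 0 k)^-1 - beta k))) +
   (ln (p [set: 'I_n]%SET) + \sum_k ln ((x 0 k)^-1))) A y)//; last first.
  move=> x Ax; have x0 k : 0 < x 0 k by have /andP[] := Ax k.
  rewrite qE// lnM ?posrE ?q_gt0//; last first.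
    by rewrite mulr_gt0// prodr_gt0// => k _; rewrite invr_gt0.
  rewrite lnM ?posrE//; last by rewrite prodr_gt0// => k _; rewrite invr_gt0.
  have -> : ln (\prod_k (x 0 k)^-1) = \sum_k ln (x 0 k)^-1.
    elim: (index_enum _) => [|k r' IH]; first by rewrite !big_nil ln1.
    rewrite !big_cons lnM ?posrE ?invr_gt0// ?IH// prodr_gt0// => j' _.
    by rewrite invr_gt0.
  by ring.
have sn : s != [::] by rewrite -size_eq0 -lt0n (leq_trans _ s2).
rewrite mdiffD mdiffD mdiff_cst// add0r (mdiff_sum_coord _ _ (fun k t => ln t^-1))// addr0.
rewrite (mdiff_map s z w (fun k t => t^-1 - beta k) (fun x => - ln (affine_poly p x))).
apply: mdiff_ln_affine_ge0 => // k.
(* Inversion reverses the order: w < z becomes 1 / z < 1 / w, the orientation in which exponentials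
   have nonnegative differences. *)
- by have /andP[w0 h] := wz k; rewrite lerD2r ler_pV2 ?inE ?unitfE ?gt_eqF ?(lt_trans w0 h)//= ltW.
- exact: inM.
- by rewrite mxE; exact: inM.
Qed.
End QuadraticCoefficients.

(** * The mixture of gamma laws *)

Section CountableTonelli.
Local Open Scope ereal_scope.
Variables (R : realType) (I : countType).

(** An enumeration turns the unordered sum into a series, which can be integrated term by term. *)
Lemma esum_pickle (a : I -> \bar R) : (forall i, 0 <= a i) ->
  \esum_(i in setT) a i = \sum_(k <oo) oapp a 0 (@pickle_inv I k).
Proof.
move=> a0; have [[i0 _]|noI] := pselect (exists i : I, True); last first.
  rewrite esum1; last by move=> i _; exfalso; apply: noI; exists i.
  rewrite eseries0// => k _ _; case: (@pickle_inv I k) => //= i; exfalso; apply: noI; exists i => //.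
pose e k := odflt i0 (@pickle_inv I k).
pose P : pred nat := fun k => isSome (@pickle_inv I k).
have -> : [set: I] = e @` (fun k => P k).
  by apply/seteqP; split => // i _; exists (pickle i); rewrite /P /e pickleK_inv.
rewrite (@esum_pred_image _ _ a e P)//; last first.
  move=> k l; rewrite !inE /P /e => Pk Pl.
  have := pickle_invK (T := I) k; have := pickle_invK (T := I) l.
  case: (@pickle_inv I k) Pk => // i _; case: (@pickle_inv I l) Pl => //= j _ <- <- ->//.
rewrite eseries_mkcond; apply: eq_eseriesr => k _; rewrite /P /e.
by case: (@pickle_inv I k).
Qed.

Context d (T : measurableType d) (mu : {measure set T -> \bar R}).
Variable f : I -> T -> \bar R.
Hypothesis mf : forall i, measurable_fun setT (f i).
Hypothesis f0 : forall i x, 0 <= f i x.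

Let g k x := oapp (f ^~ x) 0 (@pickle_inv I k).
Let mg k : measurable_fun setT (g k).
Proof. by rewrite /g; case: (@pickle_inv I k) => [i|] /=; [exact: mf|exact: measurable_cst]. Qed.
Let g0 k x : 0 <= g k x.
Proof. by rewrite /g; case: (@pickle_inv I k) => /=. Qed.

Lemma measurable_esum : measurable_fun setT (fun x => \esum_(i in setT) f i x).
Proof.
under eq_fun do rewrite esum_pickle//.
have := @ge0_emeasurable_sum _ T R setT g xpredT (fun k x _ _ => g0 k x) (fun k _ => mg k).
by [].
Qed.

Lemma integral_esum : \int[mu]_x (\esum_(i in setT) f i x) = \esum_(i in setT) \int[mu]_x f i x.
Proof.
under eq_integral do rewrite esum_pickle//.
rewrite (integral_nneseries mu measurableT mg (fun k x _ => g0 k x)).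
rewrite esum_pickle; last by move=> i; exact: integral_ge0.
apply: eq_eseriesr => k _; rewrite /g; case: (@pickle_inv I k) => //=.
exact: integral0.
Qed.
End CountableTonelli.

Section GammaLaw.
Variable R : realType.
Implicit Types (s b t : R).

Lemma gamma_probability s b : 0 < s -> 0 < b -> exists m : probability R R,
  forall h : R -> \bar R, measurable_fun setT h -> (forall x, 0 <= h x)%E ->
  (\int[m]_x h x = \int[lebesgue_measure]_x (h x * (gamma_density s b x * (b `^ s / Gamma s))%:E))%E.
Proof.
move=> s0 b0; have G0 := Gamma_gt0 s0; have C0 : 0 <= b `^ s / Gamma s by rewrite divr_ge0 ?powR_ge0// ltW.
pose f x : \bar R := (gamma_density s b x * (b `^ s / Gamma s))%:E.
have f0 x : (0 <= f x)%E by rewrite lee_fin mulr_ge0// gamma_density_ge0.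
have mf : measurable_fun setT f.
  by apply/measurable_EFinP; apply: measurable_funM => //; exact: measurable_gamma_density.
have [nu nuI] := lebesgue_density mf f0.
have nu1 : nu setT = 1%E.
  rewrite -[LHS]mul1e -integral_cst// nuI//.
  under eq_integral do rewrite mul1e /f mulrC EFinM.
  rewrite ge0_integralZl_EFin//; last 2 first.
  - by move=> x _; rewrite lee_fin gamma_density_ge0.
  - by apply/measurable_EFinP; exact: measurable_gamma_density.
  rewrite integral_gamma_density// -EFinM; congr EFin.
  by rewrite mulrA divfK ?gt_eqF// powRN divff// gt_eqF// powR_gt0.
have [m mE] := probability_of_measure nu1.
exists m => h mh h0; rewrite -nuI//.
by apply: eq_measure_integral => A mA _; exact: mE.
Qed.

Section moments.
Variables (s b : R) (m : probability R R).
Hypotheses (s0 : 0 < s) (b0 : 0 < b).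
Hypothesis mI : forall h : R -> \bar R, measurable_fun setT h -> (forall x, 0 <= h x)%E ->
  (\int[m]_x h x = \int[lebesgue_measure]_x (h x * (gamma_density s b x * (b `^ s / Gamma s))%:E))%E.

Lemma gamma_probability_moment (j : nat) t : 0 < b + t ->
  (\int[m]_x (`|x| ^+ j * expR (- (t * x)))%:E =
   (b `^ s * (b + t) `^ (- s) * (rising s j * (b + t) ^- j))%:E)%E.
Proof.
move=> bt; have G0 := Gamma_gt0 s0.
have sj0 : 0 < s + j%:R by rewrite ltr_wpDr.
rewrite mI; last 2 first.
- apply/measurable_EFinP; apply: measurable_funM; last exact: measurable_expRM.
  by apply: measurable_funX; exact: normr_measurable.
- by move=> x; rewrite lee_fin mulr_ge0 ?expR_ge0// exprn_ge0.
rewrite (_ : (fun x => _) = fun x => ((b `^ s / Gamma s)%:E * (gamma_density (s + j%:R) (b + t) x)%:E)%E); last first.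
  apply/funext => x; rewrite -!EFinM; congr EFin.
  have [x0|x0] := leP x 0; first by rewrite !gamma_density_le0//; ring.
  rewrite !gamma_density_gt0// gtr0_norm// -addrA [j%:R - 1]addrC addrA.
  rewrite (@powRD _ x (s - 1) j%:R); last by rewrite lt0r_neq0// implybT.
  by rewrite powR_mulrn ?ltW// mulrDl opprD expRD; ring.
rewrite ge0_integralZl_EFin//; last 3 first.
- by move=> x _; rewrite lee_fin gamma_density_ge0.
- by apply/measurable_EFinP; exact: measurable_gamma_density.
- by rewrite divr_ge0 ?powR_ge0// ltW.
rewrite integral_gamma_density// -EFinM; congr EFin.
rewrite opprD (@powRD _ (b + t) (- s) (- j%:R)); last by rewrite lt0r_neq0// implybT.
rewrite [_ `^ (- j%:R)]powRN powR_mulrn ?(ltW bt)// /rising.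
have key (x1 x2 x3 x4 x5 : R) : x1 * x2 * (x3 * (x4 * x5)) = x1 * x4 * (x3 * x2 * x5) by ring.
exact: key.
Qed.

Lemma gamma_probability_le0 : (\int[m]_x (\1_(`]-oo, 0%R]%classic) x)%:E = 0)%E.
Proof.
rewrite mI//; last by apply/measurable_EFinP; exact: measurable_indic.
rewrite integral0_eq// => x _; rewrite -EFinM indicE.
have [x0|x0] := leP x 0; first by rewrite gamma_density_le0// mul0r mulr0.
by rewrite memNset ?mul0r//= in_itv/=; apply/negP; rewrite -ltNge.
Qed.

Lemma gamma_probability_gt0 u : 0 <= u -> (0 < \int[m]_x (\1_(`]u, +oo[%classic) x)%:E)%E.
Proof.
move=> u0; rewrite lt0e integral_ge0 ?andbT; last by move=> x _; rewrite lee_fin.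
apply/eqP => H; have mD : measurable (`]u, +oo[%classic : set R) by exact: measurable_itv.
have C0 : 0 < b `^ s / Gamma s by rewrite divr_gt0 ?powR_gt0// Gamma_gt0.
move: H; rewrite mI//; last by apply/measurable_EFinP; exact: measurable_indic.
move=> H.
pose f x := gamma_density s b x * (b `^ s / Gamma s).
have leb0 : @lebesgue_measure R `]u, +oo[%classic = 0%E.
  apply: (@null_of_integral_eq0 _ _ _ lebesgue_measure _ f) => //.
  - by apply: measurable_funM => //; exact: measurable_gamma_density.
  - move=> x; rewrite /= in_itv/= andbT => ux; have x0 : 0 < x by exact: le_lt_trans ux.
    by rewrite /f gamma_density_gt0// (mulr_gt0 _ C0)// mulr_gt0 ?powR_gt0 ?expR_gt0.
  - rewrite -[RHS]H [LHS]integral_mkcond; apply: eq_integral => x _.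
    by rewrite patchE indicE; case: ifP => _; rewrite ?mul1e ?mul0e.
have E : @lebesgue_measure R `]u, +oo[%classic = +oo%E.
  have E := @lebesgue_measure_itv R (Interval (BRight u) (BInfty R false)).
  by apply: (etrans E) => /=; rewrite ltry.
by move: leb0; rewrite E.
Qed.
End moments.
End GammaLaw.

Section GammaProduct.
Variables (R : realType) (n : nat) (lambda : R) (beta : 'I_n -> R).
Hypothesis lambda_gt0 : 0 < lambda.
Hypothesis beta_gt0 : forall i, 0 < beta i.

Lemma rising_gt0 j : 0 < rising lambda j.
Proof. by rewrite /rising divr_gt0// Gamma_gt0// ltr_wpDr. Qed.

Lemma prodr_powR (I : Type) (r : seq I) (f : I -> R) (a : R) : (forall i, 0 <= f i) ->
  \prod_(i <- r) f i `^ a = (\prod_(i <- r) f i) `^ a.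
Proof.
move=> f0; elim: r => [|i r IH]; first by rewrite !big_nil powR1.
by rewrite !big_cons IH powRM// prodr_ge0.
Qed.

Variable m : 'I_n -> probability R R.
Hypothesis mI : forall i (h : R -> \bar R), measurable_fun setT h -> (forall x, 0 <= h x)%E ->
  (\int[m i]_x h x =
   \int[lebesgue_measure]_x (h x * (gamma_density lambda (beta i) x * (beta i `^ lambda / Gamma lambda))%:E))%E.
Variable G : probability (n.-tuple R) R.
Hypothesis GI : forall (f : 'I_n -> R -> R) (a : 'I_n -> R),
    (forall i, measurable_fun setT (f i)) -> (forall i x, 0 <= f i x) ->
    (forall i, \int[m i]_x (f i x)%:E = (a i)%:E)%E ->
    (\int[G]_x (\prod_(i < n) f i (tnth x i))%:E = (\prod_(i < n) a i)%:E)%E.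

Lemma measurable_moment j (t : R) : measurable_fun setT (fun x : R => `|x| ^+ j * expR (- (t * x))).
Proof.
apply: measurable_funM; last exact: measurable_expRM.
by apply: measurable_funX; exact: normr_measurable.
Qed.

Lemma gamma_product_moment (alpha : 'I_n -> nat) (theta : 'rV[R]_n) : (forall i, 0 < beta i + theta 0 i) ->
  (\int[G]_x (\prod_i (`|tnth x i| ^+ alpha i * expR (- (theta 0 i * tnth x i))))%:E =
   (\prod_i (beta i `^ lambda * (beta i + theta 0 i) `^ (- lambda) *
      (rising lambda (alpha i) * (beta i + theta 0 i) ^- alpha i)))%:E)%E.
Proof.
move=> bt; apply: (GI (f := fun i x => `|x| ^+ alpha i * expR (- (theta 0 i * x)))).
- by move=> i; exact: measurable_moment.
- by move=> i x; rewrite mulr_ge0 ?expR_ge0// exprn_ge0.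
- by move=> i; exact: (gamma_probability_moment lambda_gt0 (@mI i)).
Qed.

Lemma gamma_product_rectangle (B : 'I_n -> set R) : (forall i, measurable (B i)) ->
  G (rectangle B) = (\prod_i fine (\int[m i]_x (\1_(B i) x)%:E)%E)%:E.
Proof.
move=> mB; have mR := measurable_rectangle mB.
have <- : (\int[G]_x (\1_(rectangle B) x)%:E)%E = G (rectangle B) by rewrite integral_indic// setIT.
under eq_integral do rewrite -prod_indic.
apply: (GI (f := fun i => \1_(B i))) => // i; rewrite fineK// integral_indic// setIT.
exact: fin_num_measure.
Qed.

Lemma gamma_product_null i : G [set x | tnth x i <= 0] = 0%E.
Proof.
pose B (j : 'I_n) : set R := if j == i then `]-oo, 0%R]%classic else setT.
have -> : [set x : n.-tuple R | tnth x i <= 0] = rectangle B.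
  apply/seteqP; split=> x /=; rewrite /rectangle /B /=.
    by move=> xi j; case: eqP => [->|//]; rewrite /= in_itv.
  by move=> /(_ i); rewrite eqxx /= in_itv.
rewrite gamma_product_rectangle; last by move=> j; rewrite /B; case: eqP.
by rewrite (bigD1 i)//= /B eqxx (gamma_probability_le0 (@mI i)) mul0r.
Qed.

(** Later upgrades almost everywhere finiteness of the series to finiteness at every point. *)
Lemma gamma_product_gt0 (u : 'I_n -> R) : (forall i, 0 <= u i) ->
  (0 < G [set x : n.-tuple R | forall i, (u i < tnth x i)%R])%E.
Proof.
move=> u0; pose B (j : 'I_n) : set R := `]u j, +oo[%classic.
have -> : [set x : n.-tuple R | forall i, u i < tnth x i] = rectangle B.
  by apply/seteqP; split=> x /= H i; have := H i; rewrite /B /= in_itv/= andbT.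
rewrite gamma_product_rectangle; last by move=> j; exact: measurable_itv.
rewrite lte_fin prodr_gt0// => i _; rewrite fine_gt0//.
rewrite (gamma_probability_gt0 lambda_gt0 (beta_gt0 i) (@mI i))//=.
have mB : measurable (B i) by exact: measurable_itv.
have E : (\int[m i]_x (\1_(B i) x)%:E = m i (B i))%E by rewrite integral_indic// setIT.
by rewrite E -ge0_fin_numE// fin_num_measure.
Qed.

Variable c : {ffun 'I_n -> nat} -> R.
Hypothesis c_ge0 : forall alpha, 0 <= c alpha.

(** Absolute values keep the terms nonnegative on the whole space; they disappear on the positive
    orthant, which carries the gamma laws. *)
Definition mix_term (alpha : {ffun 'I_n -> nat}) (x : n.-tuple R) : R :=
  c alpha * \prod_i ((rising lambda (alpha i))^-1 * `|tnth x i| ^+ alpha i).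

Definition mix_density x : \bar R := (\esum_(alpha in setT) (mix_term alpha x)%:E)%E.

Lemma mix_term_ge0 alpha x : 0 <= mix_term alpha x.
Proof.
rewrite mulr_ge0// prodr_ge0// => i _.
by rewrite mulr_ge0 ?invr_ge0 ?(ltW (rising_gt0 _))// exprn_ge0.
Qed.

Lemma measurable_mix_term alpha : measurable_fun setT (mix_term alpha).
Proof.
apply: measurable_funM => //.
apply: (measurable_prod_tnth (f := fun i y => (rising lambda (alpha i))^-1 * `|y| ^+ alpha i)) => i.
apply: measurable_funM => //; apply: measurable_funX; exact: normr_measurable.
Qed.

Lemma measurable_mix_density : measurable_fun setT mix_density.
Proof.
apply: (measurable_esum (f := fun alpha x => (mix_term alpha x)%:E)) => [alpha|alpha x].
  by apply/measurable_EFinP; exact: measurable_mix_term.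
by rewrite lee_fin mix_term_ge0.
Qed.

Lemma mix_density_ge0 x : (0 <= mix_density x)%E.
Proof. by apply: esum_ge0 => alpha _; rewrite lee_fin mix_term_ge0. Qed.

(** Termwise, by Tonelli: the moment of order alpha_i of a tilted gamma law contains the rising
    factorial of lambda, which cancels the denominator and leaves a power of 1 / (beta_i +
    theta_i). *)
Lemma laplace_mix (theta : 'rV[R]_n) : (forall i, 0 < beta i + theta 0 i) ->
  (\int[G]_x ((expdot theta x)%:E * mix_density x) =
   ((\prod_i beta i `^ lambda) * (\prod_i (beta i + theta 0 i)) `^ (- lambda))%:E *
   \esum_(alpha in setT) (c alpha * \prod_i ((beta i + theta 0 i)^-1) ^+ alpha i)%:E)%E.
Proof.
move=> bt.
have -> : (fun x => ((expdot theta x)%:E * mix_density x)%E) =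
    fun x => (\esum_(alpha in setT) (expdot theta x * mix_term alpha x)%:E)%E.
  apply/funext => x; rewrite -esumZ ?expR_ge0// => alpha.
  by rewrite lee_fin mix_term_ge0.
rewrite (integral_esum G (f := fun alpha x => (expdot theta x * mix_term alpha x)%:E)); last 2 first.
- move=> alpha; apply/measurable_EFinP; apply: measurable_funM; first exact: measurable_expdot.
  exact: measurable_mix_term.
- by move=> alpha x; rewrite lee_fin mulr_ge0 ?expR_ge0 ?mix_term_ge0.
have ti i : 0 <= (beta i + theta 0 i)^-1 by rewrite invr_ge0 ltW.
rewrite -esumZ; last 2 first.
- by rewrite mulr_ge0 ?powR_ge0// prodr_ge0// => i _; exact: powR_ge0.
- by move=> alpha; rewrite lee_fin mulr_ge0// prodr_ge0// => i _; rewrite exprn_ge0.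
apply: eq_esum => alpha _.
pose r := c alpha * \prod_i (rising lambda (alpha i))^-1.
have r0 : 0 <= r.
  by rewrite mulr_ge0// prodr_ge0// => i _; rewrite invr_ge0 ltW// rising_gt0.
have -> : (fun x => (expdot theta x * mix_term alpha x)%:E) =
    fun x => (r%:E * (\prod_i (`|tnth x i| ^+ alpha i * expR (- (theta 0 i * tnth x i))))%:E)%E.
  apply/funext => x; rewrite -EFinM; congr EFin.
  by rewrite expdotE /mix_term /r !big_split/=; ring.
have mE : measurable_fun setT (fun x : n.-tuple R =>
    (\prod_i (`|tnth x i| ^+ alpha i * expR (- (theta 0 i * tnth x i))))%:E).
  apply/measurable_EFinP.
  apply: (measurable_prod_tnth (f := fun i y => `|y| ^+ alpha i * expR (- (theta 0 i * y)))) => i.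
  exact: measurable_moment.
rewrite (ge0_integralZl_EFin G measurableT _ mE r0); last first.
  by move=> x _; rewrite lee_fin prodr_ge0// => i _; rewrite mulr_ge0 ?expR_ge0// exprn_ge0.
rewrite gamma_product_moment// -!EFinM; congr EFin.
rewrite -prodr_powR; last by move=> i; exact: ltW.
rewrite /r 3!big_split/=.
have -> : \prod_i (beta i + theta 0 i) ^- alpha i = \prod_i ((beta i + theta 0 i)^-1) ^+ alpha i.
  by apply: eq_bigr => i _; rewrite exprVn.
have rr : (\prod_i (rising lambda (alpha i))^-1) * \prod_i rising lambda (alpha i) = 1.
  by rewrite -big_split big1//= => i _; rewrite mulVf// gt_eqF// rising_gt0.
set r1 := \prod_i (rising lambda (alpha i))^-1 in rr *; set r2 := \prod_i rising lambda (alpha i) in rr *.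
set b1 := \prod_i beta i `^ lambda; set b2 := \prod_i _ `^ (- lambda); set b3 := \prod_i (_ ^-1) ^+ _.
by transitivity (c alpha * (b1 * b2 * b3) * (r1 * r2)); [ring|rewrite rr; ring].
Qed.

Variable p : {set 'I_n} -> R.
Hypothesis pT_gt0 : 0 < p [set: 'I_n]%SET.
Hypothesis betaE : forall i, beta i = - ptilde1 p i.
Variables (mu : {measure set (n.-tuple R) -> \bar R}) (e M : R).
Hypothesis e0 : 0 < e.
Hypothesis ce : forall z : 'rV[R]_n, (forall i, `|z 0 i| < e) ->
  let term alpha := c alpha * \prod_(i < n) z 0 i ^+ alpha i in
  0 < affine_poly (qcoef p) z /\
  abs_summable setT term /\ affine_poly (qcoef p) z `^ (- lambda) = real_sum setT term.
Hypothesis mu0 : forall i, mu [set x | tnth x i < 0] = 0%E.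
Hypothesis mu_law : laplace_law p lambda mu [set theta | forall i, M < theta 0 i].

(** The constant left over when P^(- lambda) is divided by q^(- lambda) and by the gamma transforms
    prod_i (beta_i / (beta_i + theta_i))^lambda. *)
Definition mix_mass : R := (p [set: 'I_n]%SET * \prod_i beta i) `^ (- lambda).

(* The law of X has density [mix_mass * mix_density] with respect to a product of
   gamma laws: the Laplace transforms agree for large arguments. *)
Lemma gamma_mixture (h : n.-tuple R -> \bar R) : measurable_fun setT h -> (forall x, 0 <= h x)%E ->
  (\int[mu]_x h x = \int[G]_x (h x * (mix_mass%:E * mix_density x)))%E.
Proof.
move=> mh h0.
pose f x := (mix_mass%:E * mix_density x)%E.
have f0 x : (0 <= f x)%E by rewrite mule_ge0 ?lee_fin ?powR_ge0// mix_density_ge0.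
have mf : measurable_fun setT f by apply: emeasurable_funM => //; exact: measurable_mix_density.
have [nu nuE] := density_measure G mf f0.
rewrite -(ge0_integral_density mf f0 nuE mh h0); apply: eq_measure_integral => A mA _.
(* Beyond M the transform of [mu] is known; beyond 1 / e all z_i = 1 / (beta_i + theta_i) are
   smaller than e, where the series converges. *)
pose M' := Num.max M e^-1; apply: (laplace_unique (M := M')) mA => //.
  move=> i; have mN := @measurable_tnth_lt R n i 0.
  rewrite nuE//; apply: null_set_integral => //; first exact: measurable_funTS.
  apply/eqP; rewrite eq_le measure_ge0 andbT -(gamma_product_null i).
  by apply: le_measure; rewrite ?inE//; [exact: measurable_tnth_le|move=> x /= /ltW].
move=> theta ht.
have ht1 i : M < theta 0 i by have := ht i; rewrite gt_max => /andP[].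
have ht2 i : e^-1 < theta 0 i by have := ht i; rewrite gt_max => /andP[].
have [P0 LT] := mu_law ht1; split; first by rewrite LT ltry.
have t0 i : 0 < theta 0 i by apply: lt_trans (ht2 i); rewrite invr_gt0.
have bt i : 0 < beta i + theta 0 i by rewrite addr_gt0.
rewrite LT /laplace (ge0_integral_density mf f0 nuE); last 2 first.
- by apply/measurable_EFinP; exact: measurable_expdot.
- by move=> x; rewrite lee_fin expR_ge0.
have -> : (fun x => ((expdot theta x)%:E * f x)%E) = (fun x => (mix_mass%:E * ((expdot theta x)%:E * mix_density x))%E).
  by apply/funext => x; rewrite muleCA.
rewrite ge0_integralZl_EFin//; last 3 first.
- by move=> x _; rewrite mule_ge0 ?lee_fin ?expR_ge0// mix_density_ge0.
- apply: emeasurable_funM; last exact: measurable_mix_density.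
  by apply/measurable_EFinP; exact: measurable_expdot.
- exact: powR_ge0.
rewrite laplace_mix//.
pose z : 'rV[R]_n := \row_i (beta i + theta 0 i)^-1.
have ze i : `|z 0 i| < e.
  rewrite mxE gtr0_norm ?invr_gt0// -[e]invrK ltf_pV2 ?posrE ?invr_gt0//.
  by apply: lt_trans (ht2 i) _; rewrite ltrDr.
have [q0 [S E]] := ce ze.
have tg0 alpha : 0 <= c alpha * \prod_i (beta i + theta 0 i)^-1 ^+ alpha i.
  by rewrite mulr_ge0// prodr_ge0// => i _; rewrite exprn_ge0// invr_ge0 ltW.
have zE : (fun alpha : {ffun 'I_n -> nat} => c alpha * \prod_i z 0 i ^+ alpha i) =
    fun alpha => c alpha * \prod_i (beta i + theta 0 i)^-1 ^+ alpha i.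
  by apply/funext => alpha; under eq_bigr do rewrite mxE.
have -> : (\esum_(alpha in setT) (c alpha * \prod_i (beta i + theta 0 i)^-1 ^+ alpha i)%:E =
   (affine_poly (qcoef p) z `^ (- lambda))%:E)%E.
  rewrite E zE ge0_real_sum// fineK// ge0_fin_numE; last by apply: esum_ge0 => alpha _; rewrite lee_fin.
  move: S; rewrite zE abs_summableE; under eq_esum do rewrite ger0_norm//.
  by [].
rewrite -!EFinM; congr EFin.
have thetaP i : theta 0 i - theta_P p 0 i = beta i + theta 0 i by rewrite mxE betaE addrC.
rewrite affine_poly_factor ?gt_eqF//; last by move=> i; rewrite -subr_eq0 thetaP gt_eqF.
have -> : \row_i (theta 0 i - theta_P p 0 i)^-1 = z by apply/rowP => i; rewrite mxE [RHS]mxE thetaP.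
under eq_bigr do rewrite thetaP.
have pb : 0 < \prod_i beta i by rewrite prodr_gt0.
have pbt : 0 < \prod_i (beta i + theta 0 i) by rewrite prodr_gt0.
rewrite !powRM ?mulr_ge0 ?(ltW pT_gt0) ?(ltW pbt) ?(ltW q0)//.
rewrite /mix_mass powRM ?(ltW pT_gt0) ?(ltW pb)// prodr_powR; last by move=> i; exact: ltW.
rewrite [(\prod_i beta i) `^ (- _)]powRN.
by field; rewrite gt_eqF// powR_gt0.
Qed.
End GammaProduct.

(** * Integrating out the second block of coordinates *)

Section Blocks.
Variables (R : realType) (k n : nat) (le_kn : (k <= n)%N).
Local Notation fsti := (fst_idx le_kn).
Local Notation sndi := (snd_idx le_kn).

Lemma prod_blocks (h : 'I_n -> R) :
  \prod_i h i = (\prod_(i < k) h (fsti i)) * \prod_(j < n - k) h (sndi j).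
Proof.
rewrite (reindex (cast_ord (subnKC le_kn)))/=; last first.
  by apply: onW_bij; exists (cast_ord (esym (subnKC le_kn))) => i; rewrite ?cast_ordK ?cast_ordKV.
rewrite big_split_ord/=; congr (_ * _); apply: eq_bigr => i _; congr h.
exact: val_inj.
Qed.

Lemma measurable_fst_block : measurable_fun setT (@fst_block k n le_kn R).
Proof.
apply/measurable_fun_tnthP => i.
rewrite (_ : _ \o _ = fun x : n.-tuple R => tnth x (fsti i)); first exact: measurable_tnth.
by apply/funext => x /=; rewrite tnth_mktuple.
Qed.

Lemma measurable_snd_block : measurable_fun setT (@snd_block k n le_kn R).
Proof.
apply/measurable_fun_tnthP => i.
rewrite (_ : _ \o _ = fun x : n.-tuple R => tnth x (sndi i)); first exact: measurable_tnth.
by apply/funext => x /=; rewrite tnth_mktuple.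
Qed.

Definition blockwise (T : Type) (f : 'I_k -> T) (g : 'I_n -> T) (i : 'I_n) : T :=
  if insub (i : nat) is Some j then f j else g i.

Lemma blockwise_fst T (f : 'I_k -> T) g i : blockwise f g (fsti i) = f i.
Proof. by rewrite /blockwise /= valK. Qed.

Lemma blockwise_snd T (f : 'I_k -> T) g j : blockwise f g (sndi j) = g (sndi j).
Proof. by rewrite /blockwise insubN//= -leqNgt leq_addr. Qed.

Variables (lambda : R) (beta : 'I_n -> R).
Hypothesis lambda_gt0 : 0 < lambda.
Hypothesis beta_gt0 : forall i, 0 < beta i.
Variable m : 'I_n -> probability R R.
Hypothesis mI : forall i (h : R -> \bar R), measurable_fun setT h -> (forall x, 0 <= h x)%E ->
  (\int[m i]_x h x =
   \int[lebesgue_measure]_x (h x * (gamma_density lambda (beta i) x * (beta i `^ lambda / Gamma lambda))%:E))%E.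
Variable G : probability (n.-tuple R) R.
Hypothesis GI : forall (f : 'I_n -> R -> R) (a : 'I_n -> R),
    (forall i, measurable_fun setT (f i)) -> (forall i x, 0 <= f i x) ->
    (forall i, \int[m i]_x (f i x)%:E = (a i)%:E)%E ->
    (\int[G]_x (\prod_(i < n) f i (tnth x i))%:E = (\prod_(i < n) a i)%:E)%E.

(** The two blocks are independent under [G]. For the indicator of a rectangle this is the product
    formula; in general, the image on the first block weighted by the second and a constant multiple
    of the plain image agree on rectangles, hence everywhere. *)
Lemma block_integral (g : k.-tuple R -> \bar R) (f : 'I_n -> R -> R) (a : 'I_n -> R) :
  measurable_fun setT g -> (forall u, 0 <= g u)%E ->
  (forall i, measurable_fun setT (f i)) -> (forall i x, 0 <= f i x) ->
  (forall i, \int[m i]_x (f i x)%:E = (a i)%:E)%E ->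
  (\int[G]_x (g (fst_block le_kn x) * (\prod_(j < n - k) f (sndi j) (tnth x (sndi j)))%:E) =
   (\prod_(j < n - k) a (sndi j))%:E * \int[G]_x g (fst_block le_kn x))%E.
Proof.
move=> mg g0 mf f0 fa.
have base (f' : 'I_n -> R -> R) (a' : 'I_n -> R) (B : 'I_k -> set R) : (forall i, measurable (B i)) ->
  (forall i, measurable_fun setT (f' i)) -> (forall i x, 0 <= f' i x) ->
  (forall i, \int[m i]_x (f' i x)%:E = (a' i)%:E)%E ->
  (\int[G]_x ((\1_(rectangle B) (fst_block le_kn x))%:E * (\prod_(j < n - k) f' (sndi j) (tnth x (sndi j)))%:E) =
   ((\prod_(i < k) fine (\int[m (fsti i)]_x (\1_(B i) x)%:E)) * \prod_(j < n - k) a' (sndi j))%:E)%E.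
  move=> mB mf' f'0 fa'.
  pose h := blockwise (fun i => \1_(B i) : R -> R) f'.
  pose b i := blockwise (fun j => fine (\int[m i]_x (\1_(B j) x)%:E)%E) a' i.
  have hE x : ((\1_(rectangle B) (fst_block le_kn x))%:E * (\prod_(j < n - k) f' (sndi j) (tnth x (sndi j)))%:E =
      (\prod_i h i (tnth x i))%:E)%E.
    rewrite -EFinM prod_blocks -prod_indic; congr ((_ * _)%:E).
      by apply: eq_bigr => i _; rewrite /h blockwise_fst tnth_mktuple.
    by apply: eq_bigr => j _; rewrite /h blockwise_snd.
  under eq_integral do rewrite hE.
  rewrite (GI (f := h) (a := b)); first last.
  - move=> i; rewrite /h /b /blockwise; case: insubP => [j _ _|_]; last exact: fa'.
    rewrite fineK// integral_indic// setIT; exact: fin_num_measure.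
  - by move=> i x; rewrite /h /blockwise; case: insubP => [j _ _|_].
  - move=> i; rewrite /h /blockwise; case: insubP => [j _ _|_]; last exact: mf'.
    exact: measurable_indic.
  rewrite prod_blocks; congr ((_ * _)%:E); apply: eq_bigr => i _.
    by rewrite /b blockwise_fst.
  by rewrite /b blockwise_snd.
pose F x : \bar R := (\prod_(j < n - k) f (sndi j) (tnth x (sndi j)))%:E.
pose A : R := \prod_(j < n - k) a (sndi j).
have A0 : 0 <= A.
  by rewrite prodr_ge0// => j _; rewrite -lee_fin -fa integral_ge0// => x _; rewrite lee_fin.
have F0 x : (0 <= F x)%E by rewrite lee_fin prodr_ge0.
have mF : measurable_fun setT F.
  apply/measurable_EFinP; apply: measurable_prod => j _.
  by apply: measurableT_comp; [exact: mf|exact: measurable_tnth].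
have [i1 I1] := weighted_image G measurable_fst_block mF F0.
have [i2 I2] := @weighted_image _ _ _ _ _ G _ (fun=> A%:E) measurable_fst_block (measurable_cst _) (fun=> A0).
have e1 i : (\int[m i]_x (cst 1 x)%:E = 1%:E)%E.
  rewrite -[LHS]/(\int[m i]_x cst 1%:E x)%E.
  by rewrite integral_cst// mul1e; exact: probability_setT.
have B12 B : (forall i, measurable (B i)) -> i1 (rectangle B) = i2 (rectangle B).
  move=> mB; have mR := measurable_rectangle mB.
  have ind (mm : {measure set (k.-tuple R) -> \bar R}) : mm (rectangle B) = (\int[mm]_u (\1_(rectangle B) u)%:E)%E.
    by rewrite integral_indic// setIT.
  have mi : measurable_fun setT (fun u : k.-tuple R => (\1_(rectangle B) u : R)%:E).
    by apply/measurable_EFinP; exact: measurable_indic.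
  rewrite !ind I1// I2// /F (base f a B)//.
  under eq_integral do rewrite muleC.
  rewrite ge0_integralZl_EFin//; last exact: (measurableT_comp mi measurable_fst_block).
  have := base (fun=> cst 1) (fun=> 1) B mB (fun=> measurable_cst _) (fun _ _ => ler01) e1.
  rewrite (_ : (fun x => _) = fun x => (\1_(rectangle B) (fst_block le_kn x))%:E); last first.
    by apply/funext => x; rewrite [X in (_ * X%:E)%E]big1// mule1.
  by move=> ->; rewrite -EFinM [X in _ = (A * (_ * X))%:E]big1// mulr1 mulrC.
have i1fin : (i1 setT < +oo)%E.
  have -> : i1 setT = (\int[i1]_u cst 1%:E u)%E by rewrite integral_cst// mul1e.
  have rT : rectangle (fun=> setT) = setT :> set (k.-tuple R) by apply/seteqP; split.
  have := base f a (fun=> setT) (fun=> measurableT) mf f0 fa; rewrite rT I1//.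
  rewrite (_ : (fun x => _) = fun x => (cst 1%:E (fst_block le_kn x) * F x)%E) => [->|]; first exact: ltry.
  by apply/funext => x; rewrite indicT.
have i12 := measure_eq_rectangle i1fin B12.
have -> : (\int[G]_x (g (fst_block le_kn x) * F x) = \int[G]_x (g (fst_block le_kn x) * A%:E))%E.
  by rewrite -I1// -I2//; apply: eq_measure_integral => S mS _; exact: i12.
under eq_integral do rewrite muleC.
by rewrite ge0_integralZl_EFin//; exact: measurableT_comp mg measurable_fst_block.
Qed.

Variable c : {ffun 'I_n -> nat} -> R.
Hypothesis c_ge0 : forall alpha, 0 <= c alpha.

Definition block_term (u : k.-tuple R) (theta : 'rV[R]_(n - k)) (alpha : {ffun 'I_n -> nat}) : R :=
  c alpha * (\prod_(i < k) ((rising lambda (alpha (fsti i)))^-1 * `|tnth u i| ^+ alpha (fsti i))) *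
  \prod_(j < n - k) (beta (sndi j) + theta 0 j)^-1 ^+ alpha (sndi j).

Definition block_sum u theta : \bar R := (\esum_(alpha in setT) (block_term u theta alpha)%:E)%E.

Section theta.
Variable theta : 'rV[R]_(n - k).
Hypothesis bt : forall j, 0 < beta (sndi j) + theta 0 j.

Lemma block_term_ge0 u alpha : 0 <= block_term u theta alpha.
Proof.
rewrite !mulr_ge0// prodr_ge0// => i _; last by rewrite exprn_ge0// invr_ge0 ltW.
by rewrite mulr_ge0 ?exprn_ge0// invr_ge0 ltW// rising_gt0.
Qed.

Lemma measurable_block_term alpha : measurable_fun setT (fun u => block_term u theta alpha).
Proof.
apply: measurable_funM => //; apply: measurable_funM => //.
apply: (measurable_prod_tnth (f := fun i y => (rising lambda (alpha (fsti i)))^-1 * `|y| ^+ alpha (fsti i))) => i.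
by apply: measurable_funM => //; apply: measurable_funX; exact: normr_measurable.
Qed.

Lemma measurable_block_sum : measurable_fun setT (block_sum ^~ theta).
Proof.
apply: (measurable_esum (f := fun alpha u => (block_term u theta alpha)%:E)) => [alpha|alpha u].
  by apply/measurable_EFinP; exact: measurable_block_term.
by rewrite lee_fin block_term_ge0.
Qed.

Lemma block_sum_ge0 u : (0 <= block_sum u theta)%E.
Proof. by apply: esum_ge0 => alpha _; rewrite lee_fin block_term_ge0. Qed.

Definition block_factor : R := \prod_(j < n - k) (beta (sndi j) `^ lambda * (beta (sndi j) + theta 0 j) `^ (- lambda)).

(** Termwise again: the second block contributes gamma moments that do not involve the first, and
    [block_factor] collects what does not depend on alpha. *)
Lemma block_mixture (g : k.-tuple R -> R) : measurable_fun setT g -> (forall u, 0 <= g u) ->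
  (\int[G]_x ((g (fst_block le_kn x) * expdot theta (snd_block le_kn x))%:E * mix_density lambda c x) =
   block_factor%:E * \int[G]_x ((g (fst_block le_kn x))%:E * block_sum (fst_block le_kn x) theta))%E.
Proof.
move=> mg g0.
have mgf : measurable_fun setT (fun x : n.-tuple R => g (fst_block le_kn x)).
  exact: measurableT_comp mg measurable_fst_block.
have msnd : measurable_fun setT (fun x : n.-tuple R => expdot theta (snd_block le_kn x)).
  exact: measurableT_comp (measurable_expdot theta) measurable_snd_block.
have mix0 := mix_term_ge0 lambda_gt0 c_ge0.
have -> : (fun x => ((g (fst_block le_kn x) * expdot theta (snd_block le_kn x))%:E * mix_density lambda c x)%E) =
    fun x => (\esum_(alpha in setT) (g (fst_block le_kn x) * expdot theta (snd_block le_kn x) * mix_term lambda c alpha x)%:E)%E.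
  apply/funext => x; rewrite -esumZ ?mulr_ge0 ?expR_ge0// => alpha.
  by rewrite lee_fin mix0.
rewrite (integral_esum G (f := fun alpha x => (g (fst_block le_kn x) * expdot theta (snd_block le_kn x) * mix_term lambda c alpha x)%:E)); last 2 first.
- move=> alpha; apply/measurable_EFinP; apply: measurable_funM; first exact: measurable_funM.
  exact: measurable_mix_term.
- move=> alpha x; rewrite lee_fin; apply: mulr_ge0; last exact: mix0.
  by rewrite mulr_ge0 ?expR_ge0.
have -> : (fun x => ((g (fst_block le_kn x))%:E * block_sum (fst_block le_kn x) theta)%E) =
    fun x => (\esum_(alpha in setT) (g (fst_block le_kn x) * block_term (fst_block le_kn x) theta alpha)%:E)%E.
  apply/funext => x; rewrite -esumZ// => alpha.
  by rewrite lee_fin block_term_ge0.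
have bf0 : 0 <= block_factor by rewrite prodr_ge0// => j _; rewrite mulr_ge0 ?powR_ge0.
have mbt alpha : measurable_fun setT (fun x => (g (fst_block le_kn x) * block_term (fst_block le_kn x) theta alpha)%:E).
  apply/measurable_EFinP; apply: measurable_funM => //.
  exact: measurableT_comp (measurable_block_term alpha) measurable_fst_block.
rewrite (integral_esum G (f := fun alpha x => (g (fst_block le_kn x) * block_term (fst_block le_kn x) theta alpha)%:E))//; last first.
  by move=> alpha x; rewrite lee_fin mulr_ge0// block_term_ge0.
rewrite -esumZ//; last first.
  by move=> alpha; apply: integral_ge0 => x _; rewrite lee_fin mulr_ge0// block_term_ge0.
apply: eq_esum => alpha _.
pose g1 u : R := g u * (c alpha * \prod_(i < k) ((rising lambda (alpha (fsti i)))^-1 * `|tnth u i| ^+ alpha (fsti i))).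
have g10 u : 0 <= g1 u.
  rewrite !mulr_ge0// prodr_ge0// => i _.
  by rewrite mulr_ge0 ?exprn_ge0// invr_ge0 ltW// rising_gt0.
have mg1 : measurable_fun setT g1.
  apply: measurable_funM => //; apply: measurable_funM => //.
  apply: (measurable_prod_tnth (f := fun i y => (rising lambda (alpha (fsti i)))^-1 * `|y| ^+ alpha (fsti i))) => i.
  by apply: measurable_funM => //; apply: measurable_funX; exact: normr_measurable.
(* off the second block the exponent is irrelevant: it is taken to be 0 *)
pose th (i : 'I_n) : R := blockwise (fun=> 0) (fun i => if insub (i - k)%N is Some j then theta 0 j else 0) i.
have thE j : th (sndi j) = theta 0 j by rewrite /th blockwise_snd /= addKn valK.
have bth i : 0 < beta i + th i.
  rewrite /th /blockwise; case: insubP => [j _ _|]; first by rewrite addr0.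
  rewrite -leqNgt => ki; case: insubP => [j _ jE|_]; last by rewrite addr0.
  have -> : i = sndi j by apply: val_inj; rewrite /= jE subnKC.
  exact: bt.
pose f (i : 'I_n) (y : R) : R := (rising lambda (alpha i))^-1 * (`|y| ^+ alpha i * expR (- (th i * y))).
pose a i : R := beta i `^ lambda * (beta i + th i) `^ (- lambda) * (beta i + th i)^-1 ^+ alpha i.
have ri i : 0 <= (rising lambda (alpha i))^-1 by rewrite invr_ge0 ltW// rising_gt0.
have -> : (fun x => (g (fst_block le_kn x) * expdot theta (snd_block le_kn x) * mix_term lambda c alpha x)%:E) =
    fun x => ((g1 (fst_block le_kn x))%:E * (\prod_(j < n - k) f (sndi j) (tnth x (sndi j)))%:E)%E.
  apply/funext => x; rewrite -EFinM; congr EFin.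
  rewrite /mix_term prod_blocks expdotE /g1 /f.
  have -> : \prod_(i < k) ((rising lambda (alpha (fsti i)))^-1 * `|tnth (fst_block le_kn x) i| ^+ alpha (fsti i)) =
      \prod_(i < k) ((rising lambda (alpha (fsti i)))^-1 * `|tnth x (fsti i)| ^+ alpha (fsti i)).
    by apply: eq_bigr => i _; rewrite tnth_mktuple.
  have -> : \prod_(j < n - k) ((rising lambda (alpha (sndi j)))^-1 * (`|tnth x (sndi j)| ^+ alpha (sndi j) * expR (- (th (sndi j) * tnth x (sndi j))))) =
     (\prod_(j < n - k) ((rising lambda (alpha (sndi j)))^-1 * `|tnth x (sndi j)| ^+ alpha (sndi j))) *
     \prod_(j < n - k) expR (- (theta 0 j * tnth (snd_block le_kn x) j)).
    by rewrite -big_split/=; apply: eq_bigr => j _; rewrite thE tnth_mktuple mulrA.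
  ring.
rewrite (block_integral (g := fun u => (g1 u)%:E) (f := f) (a := a)); first last.
- move=> i; rewrite /f /a; under eq_integral do rewrite EFinM.
  rewrite ge0_integralZl_EFin//; last by apply/measurable_EFinP; exact: measurable_moment.
  rewrite (gamma_probability_moment lambda_gt0 (@mI i))// -EFinM; congr EFin.
  have rn : rising lambda (alpha i) != 0 by rewrite gt_eqF// rising_gt0.
  have key (r b1 b2 b3 : R) : r != 0 -> r^-1 * (b1 * b2 * (r * b3)) = b1 * b2 * b3.
    by move=> r0; transitivity (b1 * b2 * b3 * (r^-1 * r)); [ring|rewrite mulVf// mulr1].
  by rewrite exprVn key.
- by move=> i x; rewrite mulr_ge0// mulr_ge0 ?expR_ge0 ?exprn_ge0.
- by move=> i; apply: measurable_funM => //; exact: measurable_moment.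
- by move=> u; rewrite lee_fin.
- exact/measurable_EFinP.
have -> : (\prod_(j < n - k) a (sndi j)) = block_factor * \prod_(j < n - k) (beta (sndi j) + theta 0 j)^-1 ^+ alpha (sndi j).
  by rewrite /block_factor -big_split/=; apply: eq_bigr => j _; rewrite /a thE.
rewrite EFinM -muleA; congr (_ * _)%E.
rewrite -ge0_integralZl_EFin//; last 3 first.
- by move=> x _; rewrite lee_fin.
- by apply/measurable_EFinP; exact: measurableT_comp mg1 measurable_fst_block.
- by rewrite prodr_ge0// => j _; rewrite exprn_ge0// invr_ge0 ltW.
by apply: eq_integral => x _; rewrite -EFinM; congr EFin; rewrite /g1 /block_term; ring.
Qed.
End theta.
End Blocks.

(** * The conditional law *)

Section Conditional.
Variables (R : realType) (k n : nat) (le_kn : (k <= n)%N).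
Variables (lambda : R) (p : {set 'I_n} -> R) (c : {ffun 'I_n -> nat} -> R).
Local Notation beta := (fun i => - ptilde1 p i).
Local Notation fsti := (fst_idx le_kn).
Local Notation sndi := (snd_idx le_kn).
Local Notation bsum := (block_sum le_kn lambda beta c).
Local Notation fstb := (@fst_block k n le_kn R).
Local Notation sndb := (@snd_block k n le_kn R).
Implicit Types (u : k.-tuple R) (theta : 'rV[R]_(n - k)).
Hypothesis lambda_gt0 : 0 < lambda.
Hypothesis beta_gt0 : forall i, 0 < - ptilde1 p i.
Hypothesis c_ge0 : forall alpha, 0 <= c alpha.
Hypothesis c0E : c [ffun=> 0%N] = 1.

Let nonneg theta := forall j, 0 <= theta 0 j.

Let bt theta : nonneg theta -> forall j, 0 < - ptilde1 p (sndi j) + theta 0 j.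
Proof. by move=> t0 j; rewrite ltr_pwDl. Qed.

Let nonneg0 : nonneg 0.
Proof. by move=> j; rewrite mxE. Qed.

Lemma Fterm_block_term u theta alpha : pos_orthant u ->
  Fterm le_kn p lambda c u theta alpha = block_term le_kn lambda beta c u theta alpha.
Proof.
move=> u0; rewrite /Fterm /block_term.
have -> : \prod_(i < k) ((rising lambda (alpha (fsti i)))^-1 * `|tnth u i| ^+ alpha (fsti i)) =
    (\prod_(i < k) tnth u i ^+ alpha (fsti i)) / \prod_(i < k) rising lambda (alpha (fsti i)).
  rewrite -prodfV -big_split/=; apply: eq_bigr => i _.
  by rewrite gtr0_norm ?u0// mulrC.
rewrite [c alpha * _]mulrC; congr (_ * _); apply: eq_bigr => j _.
by rewrite exprVn addrC.
Qed.

Lemma esum_Fterm u theta : pos_orthant u -> nonneg theta ->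
  (\esum_(alpha in csupp c) (Fterm le_kn p lambda c u theta alpha)%:E = bsum u theta)%E.
Proof.
move=> u0 t0; rewrite esum_mkcond; apply: eq_esum => alpha _; rewrite Fterm_block_term//.
case: ifPn => // /negP; rewrite inE /csupp/= => /negP; rewrite negbK => /eqP c0.
by rewrite /block_term c0 !mul0r.
Qed.

Lemma Fterm_ge0 u theta alpha : pos_orthant u -> nonneg theta -> 0 <= Fterm le_kn p lambda c u theta alpha.
Proof.
by move=> u0 t0; rewrite Fterm_block_term//; exact: (block_term_ge0 lambda_gt0 c_ge0 (bt t0)).
Qed.

Lemma Fseries_block_sum u theta : pos_orthant u -> nonneg theta ->
  Fseries le_kn p lambda c u theta = fine (bsum u theta).
Proof.
move=> u0 t0; rewrite /Fseries ge0_real_sum ?esum_Fterm// => alpha _; exact: Fterm_ge0.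
Qed.

Lemma block_sum_le u v theta eta : (forall i, `|tnth u i| <= `|tnth v i|) -> nonneg eta ->
  (forall j, eta 0 j <= theta 0 j) -> (bsum u theta <= bsum v eta)%E.
Proof.
move=> uv e0 et; apply: le_esum => alpha _; rewrite lee_fin /block_term.
have r0 i : 0 <= (rising lambda (alpha (fsti i)))^-1 by rewrite invr_ge0 ltW// rising_gt0.
have t0 : nonneg theta by move=> j; exact: le_trans (et j).
apply: ler_pM.
- by rewrite mulr_ge0// prodr_ge0// => i _; rewrite mulr_ge0// exprn_ge0.
- by rewrite prodr_ge0// => j _; rewrite exprn_ge0// invr_ge0 ltW// bt.
- rewrite ler_wpM2l//; apply: ler_prod => i _; rewrite mulr_ge0 ?exprn_ge0//=.
  by rewrite ler_wpM2l// lerXn2r ?nnegrE.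
- apply: ler_prod => j _; rewrite exprn_ge0 ?invr_ge0 ?(ltW (bt t0 j))//=.
  rewrite lerXn2r ?nnegrE ?invr_ge0 ?(ltW (bt t0 j)) ?(ltW (bt e0 j))//.
  by rewrite lef_pV2 ?posrE ?bt// lerD2l.
Qed.

Lemma block_sum_ge1 u theta : nonneg theta -> (1 <= bsum u theta)%E.
Proof.
move=> t0; apply: esum_ge; exists [set [ffun=> 0%N]]; first by split => //; exact: finite_set1.
rewrite fsbig_set1 /block_term c0E lee_fin mul1r.
rewrite big1 => [|i _]; last first.
  rewrite ffunE expr0 mulr1 /rising addr0 divff ?invr1//.
  by rewrite gt_eqF// Gamma_gt0.
by rewrite big1 ?mulr1// => j _; rewrite ffunE expr0.
Qed.

Lemma Qpoly_block_factor theta : nonneg theta ->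
  Qpoly le_kn p theta `^ (- lambda) = block_factor le_kn lambda beta theta.
Proof.
move=> t0; have q0 j : 0 <= 1 + theta 0 j * (- ptilde1 p (sndi j))^-1.
  by rewrite addr_ge0// mulr_ge0// invr_ge0 ltW.
rewrite /Qpoly -prodr_powR// /block_factor; apply: eq_bigr => j _.
have b0 := beta_gt0 (sndi j).
have -> : 1 + theta 0 j * (- ptilde1 p (sndi j))^-1 =
    (- ptilde1 p (sndi j))^-1 * (- ptilde1 p (sndi j) + theta 0 j).
  by rewrite mulrDr mulVf ?gt_eqF// mulrC.
rewrite powRM ?invr_ge0 ?(ltW b0) ?(ltW (bt t0 j))//; congr (_ * _).
by rewrite -powR_inv1 ?(ltW b0)// -powRrM mulrNN mul1r.
Qed.

Variables (d : measure_display) (Omega : measurableType d) (P : probability Omega R).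
Variable X : Omega -> n.-tuple R.
Hypothesis mX : measurable_fun setT X.
Variables (G : probability (n.-tuple R) R) (K : R).
Hypothesis K_gt0 : 0 < K.
Hypothesis G_null : forall i, G [set x | tnth x i <= 0] = 0%E.
Hypothesis G_gt0 : forall u : 'I_n -> R, (forall i, 0 <= u i) ->
  (0 < G [set x : n.-tuple R | forall i, (u i < tnth x i)%R])%E.
Hypothesis mixture : forall (g : k.-tuple R -> R) theta, measurable_fun setT g ->
  (forall u, 0 <= g u) -> nonneg theta ->
  (\int[P]_w (g (fstb (X w)) * expdot theta (sndb (X w)))%:E =
   (K * block_factor le_kn lambda beta theta)%:E * \int[G]_x ((g (fstb x))%:E * bsum (fstb x) theta))%E.

Let mfst : measurable_fun setT fstb := @measurable_fst_block R k n le_kn.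

Let mbs theta : nonneg theta -> measurable_fun setT (bsum ^~ theta).
Proof. by move=> t0; exact: (measurable_block_sum lambda_gt0 c_ge0 (bt t0)). Qed.

Let bs0 u theta : nonneg theta -> (0 <= bsum u theta)%E.
Proof. by move=> t0; exact: (block_sum_ge0 lambda_gt0 c_ge0 (bt t0)). Qed.

Let mbsx theta : nonneg theta -> measurable_fun setT (fun x => bsum (fstb x) theta).
Proof. by move=> t0; exact: (measurableT_comp (mbs t0) mfst). Qed.

Lemma block_factor0 : block_factor le_kn lambda beta 0 = 1.
Proof.
by rewrite -Qpoly_block_factor// /Qpoly big1 ?powR1// => j _; rewrite mxE mul0r addr0.
Qed.

(** At theta = 0 with g = 1, the mixture formula says that K times the integral is the total mass of
    [P]; other theta only decrease the sum. *)
Lemma integral_block_sum_lty theta : nonneg theta -> (\int[G]_x bsum (fstb x) theta < +oo)%E.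
Proof.
move=> t0; apply: (@le_lt_trans _ _ (\int[G]_x bsum (fstb x) 0)%E).
  apply: ge0_le_integral => //.
  - by move=> x _; exact: bs0.
  - exact: mbsx.
  - exact: mbsx.
  - by move=> x _; apply: block_sum_le => // j; rewrite mxE.
have := @mixture (fun=> 1) 0 (measurable_cst _) (fun=> ler01) nonneg0.
rewrite block_factor0 mulr1.
have -> : (fun w => (1 * expdot 0 (sndb (X w)))%:E) = cst (1%:E : \bar R).
  by apply/funext => w; rewrite expdot0 mulr1.
under [in RHS]eq_integral do rewrite mul1e.
rewrite integral_cst// mul1e => /(etrans (esym (probability_setT P))) E.
rewrite ltey; apply/eqP => I; by move: E; rewrite I gt0_muley ?lte_fin.
Qed.

(** The sum grows with the coordinates: if infinite at u, it would be infinite on an orthant with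
    corner u in the first block, which [G] charges, against integrability. *)
Lemma block_sum_lty u theta : pos_orthant u -> nonneg theta -> (bsum u theta < +oo)%E.
Proof.
move=> u0 t0; rewrite ltey; apply/eqP => I.
pose v : 'I_n -> R := blockwise (fun i : 'I_k => tnth u i) (fun=> 0).
have v0 i : 0 <= v i by rewrite /v /blockwise; case: insubP => // j _ _; rewrite ltW ?u0.
pose A := [set x : n.-tuple R | forall i, v i < tnth x i].
have mA : measurable A.
  rewrite (_ : A = rectangle (fun i => `]v i, +oo[%classic)); first by apply: measurable_rectangle => i; exact: measurable_itv.
  by apply/seteqP; split=> x /= H i; have := H i; rewrite /= in_itv/= andbT.
have := integral_block_sum_lty t0; rewrite ltNge => /negP; apply.
have <- : (\int[G]_(x in A) cst +oo x = +oo)%E by rewrite integral_cst// gt0_mulye// G_gt0.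
apply: (@le_trans _ _ (\int[G]_(x in A) bsum (fstb x) theta)%E).
  apply: ge0_le_integral => //; first by move=> x _; exact: leey.
    by apply: measurable_funTS; exact: mbsx.
  move=> x Ax; rewrite /= -I.
  apply: block_sum_le => // i.
  have := Ax (fsti i); rewrite /v blockwise_fst tnth_mktuple => ux.
  by rewrite !gtr0_norm ?u0 ?ltW//; exact: lt_trans ux.
apply: ge0_subset_integral => //; first exact: mbsx.
by move=> x _; exact: bs0.
Qed.

Lemma Fseries0_gt0 u : pos_orthant u -> 0 < Fseries le_kn p lambda c u 0.
Proof.
move=> u0; rewrite Fseries_block_sum// fine_gt0// block_sum_lty// andbT.
by apply: lt_le_trans (block_sum_ge1 u nonneg0); rewrite lte_fin.
Qed.

Lemma abs_summable_Fterm u theta : pos_orthant u -> nonneg theta ->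
  abs_summable (csupp c) (Fterm le_kn p lambda c u theta).
Proof.
move=> u0 t0; rewrite abs_summableE.
rewrite (eq_esum (b := fun alpha => (Fterm le_kn p lambda c u theta alpha)%:E)); last first.
  by move=> alpha _; rewrite ger0_norm// Fterm_ge0.
by rewrite esum_Fterm// block_sum_lty.
Qed.

Let D := @pos_orthant R k.

Lemma measurable_pos_orthant : measurable D.
Proof.
rewrite (_ : D = rectangle (fun=> `]0%R, +oo[%classic)); first by apply: measurable_rectangle => i; exact: measurable_itv.
by apply/seteqP; split=> x /= H i; have := H i; rewrite /= in_itv/= andbT.
Qed.

Lemma ae_pos_orthant : \forall x \ae G, D (fstb x).
Proof.
have : \forall x \ae G, forall i : 'I_n, 0 < tnth x i.
  apply: filter_forall => i; exists [set x | tnth x i <= 0]; split => //.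
    exact: measurable_tnth_le.
  by move=> x /= /negP; rewrite -leNgt.
by apply: filterS => x H i; rewrite tnth_mktuple.
Qed.

Variable theta : 'rV[R]_(n - k).
Hypothesis t0 : nonneg theta.

Let Fr u eta : R := fine (bsum u eta).
(** The power - 1 stands for the inverse for the sake of measurability; the two agree since the base
    is nonnegative. *)
Let phi u : R := Qpoly le_kn p theta `^ (- lambda) * (Fr u theta * Fr u 0 `^ (-1)).

Let phiE u : D u -> phi u = Qpoly le_kn p theta `^ (- lambda) *
  (Fseries le_kn p lambda c u theta / Fseries le_kn p lambda c u 0).
Proof. by move=> Du; rewrite !Fseries_block_sum// /phi powR_inv1// fine_ge0// bs0. Qed.

Let phi_ge0 u : 0 <= phi u.
Proof. by rewrite /phi !mulr_ge0 ?powR_ge0// fine_ge0// bs0. Qed.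

Let mphi : measurable_fun setT phi.
Proof.
have mFr eta : nonneg eta -> measurable_fun setT (Fr ^~ eta).
  by move=> e0; apply: (measurableT_comp (@fine_measurable R setT measurableT) (mbs e0)).
apply: measurable_funM => //; apply: measurable_funM; first exact: mFr.
by apply: (measurableT_comp (measurable_powR _)); exact: mFr.
Qed.

Let Z w := fstb (X w).
Let Y w := expdot theta (sndb (X w)).

Let mZ : measurable_fun setT Z.
Proof. exact: measurableT_comp mfst mX. Qed.

Let mY : measurable_fun setT Y.
Proof.
apply: (measurableT_comp (measurable_expdot theta)).
exact: measurableT_comp (@measurable_snd_block R k n le_kn) mX.
Qed.

Let restrict_integral (B : set (k.-tuple R)) (f : Omega -> R) :
  (\int[P]_(w in Z @^-1` B) (f w)%:E = \int[P]_w (\1_B (Z w) * f w)%:E)%E.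
Proof.
rewrite integral_mkcond; apply: eq_integral => w _; rewrite patchE indicE.
have -> : (w \in Z @^-1` B) = (Z w \in B) by apply/idP/idP; rewrite !inE.
by case: ifP => _; rewrite ?mul1r ?mul0r.
Qed.

Let mZB B : measurable B -> measurable (Z @^-1` B).
Proof. by move=> mB; rewrite -[X in measurable X]setTI; exact: mZ. Qed.

(** The mixture formula evaluates both sides: the left one at theta with the indicator of B, the
    right one at 0 with that of B and D times [phi]. They agree because [phi] times the sum at 0 is
    the block factor times the sum at theta. *)
Lemma conditional_formula (B : set (k.-tuple R)) : measurable B ->
  (\int[P]_(w in Z @^-1` B) (Y w)%:E = \int[P]_(w in Z @^-1` (B `&` D)) (phi (Z w))%:E)%E.
Proof.
move=> mB; have mBD : measurable (B `&` D) by apply: measurableI => //; exact: measurable_pos_orthant.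
have mi1 (C : set (k.-tuple R)) : measurable C -> measurable_fun setT (\1_C : k.-tuple R -> R).
  by move=> mC; exact: measurable_indic.
rewrite !restrict_integral (@mixture (\1_B) theta (mi1 _ mB) (fun=> ler0n _ _) t0).
have mg : measurable_fun setT (fun u => \1_(B `&` D) u * phi u).
  by apply: measurable_funM => //; exact: measurable_indic.
have := @mixture _ 0 mg (fun u => mulr_ge0 (ler0n _ _) (phi_ge0 u)) nonneg0.
rewrite block_factor0 mulr1.
have -> : (fun w => (\1_(B `&` D) (fstb (X w)) * phi (fstb (X w)) * expdot 0 (sndb (X w)))%:E) =
    fun w => (\1_(B `&` D) (Z w) * phi (Z w))%:E.
  by apply/funext => w; rewrite expdot0 mulr1.
move=> ->.
have bf0 : 0 <= block_factor le_kn lambda beta theta by rewrite -Qpoly_block_factor// powR_ge0.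
rewrite EFinM -muleA; congr (_ * _)%E.
have mind (C : set (k.-tuple R)) : measurable C -> measurable_fun setT (fun x : n.-tuple R => (\1_C (fstb x))%:E : \bar R).
  move=> mC; apply/measurable_EFinP; apply: (measurableT_comp (mi1 _ mC)).
  exact: mfst.
rewrite -ge0_integralZl_EFin//; last 2 first.
- by move=> x _; rewrite mule_ge0 ?lee_fin// bs0.
- by apply: emeasurable_funM; [exact: mind|exact: mbsx].
apply: ge0_ae_eq_integral => //.
- by apply: emeasurable_funM => //; apply: emeasurable_funM; [exact: mind|exact: mbsx].
- apply: emeasurable_funM; last exact: mbsx.
  by apply/measurable_EFinP; exact: (measurableT_comp mg mfst).
- by move=> x _; rewrite !mule_ge0 ?lee_fin// bs0.
- by move=> x _; rewrite mule_ge0 ?bs0// lee_fin mulr_ge0.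
apply: filterS ae_pos_orthant => x Dx _.
rewrite !indicE in_setI (mem_set Dx) andbT; case: (_ \in B); last by rewrite mul0r !mul0e mule0.
rewrite mul1e mul1r /phi Qpoly_block_factor//.
have fF eta : nonneg eta -> bsum (fstb x) eta = (Fr (fstb x) eta)%:E.
  by move=> e0; rewrite fineK// ge0_fin_numE ?bs0// block_sum_lty.
rewrite !fF// -!EFinM; congr EFin.
have F0 : 0 < Fr (fstb x) 0 by rewrite /Fr -Fseries_block_sum// Fseries0_gt0.
by rewrite powR_inv1 ?(ltW F0)// -!mulrA mulVf ?gt_eqF// mulr1.
Qed.

Lemma conditional_laplace : cond_exp_version P Z Y D
  (fun u => Qpoly le_kn p theta `^ (- lambda) *
     (Fseries le_kn p lambda c u theta / Fseries le_kn p lambda c u 0)).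
Proof.
have mD := measurable_pos_orthant.
have EY : (\int[P]_w (Y w)%:E < +oo)%E.
  have := @mixture (fun=> 1) theta (measurable_cst _) (fun=> ler01) t0.
  have -> : (fun w => (1 * expdot theta (sndb (X w)))%:E) = fun w => (Y w)%:E.
    by apply/funext => w; rewrite mul1r.
  move=> ->; under eq_integral do rewrite mul1e.
  rewrite lte_mul_pinfty ?integral_block_sum_lty// lee_fin mulr_ge0 ?(ltW K_gt0)//.
  by rewrite -Qpoly_block_factor// powR_ge0.
have phiZ B : (\int[P]_(w in Z @^-1` (B `&` D)) (Qpoly le_kn p theta `^ (- lambda) *
     (Fseries le_kn p lambda c (Z w) theta / Fseries le_kn p lambda c (Z w) 0))%:E =
     \int[P]_(w in Z @^-1` (B `&` D)) (phi (Z w))%:E)%E.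
  by apply: eq_integral => w; rewrite inE => -[_ Dw]; rewrite phiE.
split.
- split => //.
  have mDC : measurable (~` D) by exact: measurableC.
  have E : (\int[P]_(w in Z @^-1` (~` D)) (cst 1 w)%:E = P (Z @^-1` (~` D)))%E.
    rewrite -[LHS]/(\int[P]_(w in Z @^-1` (~` D)) (cst 1%:E w))%E.
    by rewrite integral_cst ?mul1e//; exact: mZB.
  rewrite -E restrict_integral.
  have mi : measurable_fun setT (\1_(~` D) : k.-tuple R -> R) by exact: measurable_indic.
  have := @mixture (\1_(~` D)) 0 mi (fun=> ler0n _ _) nonneg0.
  have -> : (fun w => (\1_(~` D) (fstb (X w)) * expdot 0 (sndb (X w)))%:E) =
      fun w => (\1_(~` D) (Z w) * cst 1 w)%:E.
    by apply/funext => w; rewrite expdot0.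
  move=> ->; rewrite (@ge0_ae_eq_integral _ _ _ G setT _ (cst 0%E)) ?integral_cst ?mul0e ?mule0//.
  + apply: emeasurable_funM; last exact: mbsx.
    apply/measurable_EFinP; apply: (measurableT_comp mi).
    exact: mfst.
  + by move=> x _; rewrite mule_ge0 ?lee_fin ?bs0.
  + apply: filterS ae_pos_orthant => x Dx _.
    by rewrite indicE in_setC (mem_set Dx) mul0e.
- apply/integrableP; split; first exact/measurable_EFinP.
  by under eq_integral do rewrite gee0_abs ?lee_fin ?expR_ge0//.
- apply: (eq_measurable_fun phi); first by move=> u; rewrite inE => Du; rewrite phiE.
  exact: measurable_funTS.
- apply/integrableP; split.
    apply: (eq_measurable_fun (fun w => (phi (Z w))%:E)); first by move=> w; rewrite inE => Dw /=; rewrite phiE.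
    by apply: measurable_funTS; apply/measurable_EFinP; exact: measurableT_comp mphi mZ.
  (* [phi] is nonnegative, so integrability follows from [EY] and the conditional formula with B the
     full space. *)
  rewrite (eq_integral (fun w => (phi (Z w))%:E)); last first.
    by move=> w; rewrite inE => Dw /=; rewrite -phiE// ger0_norm.
  by have := conditional_formula measurableT; rewrite setTI preimage_setT => <-.
- by move=> B mB; rewrite phiZ; exact: conditional_formula.
Qed.
End Conditional.

Theorem theorem23 (R : realType) (n k : nat)
    (n_ge2 : (2 <= n)%N) (k_ge1 : (1 <= k)%N) (k_lt_n : (k < n)%N)
    (lambda : R) (lambda_gt0 : 0 < lambda)
    (p : {set 'I_n} -> R)
    (p_set0 : p (finset.set0 : {set 'I_n}) = 1)
    (p_neq0 : forall T : {set 'I_n}, p T != 0)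
    (p_init_gt0 : forall j : nat, (1 <= j <= n)%N ->
      0 < p [set i : 'I_n | (i < j)%N]%SET)
    (d : measure_display) (Omega : measurableType d) (P : probability Omega R)
    (X : {RV P >-> n.-tuple R})
    (Theta : set 'rV[R]_n) (Theta_dom : laplace_domain p Theta)
    (X_gamma : mgamma p lambda Theta (distribution P X))
    (gamma_infdiv : mgamma_infdiv p lambda Theta)
    (c : {ffun 'I_n -> nat} -> R)
    (c_coef : power_series_at0 c (fun z => (1 - Rpoly p z) `^ (- lambda))) :
  let le_kn := ltnW k_lt_n in
  (forall x : k.-tuple R, pos_orthant x ->
     Fseries le_kn p lambda c x 0 != 0 /\
     forall theta : 'rV[R]_(n - k), (forall i, 0 <= theta 0 i) ->
       abs_summable (csupp c) (Fterm le_kn p lambda c x theta)) /\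
  (forall theta : 'rV[R]_(n - k), (forall i, 0 <= theta 0 i) ->
     cond_exp_version P
       (fun w => fst_block le_kn (X w))
       (fun w => expdot theta (snd_block le_kn (X w)))
       (@pos_orthant R k)
       (fun x => Qpoly le_kn p theta `^ (- lambda) *
          (Fseries le_kn p lambda c x theta / Fseries le_kn p lambda c x 0))).
Proof.
move=> le_kn.
pose mu : {measure set (n.-tuple R) -> \bar R} := distribution P X.
have mu1 : mu setT = 1%E by exact: probability_setT.
have [[th0 /nbhs_ballP[e /= e0 sub]] Theta_pos] := Theta_dom.
have boxT theta : box th0 e theta -> Theta theta.
  by move=> bt; apply: sub; split => // i j; rewrite ord1 /ball/= distrC; exact: bt.
have law_of s m : mgamma p s Theta m -> laplace_law p s m (box th0 e).
  by move=> H theta /boxT tT; split; [exact: Theta_pos|exact: H].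
have mu_box : laplace_law p lambda mu (box th0 e) by exact: law_of.
have [p_gt0 slope_gt0] := affine_gamma_positive lambda_gt0 p_neq0 p_init_gt0 e0 mu1 mu_box.
have infdiv t : 0 < t -> exists m : {measure set (n.-tuple R) -> \bar R}, laplace_law p (lambda * t) m (box th0 e).
  by move=> /gamma_infdiv[m /law_of]; exists m.
have derivs := qcoef_ders_ge0 lambda_gt0 p_gt0 e0 slope_gt0 infdiv.
have [mu0 mu_ext] := laplace_law_extended e0 slope_gt0 lambda_gt0 mu_box.
have q00 : affine_poly (qcoef p) 0 = 1 by rewrite affine_poly0 qcoef0// gt_eqF.
have [e1 e10 H1] := near0_box c_coef.
(* q(0) = 1, so q is positive near 0; the radius is then made common with that of the given
   expansion. *)
have [e2 e20 H2] : exists2 e2 : R, 0 < e2 & forall z : 'rV[R]_n, (forall i, `|z 0 i| < e2) -> 0 < affine_poly (qcoef p) z.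
  apply: near0_box; have := @continuous_affine_poly R n (qcoef p) 0.
  by move=> /cvgr_gt; apply; rewrite q00.
pose e3 := Num.min e1 e2.
have e30 : 0 < e3 by rewrite lt_min e10.
have qe (z : 'rV[R]_n) : (forall i, `|z 0 i| < e3) -> 0 < affine_poly (qcoef p) z.
  by move=> hz; apply: H2 => i; have := hz i; rewrite lt_min => /andP[].
have ce (z : 'rV[R]_n) : (forall i, `|z 0 i| < e3) ->
    abs_summable setT (fun alpha => c alpha * \prod_(i < n) z 0 i ^+ alpha i) /\
    affine_poly (qcoef p) z `^ (- lambda) = real_sum setT (fun alpha => c alpha * \prod_(i < n) z 0 i ^+ alpha i).
  move=> hz; have [|A B] := H1 z; first by move=> i; have := hz i; rewrite lt_min => /andP[].
  by split => //; rewrite -B one_sub_Rpoly// gt_eqF.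
have c_ge0 := power_series_coef_ge0 e30 qe ce derivs.
have c0E : c [ffun=> 0%N] = 1 by rewrite (power_series_coef0 e30 qe ce) q00 powR1.
pose beta i := - ptilde1 p i.
have beta_gt0 i : 0 < beta i by rewrite /beta /ptilde1 /ptilde opprK divr_gt0.
pose M := \sum_i `|th0 0 i - e|.
have mu_law : laplace_law p lambda mu [set theta | forall i, M < theta 0 i].
  move=> theta ht; apply: mu_ext => i; apply: le_lt_trans (ht i).
  by rewrite (le_trans (ler_norm _))// /M (bigD1 i)//= lerDl sumr_ge0.
have /choice[m mI] i := gamma_probability lambda_gt0 (beta_gt0 i).
have [G GI] := tuple_product_measure m.
pose K := mix_mass lambda beta p.
have K0 : 0 < K by rewrite powR_gt0// mulr_gt0// prodr_gt0.
have mX : measurable_fun setT X by exact: measurable_funPT.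
have mixture (g : k.-tuple R -> R) (theta : 'rV[R]_(n - k)) : measurable_fun setT g ->
    (forall u, 0 <= g u) -> (forall j, 0 <= theta 0 j) ->
    (\int[P]_w (g (fst_block le_kn (X w)) * expdot theta (snd_block le_kn (X w)))%:E =
     (K * block_factor le_kn lambda beta theta)%:E *
     \int[G]_x ((g (fst_block le_kn x))%:E * block_sum le_kn lambda beta c (fst_block le_kn x) theta))%E.
  move=> mg g0 t0.
  pose h (x : n.-tuple R) := (g (fst_block le_kn x) * expdot theta (snd_block le_kn x))%:E.
  have mh : measurable_fun setT h.
    apply/measurable_EFinP; apply: measurable_funM.
      exact: (measurableT_comp mg (@measurable_fst_block R k n le_kn)).
    exact: (measurableT_comp (measurable_expdot theta) (@measurable_snd_block R k n le_kn)).
  have h0 x : (0 <= h x)%E by rewrite lee_fin mulr_ge0 ?expR_ge0.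
  have <- := ge0_integral_distribution X mh h0.
  have ce' (z : 'rV[R]_n) (hz : forall i, `|z 0 i| < e3) := conj (qe z hz) (ce z hz).
  rewrite (gamma_mixture lambda_gt0 beta_gt0 mI GI c_ge0 (p_gt0 _) (fun=> erefl) e30 ce' mu0 mu_law mh h0).
  have bt j : 0 < beta (snd_idx le_kn j) + theta 0 j by rewrite ltr_pwDl.
  rewrite EFinM -muleA -(block_mixture lambda_gt0 beta_gt0 mI GI c_ge0 bt mg g0).
  rewrite -ge0_integralZl_EFin//; last 3 first.
  - move=> x _; apply: mule_ge0; [exact: h0|exact: (mix_density_ge0 lambda_gt0 c_ge0)].
  - by apply: emeasurable_funM => //; exact: (measurable_mix_density lambda_gt0 c_ge0).
  - exact: ltW.
  by apply: eq_integral => x _; rewrite muleCA.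
have G_null := gamma_product_null mI GI.
have G_gt0 := gamma_product_gt0 lambda_gt0 beta_gt0 mI GI.
split=> [x x0|theta t0].
  split; first by apply: lt0r_neq0; exact: (Fseries0_gt0 lambda_gt0 beta_gt0 c_ge0 c0E K0 G_gt0 mixture).
  by move=> theta t0; exact: (abs_summable_Fterm lambda_gt0 beta_gt0 c_ge0 K0 G_gt0 mixture).
exact: (conditional_laplace lambda_gt0 beta_gt0 c_ge0 c0E mX K0 G_null G_gt0 mixture).
Qed.
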